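(* For all $n\in\mathbb N\cup\{\infty\}$, the $\mathbb Z\langle T\rangle$-submodule $\mathbb T_{\mathbb Z\langle T\rangle}(n,T)\subseteq\mathbb S_{\mathbb Q(T)}(n,T)$, defined as the $\mathbb Z\langle T\rangle$-span of $$\mathcal{CB}(n)_T=\bigcup_{\lambda\in\Lambda^+(n)_T}\Big\{\xi_q\xi_r\ \Big|\ \xi_q\in\bigcup_{\delta\in\Lambda(n)_T}Y(\delta,\lambda)_T,\ \xi_r\in\bigcup_{\beta\in\Lambda(n)_T}X(\lambda,\beta)_T\Big\},$$ is a $\mathbb Z\langle T\rangle$-algebra (that is, it is closed under the multiplication of $\mathbb S_{\mathbb Q(T)}(n,T)$).
   Context: $\mathbb Z\langle T\rangle=\{p(T)\in\mathbb Q[T]\mid p(\mathbb Z)\subseteq\mathbb Z\}$ is the ring of integer-valued polynomials. Combinatorics (for $t$ in a characteristic zero field $\Bbbk$; here $\Bbbk=\mathbb Q(T)$, $t=T$). $\mathbb N=\{1,2,\dots\}$ and $[1,n]=\{1,\dots,n\}$ ($[1,\infty]=\mathbb N$). $\Lambda(n)_t$ is the set of sequences $\beta=(\beta_i)_{i\in[1,n]}$ with $\beta_1\in t-\mathbb Z$, $\beta_i\in\mathbb Z_{\ge 0}$ for $i\ge 2$ (all but finitely many equal to $0$), and $\sum_i\beta_i=t$. $\Lambda^+(n)_t=\{\beta\in\Lambda(n)_t\mid\beta_2\ge\beta_3\ge\cdots\}$. For $\beta,\delta\in\Lambda(n)_t$, $\mathcal{M}at_n(\delta,\beta)_t$ is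 the set of matrices $q=(q_{i,j})_{i,j\in[1,n]}$ with $q_{1,1}\in t-\mathbb Z$, all other $q_{i,j}\in\mathbb Z_{\ge0}$, $\sum_{i,j}q_{i,j}=t$, column sums $\sum_i q_{i,j}=\beta_j$ and row sums $\sum_j q_{i,j}=\delta_i$. $q^*$ denotes the transpose. Semistandard matrices. For an integer $d$, $\lambda(d)$ (resp. $q(d)$) is obtained from $\lambda\in\Lambda(n)_t$ (resp. a matrix $q$) by adding $d-t$ to $\lambda_1$ (resp. $q_{1,1}$). Let $\lambda\in\Lambda^+(n)_t$ and $q\in\mathcal{M}at_n(\lambda,\beta)_t$. For $d$ large, $\lambda(d)$ is a partition of $d$ and $q(d)$ has nonnegative integer entries; the filling of the Young diagram $Y^{\lambda(d)}$ (with $\lambda(d)_i$ left-justified boxes in row $i$) by $q(d)$ is the tableau whose $i$th row contains $q(d)_{i,j}$ entries equal to $j$ for each $j$, arranged weakly increasingly. $q$ is called semistandard if, for all sufficiently large $d$, this filling is strictly increasing down columns. Set $X(\lambda,\beta)_t=\{\xi_r\mid r\in\mathcal{M}at_n(\lambda,\beta)_t\text{ semistandard}\}$ and $Y(\delta,\lambda)_t=\{\xi_q\mid q\in\mathcal{M}at_n(\delta,\lambda)_t,\ q^*\text{ semistandard}\}$. The category. $\mathfrak S_\infty$ is the group of all bijections of $\Omega=\mathbb N$, with the topology in which the pointwise stabilizers of finite subsets of $\Omega$ form a base of open neighborhoods of the identity. An action of an open subgroup $U$ on a set is smooth if all point stabilizers are open. A finitary $\widehat{\mathfrak S}_\infty$-set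 is a set with a smooth action of some open subgroup $U\subseteq\mathfrak S_\infty$ having finitely many orbits (one may shrink $U$); a finitary $\mathfrak S_\infty$-set is a smooth $\mathfrak S_\infty$-set with finitely many orbits. Let $\mathfrak S(p)$ be the pointwise stabilizer of $\{1,\dots,p\}$. For a finitary $\widehat{\mathfrak S}_\infty$-set $X$ there is a unique polynomial $p_X$ with rational coefficients with $p_X(p)=|X^{\mathfrak S(p)}|$ for all sufficiently large integers $p$; set $\mu_t(X)=p_X(t)$. If $f:X\to\Bbbk$ is constant on the orbits of such an open subgroup, put $\int_X f(x)\,dx=\sum_c c\,\mu_t(f^{-1}(c))$, the sum being over the finitely many values $c$ of $f$. The category $\operatorname{Perm}(\mathfrak S_\infty;\mu_t)$ has as objects the finitary $\mathfrak S_\infty$-sets; $\operatorname{Hom}(X,Y)$ is the space of functions $Y\times X\to\Bbbk$ constant on the diagonal $\mathfrak S_\infty$-orbits; composition is $(g\circ f)(z,x)=\int_Y g(z,y)f(y,x)\,dy$. The algebra. For $\beta\in\Lambda(n)_t$ and $k\ge2$ let $\{\beta\}_k=[1+\sum_{i=2}^{k-1}\beta_i,\ \sum_{i=2}^{k}\beta_i]\subset\Omega$ and $\{\beta\}_1=\Omega\setminus\bigcup_{k\ge2}\{\beta\}_k$. $\mathfrak S_\beta\le\mathfrak S_\infty$ is the subgroup preserving each $\{\beta\}_k$, and $\mathcal X^\beta=\mathfrak S_\infty/\mathfrak S_\beta$. $\mathbb S_{\Bbbk}(n,t)=\bigoplus_{\beta,\delta\in\Lambda(n)_t}\operatorname{Hom}_{\operatorname{Perm}(\mathfrak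 S_\infty;\mu_t)}(\mathcal X^\beta,\mathcal X^\delta)$, with product given by composition (zero if not composable). For $q\in\mathcal{M}at_n(\delta,\beta)_t$, $\xi_q\in\operatorname{Hom}(\mathcal X^\beta,\mathcal X^\delta)$ is the indicator function of the $\mathfrak S_\infty$-orbit of $(\mathfrak S_\delta,\sigma\mathfrak S_\beta)$ in $\mathcal X^\delta\times\mathcal X^\beta$, where $\sigma$ is any element with $|\{\delta\}_i\cap\sigma(\{\beta\}_j)|=q_{i,j}$ for all $(i,j)\ne(1,1)$. *)

(* Defs.v *)
From HB Require Import structures.
From mathcomp Require Import all_boot all_order all_algebra.
From mathcomp Require Import boolp classical_sets functions cardinality fsbigop.
Set Implicit Arguments.
Unset Strict Implicit.
Unset Printing Implicit Defensive.
Import Order.TTheory GRing.Theory Num.Theory.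
Local Open Scope classical_set_scope.
Local Open Scope card_scope.
Local Open Scope ring_scope.

Notation QT := {fraction {poly rat}}.
Notation "p %:F" := (@FracField.tofrac {poly rat} p) : ring_scope.
Definition TT : QT := ('X : {poly rat})%:F.

(* A polynomial [p : {poly rat}] is read as the element [p(T)] of Q(T),
   i.e. as [p%:F]. *)
Definition integer_valued (p : {poly rat}) : Prop :=
  forall z : int, p.[z%:~R] \is a Num.int.

Lemma QT_natr_inj (a b : nat) : a%:R = b%:R :> QT -> a = b.
Proof.
rewrite -!(rmorph_nat (@FracField.tofrac {poly rat})) => /eqP.
rewrite tofrac_eq -!polyC_natr => /eqP /polyC_inj /eqP.
by rewrite eqr_nat => /eqP.
Qed.

Definition Omega := {w : nat | (0 < w)%N}.

Record Sinf := MkSinf {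
  sfwd :> Omega -> Omega;
  sbwd : Omega -> Omega;
  sfwdK : cancel sfwd sbwd;
  sbwdK : cancel sbwd sfwd }.

Lemma Sinf_ext (s t : Sinf) : (forall w, s w = t w) -> s = t.
Proof.
case: s t => [f f' fK f'K] [g g' gK g'K] /= fg.
have efg : f = g by apply/funext.
subst g.
have e' : f' = g' by apply/funext => w; rewrite -{1}(g'K w) fK.
subst g'.
by congr MkSinf; exact: Prop_irrelevance.
Qed.

HB.instance Definition _ := gen_eqMixin Sinf.
HB.instance Definition _ := gen_choiceMixin Sinf.

Definition Sinf_one : Sinf := @MkSinf id id (fun=> erefl) (fun=> erefl).
Definition Sinf_inv (s : Sinf) : Sinf := MkSinf (@sbwdK s) (@sfwdK s).
(* Composition of functions: [s * t] applies [t] first. *)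
Definition Sinf_mul (s t : Sinf) : Sinf :=
  @MkSinf (s \o t) (sbwd t \o sbwd s)
    (can_comp (@sfwdK s) (@sfwdK t)) (can_comp (@sbwdK t) (@sbwdK s)).

Lemma Sinf_mulA : associative Sinf_mul.
Proof. by move=> s t u; apply: Sinf_ext. Qed.
Lemma Sinf_mul1 : left_id Sinf_one Sinf_mul.
Proof. by move=> s; apply: Sinf_ext. Qed.
Lemma Sinf_mulr1 : right_id Sinf_one Sinf_mul.
Proof. by move=> s; apply: Sinf_ext. Qed.
Lemma Sinf_mulV : left_inverse Sinf_one Sinf_inv Sinf_mul.
Proof. by move=> s; apply: Sinf_ext => w /=; rewrite sfwdK. Qed.
Lemma Sinf_mulrV : right_inverse Sinf_one Sinf_inv Sinf_mul.
Proof. by move=> s; apply: Sinf_ext => w /=; rewrite sbwdK. Qed.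

HB.instance Definition _ := isGroup.Build Sinf
  Sinf_mulA Sinf_mul1 Sinf_mulr1 Sinf_mulV Sinf_mulrV.

Lemma SinfM (s t : Sinf) w : (s * t)%g w = s (t w).
Proof. by []. Qed.

Definition pstab (A : set Omega) : set Sinf :=
  [set s | forall w, A w -> s w = w].

(* The pointwise stabilizers of finite sets are a base at the identity, so
   their left cosets form a base of the topology. *)
Definition open_Sinf (O : set Sinf) : Prop :=
  forall s, O s -> exists2 A : set Omega, finite_set A &
    forall u, pstab A u -> O (s * u)%g.

Definition initseg (p : nat) : set Omega := [set w | (val w <= p)%N].

Record finitary_set := FinitarySet {
  fcar :> Type;
  fact : Sinf -> fcar -> fcar;
  fact1 : forall x, fact 1%g x = x;
  factM : forall s t x, fact (s * t)%g x = fact s (fact t x);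
  fact_smooth : forall x, open_Sinf [set s | fact s x = x];
  fact_finorb :
    finite_set [set O : set fcar | exists x, O = [set fact s x | s in setT]] }.

Definition fixed_points (X : finitary_set) (A : set X) (p : nat) : set X :=
  A `&` [set x | forall s, pstab (initseg p) s -> fact s x = x].

(* The sets to be measured are subsets [A] of a finitary set that are stable
   under some open subgroup; [count_poly] is then the only member of the set
   below, and the default value of [xget] plays no role. *)
Definition count_poly (X : finitary_set) (A : set X) : {poly rat} :=
  xget 0 [set P : {poly rat} | exists N : nat, forall p : nat, (N <= p)%N ->
    exists2 m : nat, fixed_points A p #= `I_m & P.[p%:R] = m%:R].

Definition muT (X : finitary_set) (A : set X) : QT := (count_poly A)%:F.

Definition integral (X : finitary_set) (f : X -> QT) : QT :=
  \sum_(c \in range f) (c * muT (f @^-1` [set c])).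

Record Hom (X Y : finitary_set) := MkHom {
  hfun :> Y -> X -> QT;
  hfunP : forall s y x, hfun (fact s y) (fact s x) = hfun y x }.

Lemma Hom_ext X Y (f g : Hom X Y) : (forall y x, f y x = g y x) -> f = g.
Proof.
case: f g => [f fP] [g gP] /= fg.
have efg : f = g by apply/funext => y; apply/funext => x.
by subst g; congr MkHom; exact: Prop_irrelevance.
Qed.

HB.instance Definition _ X Y := gen_eqMixin (Hom X Y).
HB.instance Definition _ X Y := gen_choiceMixin (Hom X Y).

Section HomModule.
Variables X Y : finitary_set.
Implicit Types f g : Hom X Y.

Definition Hom_zero : Hom X Y.
Proof. by exists (fun _ _ => 0). Defined.
Definition Hom_opp f : Hom X Y.
Proof. by exists (fun y x => - f y x) => s y x; rewrite hfunP. Defined.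
Definition Hom_add f g : Hom X Y.
Proof. by exists (fun y x => f y x + g y x) => s y x; rewrite !hfunP. Defined.
Definition Hom_scale (a : QT) f : Hom X Y.
Proof. by exists (fun y x => a * f y x) => s y x; rewrite hfunP. Defined.

Lemma Hom_addA : associative Hom_add.
Proof. by move=> f g h; apply: Hom_ext => y x /=; rewrite addrA. Qed.
Lemma Hom_addC : commutative Hom_add.
Proof. by move=> f g; apply: Hom_ext => y x /=; rewrite addrC. Qed.
Lemma Hom_add0 : left_id Hom_zero Hom_add.
Proof. by move=> f; apply: Hom_ext => y x /=; rewrite add0r. Qed.
Lemma Hom_addN : left_inverse Hom_zero Hom_opp Hom_add.
Proof. by move=> f; apply: Hom_ext => y x /=; rewrite addNr. Qed.

HB.instance Definition _ := GRing.isZmodule.Build (Hom X Y)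
  Hom_addA Hom_addC Hom_add0 Hom_addN.

Lemma Hom_scaleA a b f : Hom_scale a (Hom_scale b f) = Hom_scale (a * b) f.
Proof. by apply: Hom_ext => y x /=; rewrite mulrA. Qed.
Lemma Hom_scale1 : left_id 1 Hom_scale.
Proof. by move=> f; apply: Hom_ext => y x /=; rewrite mul1r. Qed.
Lemma Hom_scaleDr : right_distributive Hom_scale +%R.
Proof. by move=> a f g; apply: Hom_ext => y x /=; rewrite mulrDr. Qed.
Lemma Hom_scaleDl f : {morph Hom_scale^~ f : a b / a + b}.
Proof. by move=> a b; apply: Hom_ext => y x /=; rewrite mulrDl. Qed.

HB.instance Definition _ := GRing.Zmodule_isLmodule.Build QT (Hom X Y)
  Hom_scaleA Hom_scale1 Hom_scaleDr Hom_scaleDl.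

End HomModule.

Definition Omega_swap (a b w : Omega) : Omega :=
  if w == a then b else if w == b then a else w.
Lemma Omega_swapK a b : involutive (Omega_swap a b).
Proof.
move=> w; rewrite /Omega_swap; case: (eqVneq w a) => [->|wa].
  by case: (eqVneq b a) => [->|]; rewrite ?eqxx.
by case: (eqVneq w b) => [->|wb]; rewrite ?eqxx // (negPf wa) (negPf wb).
Qed.
Definition Sinf_swap a b : Sinf := MkSinf (@Omega_swapK a b) (@Omega_swapK a b).

Lemma Sinf_extend (s : Sinf) (p : nat) (l : seq Omega) :
  {in l, forall w, (val w <= p)%N} -> {in l, forall w, (val (s w) <= p)%N} ->
  exists g : Sinf, (forall w, (val (g w) <= p)%N = (val w <= p)%N) /\
    {in l, g =1 s}.
Proof.
elim: l => [|a l IH] lp slp; first by exists 1%g.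
have [||g [gp gs]] := IH.
- by move=> w wl; apply: lp; rewrite inE wl orbT.
- by move=> w wl; apply: slp; rewrite inE wl orbT.
have ap := lp a (mem_head _ _); have sap := slp a (mem_head _ _).
exists (Sinf_swap (g a) (s a) * g)%g; split=> [w|w].
  rewrite SinfM -[RHS]gp /= /Omega_swap.
  case: (eqVneq (g w) (g a)) => [->|_]; first by rewrite sap gp ap.
  by case: (eqVneq (g w) (s a)) => [->|_] //; rewrite gp sap ap.
rewrite inE SinfM /= /Omega_swap => /predU1P[->|wl]; first by rewrite eqxx.
case: (eqVneq (g w) (g a)) => [/(can_inj (@sfwdK g)) ->|ga] //.
rewrite gs //; case: eqVneq => // /(can_inj (@sfwdK s)) wa.
by rewrite wa eqxx in ga.
Qed.

Lemma initsegP (g : Sinf) p :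
  (forall w, (val (g w) <= p)%N = (val w <= p)%N) ->
  forall s, pstab (initseg p) s -> pstab (initseg p) (g^-1 * s * g)%g.
Proof.
move=> gp s sp w wp; rewrite !SinfM sp; last by rewrite /initseg /= gp.
by rewrite -SinfM mulVg.
Qed.

Lemma factK (X : finitary_set) (s : Sinf) (x : X) : fact s^-1%g (fact s x) = x.
Proof. by rewrite -factM mulVg fact1. Qed.
Lemma factVK (X : finitary_set) (s : Sinf) (x : X) : fact s (fact s^-1%g x) = x.
Proof. by rewrite -factM mulgV fact1. Qed.

Lemma finite_Omega_seq (F : set Omega) : finite_set F ->
  exists l : seq Omega, forall w, F w <-> w \in l.
Proof. by move=> /finite_seqP[l ->]; exists l. Qed.

Lemma fixed_points_translate (X : finitary_set) (A : set X) (F : set Omega)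
    (s : Sinf) : finite_set F ->
  (forall u, pstab F u -> forall x, A (fact u x) <-> A x) ->
  exists N : nat, forall p, (N <= p)%N ->
    fixed_points A p #= fixed_points [set x | A (fact s^-1%g x)] p.
Proof.
move=> /finite_Omega_seq[l lF] Ast.
exists (\max_(w <- l) maxn (val w) (val (s w))) => p Np.
have lp : {in l, forall w, (maxn (val w) (val (s w)) <= p)%N}.
  by move=> w wl; apply: leq_trans Np; rewrite (big_rem w) //= leq_maxl.
have [||g [gp gs]] := @Sinf_extend s p l.
- by move=> w /lp; rewrite geq_max => /andP[].
- by move=> w /lp; rewrite geq_max => /andP[].
have gVp w : (val (g^-1%g w) <= p)%N = (val w <= p)%N.
  by rewrite -gp -SinfM mulgV.
have uF : pstab F (s^-1 * g)%g.
  by move=> w /lF wl; rewrite SinfM gs // -SinfM mulVg.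
have -> : fixed_points [set x | A (fact s^-1%g x)] p
        = fact g @` fixed_points A p.
  apply/seteqP; split=> [y [Ay yp]|_ [x [Ax xp] <-]].
    exists (fact g^-1%g y); last exact: factVK.
    split=> [|t tp].
      by apply/(Ast _ uF); rewrite -factM -mulgA mulgV mulg1.
    rewrite -{2}(yp _ (initsegP gVp tp)) invgK -!factM.
    by rewrite !mulgA mulVg mul1g.
  split=> [|t tp] /=; first by rewrite -factM; apply/(Ast _ uF).
  rewrite -{2}(xp _ (initsegP gp tp)) -!factM.
  by rewrite !mulgA mulgV mul1g.
rewrite card_eq_sym; apply: inj_card_eq => x y _ _ gxy.
by rewrite -(factK g x) gxy factK.
Qed.

Lemma count_poly_translate (X : finitary_set) (A : set X) (F : set Omega)
    (s : Sinf) : finite_set F ->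
  (forall u, pstab F u -> forall x, A (fact u x) <-> A x) ->
  count_poly [set x | A (fact s^-1%g x)] = count_poly A.
Proof.
move=> Ffin Ast; have [M AM] := fixed_points_translate s Ffin Ast.
congr (xget 0 _); apply/seteqP.
split=> P [N PN]; exists (maxn M N) => p; rewrite geq_max => /andP[Mp Np];
  have [m Am Pm] := PN p Np; exists m => //.
  exact: card_eq_trans (AM p Mp) Am.
by apply: card_eq_trans Am; rewrite card_eq_sym; apply: AM.
Qed.

Lemma integral_translate (X : finitary_set) (f : X -> QT) (F : set Omega)
    (s : Sinf) : finite_set F ->
  (forall u, pstab F u -> forall x, f (fact u x) = f x) ->
  integral (fun x => f (fact s^-1%g x)) = integral f.
Proof.
move=> Ffin fst; rewrite /integral.
have -> : range (fun x => f (fact s^-1%g x)) = range f.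
  apply/seteqP; split=> [_ [x _ <-]|_ [x _ <-]]; first by eexists.
  by exists (fact s x) => //; rewrite factK.
apply: eq_fsbigr => c _; congr (_ * (_)%:F).
rewrite -[RHS](@count_poly_translate _ _ F s) // => u uF x /=.
by rewrite fst.
Qed.

Definition comp_fun (X Y Z : finitary_set) (g : Hom Y Z) (f : Hom X Y)
    (z : Z) (x : X) : QT :=
  integral (fun y : Y => g z y * f y x).

Lemma comp_funP (X Y Z : finitary_set) (g : Hom Y Z) (f : Hom X Y) s z x :
  comp_fun g f (fact s z) (fact s x) = comp_fun g f z x.
Proof.
have stab1 (V : finitary_set) (v : V) :
    exists2 A, finite_set A & forall u, pstab A u -> fact u v = v.
  have [|A Afin Av] := @fact_smooth V v 1%g; first exact: fact1.
  by exists A => // u /Av /=; rewrite mul1g.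
have [A Afin Az] := stab1 _ z; have [B Bfin Bx] := stab1 _ x.
rewrite /comp_fun -[RHS](@integral_translate _ _ (A `|` B) s); last first.
- move=> u uAB y; rewrite -{1}[z](Az u); last by move=> w Aw; apply: uAB; left.
  by rewrite -{1}[x](Bx u) ?hfunP // => w Bw; apply: uAB; right.
- by rewrite finite_setU.
congr integral; apply/funext => y.
by rewrite -{1 2}(factVK s y) !hfunP.
Qed.

Definition hcomp (X Y Z : finitary_set) (g : Hom Y Z) (f : Hom X Y) : Hom X Z :=
  MkHom (comp_funP g f).

Lemma integral0 (X : finitary_set) (f : X -> QT) :
  (forall x, f x = 0) -> integral f = 0.
Proof.
move=> f0; apply: fsbig1 => c [x _ <-]; by rewrite f0 mul0r.
Qed.

Lemma hcomp0l (X Y Z : finitary_set) (f : Hom X Y) : hcomp (0 : Hom Y Z) f = 0.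
Proof. by apply: Hom_ext => z x; apply: integral0 => y; rewrite mul0r. Qed.
Lemma hcomp0r (X Y Z : finitary_set) (g : Hom Y Z) : hcomp g (0 : Hom X Y) = 0.
Proof. by apply: Hom_ext => z x; apply: integral0 => y; rewrite mulr0. Qed.

(* An element of N u {oo}, with [None] for oo. *)
Definition in_range (n : option nat) (i : nat) : Prop :=
  (1 <= i)%N /\ (if n is Some m then (i <= m)%N else True).

Definition is_nat (x : QT) : Prop := exists k : nat, x = k%:R.
Definition in_T_minus_Z (x : QT) : Prop := exists z : int, x = TT - z%:~R.

(* Sequences indexed by [1, n] are extended by zero to all of [nat]. *)
Record Lambda (n : option nat) := MkLambda {
  lseq :> nat -> QT;
  lseq_out : forall i, ~ in_range n i -> lseq i = 0;
  lseq_1 : in_T_minus_Z (lseq 1%N);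
  lseq_nat : forall i, (2 <= i)%N -> is_nat (lseq i);
  lseq_fin : finite_set [set i | lseq i != 0];
  lseq_sum : \sum_(i \in [set: nat]) lseq i = TT }.

HB.instance Definition _ n := gen_eqMixin (Lambda n).
HB.instance Definition _ n := gen_choiceMixin (Lambda n).

Definition Lambda_plus (n : option nat) : set (Lambda n) :=
  [set l | forall i, (2 <= i)%N ->
    exists a b : nat, [/\ l i = a%:R, l i.+1 = b%:R & (b <= a)%N]].

(* Matrices indexed by [1, n] x [1, n] are extended by zero as well. *)
Definition Mat (n : option nat) (d b : Lambda n) (q : nat -> nat -> QT) : Prop :=
  (forall i j, ~ (in_range n i /\ in_range n j) -> q i j = 0) /\
  in_T_minus_Z (q 1%N 1%N) /\
  (forall i j, (i, j) <> (1, 1)%N -> is_nat (q i j)) /\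
  finite_set [set ij : nat * nat | q ij.1 ij.2 != 0] /\
  \sum_(ij \in [set: nat * nat]) q ij.1 ij.2 = TT /\
  (forall j, \sum_(i \in [set: nat]) q i j = b j) /\
  (forall i, \sum_(j \in [set: nat]) q i j = d i).

Definition qtranspose (q : nat -> nat -> QT) : nat -> nat -> QT :=
  fun i j => q j i.

Definition seq_at (l : nat -> QT) (d : nat) : nat -> QT :=
  fun i => if (i == 1)%N then l i + (d%:R - TT) else l i.
Definition mat_at (q : nat -> nat -> QT) (d : nat) : nat -> nat -> QT :=
  fun i j => if ((i == 1) && (j == 1))%N then q i j + (d%:R - TT) else q i j.

(* [tab i] is the [i]-th row, read from left to right, of a filling of the
   diagram with row lengths [ld] by the matrix [qd]. *)
Definition is_filling (ld : nat -> QT) (qd : nat -> nat -> QT)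
    (tab : nat -> seq nat) : Prop :=
  forall i, [/\ (size (tab i))%:R = ld i, sorted leq (tab i) &
    forall j, (count_mem j (tab i))%:R = qd i j].

Definition column_strict (tab : nat -> seq nat) : Prop :=
  forall i i' c, (i < i')%N -> (c < size (tab i))%N -> (c < size (tab i'))%N ->
    (nth 0 (tab i) c < nth 0 (tab i') c)%N.

Definition semistandard (n : option nat) (l : Lambda n) (q : nat -> nat -> QT) :
    Prop :=
  exists N : nat, forall d : nat, (N <= d)%N ->
    exists2 tab, is_filling (seq_at l d) (mat_at q d) tab & column_strict tab.

Definition tail_block (n : option nat) (b : Lambda n) (k : nat) : set Omega :=
  [set w | exists lo hi : nat,
    [/\ lo%:R = 1 + \sum_(2 <= i < k) b i,
        hi%:R = \sum_(2 <= i < k.+1) b i & (lo <= val w <= hi)%N]].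

Definition block (n : option nat) (b : Lambda n) (k : nat) : set Omega :=
  if (k == 1)%N then ~` \bigcup_(m in [set m | (2 <= m)%N]) tail_block b m
  else tail_block b k.

Definition Young (n : option nat) (b : Lambda n) : set Sinf :=
  [set s | forall k, in_range n k -> (s : Omega -> Omega) @` block b k = block b k].

Definition lcoset (H : set Sinf) (s : Sinf) : set Sinf :=
  [set (s * u)%g | u in H].

Definition coset_type (H : set Sinf) := {C : set Sinf | exists s, C = lcoset H s}.

Lemma lcoset_translate H t (C : coset_type H) :
  exists s, [set (t * u)%g | u in sval C] = lcoset H s.
Proof.
have [s ->] := svalP C; exists (t * s)%g; apply/seteqP; split.
  by move=> _ [_ [u Hu <-] <-]; exists u => //; rewrite mulgA.
by move=> _ [u Hu <-]; exists (s * u)%g; [exists u | rewrite mulgA].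
Qed.

Definition coset_act (H : set Sinf) (t : Sinf) (C : coset_type H) :
    coset_type H :=
  exist _ [set (t * u)%g | u in sval C] (lcoset_translate t C).

Definition coset_of_elt (H : set Sinf) (s : Sinf) : coset_type H :=
  exist _ (lcoset H s) (ex_intro _ s erefl).

Lemma coset_ext H (C D : coset_type H) : sval C = sval D -> C = D.
Proof.
case: C D => [C CP] [D DP] /= CD; subst D.
by congr exist; exact: Prop_irrelevance.
Qed.

Lemma coset_act1 H (C : coset_type H) : coset_act 1%g C = C.
Proof.
apply: coset_ext; apply/seteqP; split => /= [_ [u Cu <-]|u Cu].
  by rewrite mul1g.
by exists u => //; rewrite mul1g.
Qed.

Lemma coset_actM H s t (C : coset_type H) :
  coset_act (s * t)%g C = coset_act s (coset_act t C).
Proof.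
apply: coset_ext; apply/seteqP; split => /= [_ [u Cu <-]|_ [_ [u Cu <-] <-]].
  by exists (t * u)%g; [exists u | rewrite mulgA].
by exists u => //; rewrite mulgA.
Qed.

Lemma coset_act_elt H t s :
  coset_act t (coset_of_elt H s) = coset_of_elt H (t * s)%g.
Proof.
apply: coset_ext; apply/seteqP; split => /= [_ [_ [u Hu <-] <-]|_ [u Hu <-]].
  by exists u => //; rewrite mulgA.
by exists (s * u)%g; [exists u | rewrite mulgA].
Qed.

Lemma coset_finorb H :
  finite_set [set O : set (coset_type H) |
    exists x, O = [set coset_act s x | s in setT]].
Proof.
apply: (@sub_finite_set _ _ [set setT]); last exact: finite_set1.
move=> _ [C ->]; apply/seteqP; split=> // D _.
have [s Cs] := svalP C; have [t Dt] := svalP D.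
exists (t * s^-1)%g => //.
have -> : C = coset_of_elt H s by apply: coset_ext.
by rewrite coset_act_elt -mulgA mulVg mulg1; apply/esym/coset_ext.
Qed.

Lemma tail_block_finite n (b : Lambda n) k : finite_set (tail_block b k).
Proof.
case: (pselect (exists hi : nat, hi%:R = \sum_(2 <= i < k.+1) b i)).
  move=> [hi hiE]; apply: (@sub_finite_set _ _ (initseg hi)).
    move=> w [lo [hi' [_ hi'E /andP[_ whi]]]]; rewrite /initseg /=.
    by rewrite -hiE in hi'E; rewrite -(QT_natr_inj hi'E).
  have -> : initseg hi = (fun w : Omega => val w) @^-1` `I_hi.+1 by [].
  apply: finite_preimage.
    by move=> x y _ _; exact: val_inj.
  exact: finite_II.
move=> nhi; apply: (@sub_finite_set _ _ set0); last exact: finite_set0.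
by move=> w [lo [hi [_ hiE _]]]; apply: nhi; exists hi.
Qed.

Lemma tail_block0 n (b : Lambda n) k : (2 <= k)%N -> b k = 0 ->
  tail_block b k = set0.
Proof.
move=> k2 bk; apply/seteqP; split=> // w [lo [hi [loE hiE /andP[low whi]]]].
move: hiE; rewrite big_nat_recr //= bk addr0 => hiE.
move: loE; rewrite -hiE nat1r => /QT_natr_inj loE.
by have := leq_trans low whi; rewrite loE ltnn.
Qed.

Lemma tail_blocks_finite n (b : Lambda n) :
  finite_set (\bigcup_(m in [set m | (2 <= m)%N]) tail_block b m).
Proof.
apply: (@sub_finite_set _ _
    (\bigcup_(m in [set i | b i != 0]) tail_block b m)).
  move=> w [m m2 wm]; exists m => //=; apply/eqP => bm.
  by move: wm; rewrite tail_block0.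
by apply: bigcup_finite => [|m _]; [exact: lseq_fin | exact: tail_block_finite].
Qed.

Lemma pstab_Young n (b : Lambda n) :
  pstab (\bigcup_(m in [set m | (2 <= m)%N]) tail_block b m) `<=` Young b.
Proof.
set U := bigcup _ _ => s sU k [k1 _].
have sVU w : U w -> s^-1%g w = w.
  by move=> Uw; rewrite -{1}(sU w Uw) -SinfM mulVg.
rewrite /block; case: eqP => [_|kn1].
  apply/seteqP; split=> [_ [w Uw <-] /= Usw|w Uw].
    have e : w = s w by rewrite -[RHS](sVU _ Usw) -SinfM mulVg.
    by apply: Uw; rewrite e.
  exists (s^-1%g w); last by rewrite -SinfM mulgV.
  move=> UsVw; have e : w = s^-1%g w by rewrite -[RHS](sU _ UsVw) -SinfM mulgV.
  by apply: Uw; rewrite e.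
have k2 : (2 <= k)%N by case: k k1 kn1 => [|[|k]].
apply/seteqP; split=> [_ [w bw <-]|w bw]; first by rewrite sU //; exists k.
by exists w => //; rewrite sU //; exists k.
Qed.

Lemma Young_mul n (b : Lambda n) s t : Young b s -> Young b t ->
  Young b (s * t)%g.
Proof.
move=> sb tb k kn.
rewrite -[RHS](sb k kn) -{2}(tb k kn).
by apply/seteqP; split=> [_ [w bw <-]|_ [_ [w bw <-] <-]];
  [exists (t w) => //; exists w | exists w].
Qed.

Lemma coset_smooth n (b : Lambda n) (C : coset_type (Young b)) :
  open_Sinf [set s | coset_act s C = C].
Proof.
move=> s sC; have [g Cg] := svalP C.
set U := \bigcup_(m in [set m | (2 <= m)%N]) tail_block b m.
exists ((g : Omega -> Omega) @` U) => [|u uU /=].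
  exact/finite_image/tail_blocks_finite.
have EC : C = coset_of_elt (Young b) g by apply: coset_ext.
have incl v : pstab ((g : Omega -> Omega) @` U) v ->
    lcoset (Young b) (v * g)%g `<=` lcoset (Young b) g.
  move=> vU _ [w Yw <-]; exists (g^-1 * v * g * w)%g; last first.
    by rewrite !mulgA mulgV mul1g.
  apply: Young_mul => //; apply: pstab_Young => x Ux.
  by rewrite !SinfM vU -?SinfM ?mulVg //; exists x.
rewrite coset_actM; suff -> : coset_act u C = C by [].
rewrite EC coset_act_elt; apply: coset_ext; apply/seteqP; split=> /=.
  exact: incl.
move=> _ [w Yw <-].
have [||w' Yw' w'E] := incl u^-1%g _ (u^-1 * g * w)%g.
- by move=> x Ux; rewrite -{1}(uU x Ux) -SinfM mulVg.
- by exists w.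
by exists w' => //; rewrite -mulgA w'E !mulgA mulgV mul1g.
Qed.

Definition XX (n : option nat) (b : Lambda n) : finitary_set :=
  @FinitarySet (coset_type (Young b)) (@coset_act (Young b))
    (@coset_act1 _) (@coset_actM _) (@coset_smooth n b) (@coset_finorb _).

(* The component of [x] at the pair (d, b) lies in Hom(X^b, X^d). *)
Record Salg (n : option nat) := MkSalg {
  scomp :> forall db : Lambda n * Lambda n, Hom (XX db.2) (XX db.1);
  scomp_fin : finite_set [set db | scomp db != 0] }.

HB.instance Definition _ n := gen_eqMixin (Salg n).
HB.instance Definition _ n := gen_choiceMixin (Salg n).

Section SalgModule.
Variable n : option nat.
Implicit Types x y : Salg n.

Lemma Salg_ext x y : (forall db, x db = y db) -> x = y.
Proof.
case: x y => [x xP] [y yP] /= xy.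
have exy : x = y by apply: functional_extensionality_dep.
by subst y; congr MkSalg; exact: Prop_irrelevance.
Qed.

Lemma Salg_finS (F : forall db : Lambda n * Lambda n, Hom (XX db.2) (XX db.1))
    (A : set (Lambda n * Lambda n)) :
  finite_set A -> (forall db, ~ A db -> F db = 0) ->
  finite_set [set db | F db != 0].
Proof.
move=> Afin AF; apply: sub_finite_set Afin => db /= /eqP Fdb.
by apply: contra_notP Fdb => /AF.
Qed.

Lemma scomp_out x db : ~ [set db | x db != 0] db -> x db = 0.
Proof. by move=> /= /negP; rewrite negbK => /eqP. Qed.

Definition Salg_zero : Salg n.
Proof.
exists (fun=> 0).
by apply: (@Salg_finS _ set0) => //; exact: finite_set0.
Defined.
Definition Salg_opp x : Salg n.
Proof.
exists (fun db => - x db); apply: (Salg_finS (scomp_fin x)) => db /scomp_out ->.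
by rewrite oppr0.
Defined.
Definition Salg_add x y : Salg n.
Proof.
exists (fun db => x db + y db).
apply: (@Salg_finS _ ([set db | x db != 0] `|` [set db | y db != 0])).
  by rewrite finite_setU; split; exact: scomp_fin.
by move=> db /not_orP[/scomp_out -> /scomp_out ->]; rewrite addr0.
Defined.
Definition Salg_scale (a : QT) x : Salg n.
Proof.
exists (fun db => a *: x db); apply: (Salg_finS (scomp_fin x)) => db /scomp_out ->.
by rewrite scaler0.
Defined.

Lemma Salg_addA : associative Salg_add.
Proof. by move=> x y z; apply: Salg_ext => db /=; rewrite addrA. Qed.
Lemma Salg_addC : commutative Salg_add.
Proof. by move=> x y; apply: Salg_ext => db /=; rewrite addrC. Qed.
Lemma Salg_add0 : left_id Salg_zero Salg_add.
Proof. by move=> x; apply: Salg_ext => db /=; rewrite add0r. Qed.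
Lemma Salg_addN : left_inverse Salg_zero Salg_opp Salg_add.
Proof. by move=> x; apply: Salg_ext => db /=; rewrite addNr. Qed.

HB.instance Definition _ := GRing.isZmodule.Build (Salg n)
  Salg_addA Salg_addC Salg_add0 Salg_addN.

Lemma Salg_scaleA a b x : Salg_scale a (Salg_scale b x) = Salg_scale (a * b) x.
Proof. by apply: Salg_ext => db /=; rewrite scalerA. Qed.
Lemma Salg_scale1 : left_id 1 Salg_scale.
Proof. by move=> x; apply: Salg_ext => db /=; rewrite scale1r. Qed.
Lemma Salg_scaleDr : right_distributive Salg_scale +%R.
Proof. by move=> a x y; apply: Salg_ext => db /=; rewrite scalerDr. Qed.
Lemma Salg_scaleDl x : {morph Salg_scale^~ x : a b / a + b}.
Proof. by move=> a b; apply: Salg_ext => db /=; rewrite scalerDl. Qed.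

HB.instance Definition _ := GRing.Zmodule_isLmodule.Build QT (Salg n)
  Salg_scaleA Salg_scale1 Salg_scaleDr Salg_scaleDl.

Definition smul_fun x y (db : Lambda n * Lambda n) : Hom (XX db.2) (XX db.1) :=
  \sum_(c \in [set: Lambda n])
    (hcomp (x (db.1, c)) (y (c, db.2)) : Hom (XX db.2) (XX db.1)).

Lemma smul_fin x y : finite_set [set db | smul_fun x y db != 0].
Proof.
apply: (@Salg_finS _ ((fst @` [set db | x db != 0]) `*`
                      (snd @` [set db | y db != 0]))).
  by apply: finite_setX; apply: finite_image; exact: scomp_fin.
move=> [d b] /= nxy; apply: fsbig1 => c _ /=.
have [xdc|xdc] := eqVneq (x (d, c)) 0; first by rewrite xdc hcomp0l.
have [ycb|ycb] := eqVneq (y (c, b)) 0; first by rewrite ycb hcomp0r.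
by exfalso; apply: nxy; split; [exists (d, c) | exists (c, b)].
Qed.

Definition smul x y : Salg n := MkSalg (smul_fin x y).

End SalgModule.

Section Span.
Variable n : option nat.

Definition Hom_to_Salg (d b : Lambda n) (f : Hom (XX b) (XX d)) : Salg n.
Proof.
exists (@dfwith _ (fun db => Hom (XX db.2) (XX db.1)) (fun=> 0) (d, b) f).
apply: (Salg_finS (finite_set1 (d, b))) => db ndb.
by rewrite dfwith_out //; apply/eqP => e; apply: ndb.
Defined.

(* The double coset of [s] is determined by [q], so quantifying existentially
   over [s] gives the orbit attached to any of the admissible [s]. *)
Definition rel_position (d b : Lambda n) (q : nat -> nat -> QT) (s : Sinf) :
    Prop :=
  forall i j, in_range n i -> in_range n j -> (i, j) <> (1, 1)%N ->
    exists2 m : nat,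
      block d i `&` ((s : Omega -> Omega) @` block b j) #= `I_m & q i j = m%:R.

Definition xi_orbit (d b : Lambda n) (q : nat -> nat -> QT) (y : XX d)
    (x : XX b) : Prop :=
  exists2 s, rel_position d b q s & exists t : Sinf,
    y = fact t (coset_of_elt (Young d) 1%g : XX d) /\
    x = fact t (coset_of_elt (Young b) s : XX b).

Lemma xi_orbitP d b q s y x :
  xi_orbit q (fact s y : XX d) (fact s x : XX b) <-> xi_orbit q y x.
Proof.
have imp u (y' : XX d) (x' : XX b) :
    xi_orbit q y' x' -> xi_orbit q (fact u y') (fact u x').
  move=> [v vq [t [-> ->]]]; exists v => //; exists (u * t)%g.
  by rewrite !factM.
by split=> [/(imp s^-1%g)|/(imp s)] //; rewrite !factK.
Qed.

Definition xi_hom (d b : Lambda n) (q : nat -> nat -> QT) : Hom (XX b) (XX d).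
Proof.
exists (fun y x => if `[< xi_orbit q y x >] then 1 else 0) => s y x.
by rewrite (asbool_equiv_eq (xi_orbitP q s y x)).
Defined.

Definition xi (d b : Lambda n) (q : nat -> nat -> QT) : Salg n :=
  Hom_to_Salg (xi_hom d b q).

Definition Xset (l b : Lambda n) : set (Salg n) :=
  [set xi l b r | r in [set r | Mat l b r /\ semistandard l r]].

Definition Yset (d l : Lambda n) : set (Salg n) :=
  [set xi d l q | q in [set q | Mat d l q /\ semistandard l (qtranspose q)]].

Definition CB : set (Salg n) :=
  \bigcup_(l in @Lambda_plus n)
    [set smul u v | u in \bigcup_d Yset d l & v in \bigcup_b Xset l b].

Definition Tspan : set (Salg n) :=
  [set x | exists (m : nat) (a : 'I_m -> {poly rat}) (c : 'I_m -> Salg n),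
    [/\ forall i, integer_valued (a i), forall i, CB (c i) &
        x = \sum_(i < m) (a i)%:F *: c i]].

End Span.

Arguments Tspan : clear implicits.

(* Main.v *)
From HB Require Import structures.
Require Import Defs.
From mathcomp Require Import all_boot all_order all_algebra.
From mathcomp Require Import boolp classical_sets functions cardinality fsbigop.
From mathcomp Require Import finmap zify ring.
(* [Hom] is shadowed by the vector library. *)
Import Defs.

(* T(n, T) is the set of all elements of S(n, T) whose structure functions take
   integer-valued polynomials as values, and this set is visibly closed under
   products: a measure is a polynomial that counts fixed points at all large
   integers p, hence is integer-valued.

   That the codeterminants span all such elements is proved by straightening.
   A point of [XX b] is a colouring of Omega, and a G-invariant function on
   pairs of colourings is a function of the matrix of intersection numbers.
   Evaluating polynomials at large p turns composition into matrix
   multiplication over finite sets, which gives bilinearity and associativity.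
   If row i of [r], read against row i+1, violates semistandardness at column
   j0, then the function
     prod_(j < j0) C(s_(i,j), r_(i,j)) * prod_(j > j0) C(s_(i+1,j), r_(i+1,j))
   of s equals 1 at r, and is otherwise supported on matrices s that are
   smaller for a weighted sum of the entries. As a function of row i+1 it is a
   polynomial of degree smaller than the row sum of that row, so it is an
   integral combination of binomials C(s_(i+1,.), Y) with |Y| < lambda_(i+1),
   and each of these factors through X^mu with
   mu = lambda + k (e_i - e_(i+1)), k > 0. Induction on mu finishes the proof,
   the left factor being treated by transposition. *)

Set Implicit Arguments.
Unset Strict Implicit.
Unset Printing Implicit Defensive.
Import Order.TTheory GRing.Theory Num.Theory.
Local Open Scope classical_set_scope.
Local Open Scope card_scope.
Local Open Scope ring_scope.

(** * Integer-valued polynomials *)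

(** The obstacle that shapes the proof is the infinite entry. The first part of a weight and the
    entry (1, 1) of a matrix lie in T - Z, so they cannot take part in counting arguments or serve
    as measures. Both are recorded as 0 and recovered from the condition that the total is T. For
    the same reason row 1 can violate semistandardness only at column 1, and the columns before the
    violation then avoid the infinite entry. Two inductions are nested. For a fixed weight,
    subtracting the straightening function of a violation leaves matrices s with a smaller sum of (i
    - 1) (K - j) s_(i,j), where K exceeds all indices that occur. A factorization through X^mu
    lowers the sum of i lambda_i over i >= 2. A single map f enters the outer induction as the
    composite of f with an identity. *)

Lemma polyrat_eq_large (P Q : {poly rat}) (N : nat) :
  (forall p, (N <= p)%N -> P.[p%:R] = Q.[p%:R]) -> P = Q.
Proof.
move=> PQ; apply/eqP; rewrite -subr_eq0; apply/eqP.
pose s : seq rat := [seq (N + i)%:R | i <- iota 0 (size (P - Q))].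
apply: (@roots_geq_poly_eq0 _ _ s).
- by apply/allP => _ /mapP[i _ ->]; rewrite rootE !hornerE PQ ?subrr ?leq_addr.
- rewrite map_inj_uniq ?iota_uniq// => i j /eqP.
  by rewrite eqr_nat eqn_add2l => /eqP.
- by rewrite size_map size_iota.
Qed.

(** The finite difference lowers the degree because [('X + 1) ^+ i - 'X^i] is 1 times a sum of terms
    of degree i - 1. *)
Lemma size_shift_sub (P : {poly rat}) m : (size P <= m.+1)%N ->
  (size (P \Po ('X + 1) - P)%R <= m)%N.
Proof.
move=> sP; have -> : P \Po ('X + 1) - P = \sum_(i < size P) P`_i *: (('X + 1) ^+ i - 'X^i).
  rewrite comp_polyE -[X in _ - X]coefK poly_def -sumrB.
  by apply: eq_bigr => i _; rewrite scalerBr.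
apply: (leq_trans (size_sum _ _ _)); apply/bigmax_leqP => i _.
rewrite subrXX addrAC subrr add0r mul1r.
apply: (leq_trans (size_scale_leq _ _)).
apply: (leq_trans (size_sum _ _ _)); apply/bigmax_leqP => j _.
apply: (leq_trans (size_polyMleq _ _)).
have -> : ('X + 1 : {poly rat}) = 'X - (-1)%:P by rewrite polyCN opprK.
rewrite size_polyXn size_exp_XsubC; have := ltn_ord i; have := ltn_ord j; lia.
Qed.

(** Induction on the degree: the finite difference is integer-valued everywhere, and subtracting it
    from P(z + 1) carries integrality from large arguments down to every z. *)
Lemma integer_valued_large (P : {poly rat}) (N : nat) :
  (forall p, (N <= p)%N -> P.[p%:R] \is a Num.int) -> integer_valued P.
Proof.
have [m] := ubnP (size P); elim: m => // m IH in P N *.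
rewrite ltnS => sP PN.
have [P0|P0] := eqVneq P 0; first by rewrite P0 => z; rewrite horner0 rpred0.
have [k sk] : exists k, size P = k.+1.
  by case: (size P) (size_poly_eq0 P) => [|k _]; [rewrite (negPf P0)|exists k].
have D : integer_valued (P \Po ('X + 1) - P).
  apply: (IH _ N); first by apply: (@leq_ltn_trans k); [rewrite size_shift_sub ?sk|rewrite -sk].
  by move=> p Np; rewrite !hornerE horner_comp !hornerE rpredB ?PN// natr1 PN// (leqW Np).
move=> z; have [d] : exists d : nat, (N%:Z <= z + d%:Z).
  by exists (`|z| + N)%N; lia.
elim: d z => [|d IHd] z hz.
  have -> : z = `|z|%N by lia.
  by rewrite -pmulrn; apply: PN; lia.
have -> : P.[z%:~R] = P.[(z + 1)%:~R] - (P \Po ('X + 1) - P).[z%:~R].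
  by rewrite !hornerE horner_comp !hornerE rmorphD /= opprB addrC subrK.
by rewrite rpredB//; apply: IHd; lia.
Qed.

Lemma integer_valuedC (c : int) : integer_valued (c%:~R)%:P.
Proof. by move=> z; rewrite hornerC; apply: rpred_int. Qed.

Lemma integer_valuedD P Q :
  integer_valued P -> integer_valued Q -> integer_valued (P + Q).
Proof. by move=> hP hQ z; rewrite hornerD rpredD. Qed.

Lemma integer_valuedM P Q :
  integer_valued P -> integer_valued Q -> integer_valued (P * Q).
Proof. by move=> hP hQ z; rewrite hornerM rpredM. Qed.

(** * Counting words with prescribed letter multiplicities *)

Definition binom_poly (k : nat) : {poly rat} :=
  (k`!%:R)^-1 *: \prod_(i < k) ('X - (i%:R)%:P).

Lemma binom_polyE k (M : nat) : (binom_poly k).[M%:R] = 'C(M, k)%:R.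
Proof.
rewrite hornerZ horner_prod.
have -> : \prod_(i < k) ('X - (i%:R)%:P).[M%:R : rat] = (M ^_ k)%:R.
  elim: k => [|k IH]; first by rewrite big_ord0 ffactn0.
  rewrite big_ord_recr /= IH !hornerE ffactnSr natrM.
  have [kM|Mk] := leqP k M; first by rewrite natrB.
  by rewrite ffact_small// !mul0r.
by rewrite -bin_ffact natrM mulrC mulfK// pnatr_eq0 -lt0n fact_gt0.
Qed.

(** A Newton expansion, chosen because summation in M acts on it by a shift of coefficients. *)
Definition binomial_sum (f : nat -> nat) : Prop :=
  exists D (a : nat -> nat), forall M, f M = (\sum_(k < D) a k * 'C(M, k))%N.

Lemma binomial_sum0 : binomial_sum (fun=> 0%N).
Proof. by exists 0%N, (fun=> 0%N) => M; rewrite big_ord0. Qed.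

Lemma binomial_sumD f g : binomial_sum f -> binomial_sum g ->
  binomial_sum (fun M => (f M + g M)%N).
Proof.
move=> [D [a fa]] [D' [b gb]].
have pad (E E' : nat) (c : nat -> nat) M : (E <= E')%N ->
    (\sum_(k < E) c k * 'C(M, k) =
     \sum_(k < E') (if k < E then c k else 0) * 'C(M, k))%N.
  move=> EE; rewrite (big_ord_widen E' (fun k => c k * 'C(M, k))%N EE).
  by rewrite big_mkcond; apply: eq_bigr => k _; case: ifP; rewrite ?mul0n.
exists (maxn D D'), (fun k => (if k < D then a k else 0) + (if k < D' then b k else 0))%N.
move=> M; rewrite fa gb (pad D (maxn D D')) ?leq_maxl// (pad D' (maxn D D')) ?leq_maxr//.
by rewrite -big_split; apply: eq_bigr => k _; rewrite mulnDl.
Qed.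

(** By Pascal's rule the antidifference shifts the coefficients by one; the constant of summation is
    [f 0]. *)
Lemma binomial_sum_antidiff f g : binomial_sum g ->
  (forall M, f M.+1 = f M + g M)%N -> binomial_sum f.
Proof.
move=> [D [a ga]] fg; exists D.+1, (fun k => if k is k'.+1 then a k' else f 0%N).
elim=> [|M IH]; rewrite big_ord_recl /= bin0 muln1.
  by rewrite big1 ?addn0// => k _; rewrite bin0n muln0.
rewrite fg IH ga big_ord_recl /= bin0 muln1 -addnA -big_split /=; congr addn.
by apply: eq_bigr => k _; rewrite -mulnDr binS.
Qed.

Definition polynomial_count (f : nat -> nat) (N : nat) : Prop :=
  exists P : {poly rat}, forall M, (N <= M)%N -> (f M)%:R = P.[M%:R].

Lemma binomial_sum_polynomial f : binomial_sum f -> polynomial_count f 0.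
Proof.
move=> [D [a fa]]; exists (\sum_(k < D) (a k)%:R *: binom_poly k) => M _.
rewrite fa natr_sum horner_sum; apply: eq_bigr => k _.
by rewrite hornerZ binom_polyE natrM.
Qed.

Lemma polynomial_count_sum (I : Type) (r : seq I) (f : I -> nat -> nat) N :
  (forall i, polynomial_count (f i) N) ->
  polynomial_count (fun M => \sum_(i <- r) f i M)%N N.
Proof.
move=> fP; elim: r => [|i r [P PE]].
  by exists 0 => M _; rewrite big_nil horner0.
have [Q QE] := fP i; exists (Q + P) => M NM.
by rewrite big_cons natrD hornerD PE// QE.
Qed.

Definition decr (m : nat -> nat) (j : nat) : nat -> nat :=
  fun i => (m i - (i == j))%N.

(* Letters range over [1 .. K]; the number of letters [1] is left free. *)
Fixpoint words (K : nat) (m : nat -> nat) (M : nat) : seq (seq nat) :=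
  if M is M'.+1 then
    [seq j :: s | j <- [seq j <- iota 1 K | (j == 1) || (0 < m j)]%N,
                  s <- words K (decr m j) M']
  else if all (fun i => m i == 0)%N (iota 2 K.-1) then [:: [::]] else [::].

Lemma mem_words K m M s : (s \in words K m M) =
  [&& size s == M, all (fun x => 0 < x <= K)%N s &
      all (fun i => count_mem i s == m i) (iota 2 K.-1)].
Proof.
elim: M m s => [|M IH] m s /=.
  case: s => [|x s] /=.
    under [in RHS]eq_all do rewrite eq_sym.
    by case: ifP; rewrite ?inE.
  by case: ifP.
apply/allpairsPdep/idP => [[j [s' [+ + ->]]]|].
  rewrite mem_filter mem_iota IH /= eqSS => /andP[mj jK] /and3P[-> -> /allP cm].
  rewrite /= andbT; apply/andP; split; first by lia.
  apply/allP => i iK; rewrite eq_sym; have /eqP -> := cm i iK.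
  move: iK mj; rewrite mem_iota /decr; have [->|_] := eqVneq j i; last by lia.
  by case: (m i) => [|k]; lia.
case: s => [|j s] //=; rewrite eqSS => /and3P[/eqP sM /andP[jK sK] /allP cm].
exists j, s; split=> //.
  rewrite mem_filter mem_iota; apply/andP; split; last by lia.
  have [//|j1] := eqVneq j 1%N; have /cm/eqP <- : j \in iota 2 K.-1.
    by rewrite mem_iota; lia.
  by rewrite eqxx.
rewrite IH sM eqxx sK; apply/allP => i /cm /eqP /= jm.
by rewrite /decr -jm eq_sym [j == i]eq_sym addnC addnK.
Qed.

Lemma words_uniq K m M : uniq (words K m M).
Proof.
elim: M m => [|M IH] m /=; first by case: ifP.
apply: allpairs_uniq_dep => [|j _|]; rewrite ?filter_uniq ?iota_uniq//.
by move=> [j s] [j' s'] _ _ /= [-> ->].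
Qed.

Lemma eq_words K m m' : (forall i, (1 < i)%N -> m i = m' i) ->
  words K m =1 words K m'.
Proof.
move=> + M; elim: M m m' => [|M IH] m m' mm' /=.
  rewrite (@eq_in_all _ _ (fun i => m' i == 0)%N)// => i.
  by rewrite mem_iota => /andP[i1 _]; rewrite mm'.
have -> : [seq j <- iota 1 K | (j == 1) || (0 < m j)]%N =
          [seq j <- iota 1 K | (j == 1) || (0 < m' j)]%N.
  apply: eq_in_filter => j; rewrite mem_iota => /andP[j1 _].
  by case: eqVneq => //= jn; rewrite mm'//; lia.
congr flatten; apply: eq_map => j; congr map; apply: IH => i i1.
by rewrite /decr mm'.
Qed.

Lemma count_words Q K m M : count Q (words K m M.+1) =
  (\sum_(j <- iota 1 K | (j == 1) || (0 < m j))
     count (fun s => Q (j :: s)) (words K (decr m j) M))%N.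
Proof.
rewrite /= count_flatten sumnE -map_comp big_map big_filter.
by apply: eq_bigr => j _; rewrite /= count_map.
Qed.

(** Words of length M + 1 starting with 1 correspond to words of length M with the same
    multiplicities. The difference in M therefore counts the words starting with another letter,
    which leave a smaller total multiplicity. *)
Lemma size_words_binomial K m : (0 < K)%N -> binomial_sum (fun M => size (words K m M)).
Proof.
move=> K0; have [n] := ubnP (\sum_(i <- iota 2 K.-1) m i)%N.
elim: n => // n IH in m *; rewrite ltnS => mn.
apply: (@binomial_sum_antidiff _ (fun M => \sum_(j <- iota 2 K.-1 | 0 < m j)
    size (words K (decr m j) M))%N); last first.
  move=> M; rewrite -[LHS]count_predT count_words.
  case: K K0 {IH mn} => // K _; rewrite big_cons /= count_predT.
  congr (size _ + _)%N; first by apply: eq_words => i i1; rewrite /decr; lia.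
  rewrite big_seq_cond [RHS]big_seq_cond; apply: eq_big => j; rewrite ?mem_iota.
    by case: eqVneq => //; lia.
  by rewrite count_predT.
have decr_lt j : j \in iota 2 K.-1 -> (0 < m j)%N ->
    (\sum_(i <- iota 2 K.-1) decr m j i < n)%N.
  move=> jK mj; apply: leq_trans mn; rewrite !(bigD1_seq j)//= ?iota_uniq//.
  rewrite {1}/decr eqxx -addSn; apply: leq_add; first by lia.
  by apply: leq_sum => i _; rewrite leq_subr.
pose r := [seq j <- iota 2 K.-1 | (0 < m j)%N].
rewrite (_ : (fun M => _) = fun M => \sum_(j <- r) size (words K (decr m j) M))%N;
  last by apply/funext => M; rewrite big_filter.
have : {subset r <= [pred j | (j \in iota 2 K.-1) && (0 < m j)%N]}.
  by move=> j; rewrite mem_filter inE andbC.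
elim: r => [|j r IHr] rP.
  have -> : (fun M => \sum_(j <- [::]) size (words K (decr m j) M))%N = (fun=> 0%N).
    by apply/funext => M; rewrite big_nil.
  exact: binomial_sum0.
rewrite (_ : (fun M => _) = fun M => (size (words K (decr m j) M) +
    \sum_(i <- r) size (words K (decr m i) M))%N);
  last by apply/funext => M; rewrite big_cons.
apply: binomial_sumD; last by apply: IHr => i ir; apply: rP; rewrite inE ir orbT.
by have /andP[jK mj] := rP j (mem_head _ _); apply: IH; apply: decr_lt.
Qed.

(** Membership in a set stable under an open subgroup is such a condition on a prefix. Splitting off
    the N letters one at a time leaves a constant times the number of all words. *)
Lemma count_words_polynomial K m N Q : (0 < K)%N ->
  (forall s t, take N s = take N t -> Q s = Q t) ->
  polynomial_count (fun M => count Q (words K m M)) N.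
Proof.
move=> K0; elim: N m Q => [|N IH] m Q QN.
  have -> : (fun M => count Q (words K m M)) =
      (fun M => Q [::] * size (words K m M))%N.
    apply/funext => M; rewrite (@eq_count _ _ (fun=> Q [::])).
      by case: (Q [::]); rewrite ?count_predT ?count_pred0 ?mul1n.
    by move=> s; apply: QN; rewrite !take0.
  have [P PE] := binomial_sum_polynomial (size_words_binomial m K0).
  exists (((Q [::] : nat)%:R)%:P * P) => M _.
  by rewrite natrM hornerM hornerC PE.
have [|P PE] := @polynomial_count_sum _ [seq j <- iota 1 K | (j == 1) || (0 < m j)]%N
    (fun j M => count (fun s => Q (j :: s)) (words K (decr m j) M)) N.
  by move=> j; apply: IH => s t st; apply: QN; rewrite /= st.
exists (P \Po ('X - 1)) => -[//|M]; rewrite ltnS => NM.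
rewrite count_words -big_filter PE// horner_comp !hornerE -natr1 addrK //.
Qed.

(** * Points of [XX b] as colourings *)

(* Elements of Omega are numbered from 0. *)
Definition om (k : nat) : Omega := exist _ k.+1 (ltn0Sn k).
Definition un (w : Omega) : nat := (val w).-1.

Lemma omK : cancel om un. Proof. by []. Qed.
Lemma unK : cancel un om.
Proof. by move=> [w w0]; apply: val_inj; rewrite /= /un prednK. Qed.

Definition sn (g : Sinf) (k : nat) : nat := un (g (om k)).

Lemma om_sn g k : om (sn g k) = g (om k). Proof. by rewrite /sn unK. Qed.
Lemma un_sn (g : Sinf) (w : Omega) : un (g w) = sn g (un w). Proof. by rewrite /sn unK. Qed.
Lemma snM g h k : sn (g * h)%g k = sn g (sn h k).
Proof. by rewrite /sn SinfM -om_sn. Qed.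
Lemma snK g : cancel (sn g) (sn g^-1%g).
Proof. by move=> k; rewrite -snM mulVg. Qed.
Lemma snVK g : cancel (sn g^-1%g) (sn g).
Proof. by move=> k; rewrite -snM mulgV. Qed.

(** The rearrangement of the first p values, extended by the identity, is a bijection of Omega. All
    conjugacy statements for points and for pairs of points reduce to this one. *)
Lemma match_colourings (T : eqType) (c c' : nat -> T) (p : nat) :
  (forall k, (p <= k)%N -> c k = c' k) -> perm_eq (mkseq c p) (mkseq c' p) ->
  exists g : Sinf, forall k, c' (sn g k) = c k.
Proof.
move=> cc' /(perm_iotaP (c 0%N)) [Is]; rewrite size_mkseq => Isp cIs.
have sI : size Is = p by rewrite (perm_size Isp) size_iota.
have uI : uniq Is by rewrite (perm_uniq Isp) iota_uniq.
have mI k : (k \in Is) = (k < p)%N by rewrite (perm_mem Isp) mem_iota.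
pose f k := if (k < p)%N then nth 0%N Is k else k.
pose f' k := if (k < p)%N then index k Is else k.
have fK : cancel f f'.
  move=> k; rewrite /f /f'; case kp: (k < p)%N; last by rewrite kp.
  by rewrite -mI mem_nth ?sI// index_uniq ?sI.
have f'K : cancel f' f.
  move=> k; rewrite /f /f'; case kp: (k < p)%N; last by rewrite kp.
  by rewrite -[X in (_ < X)%N]sI index_mem mI kp nth_index ?mI.
have gK : cancel (om \o f \o un) (om \o f' \o un).
  by move=> w /=; rewrite omK fK unK.
have gK' : cancel (om \o f' \o un) (om \o f \o un).
  by move=> w /=; rewrite omK f'K unK.
exists (MkSinf gK gK') => k; rewrite /sn /= !omK /f; case: ifP => [kp|/negbT].
  have := congr1 (fun s => nth (c 0%N) s k) cIs.
  rewrite nth_mkseq// (nth_map 0%N) ?sI// nth_mkseq// -mI.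
  by rewrite mem_nth ?sI.
by rewrite -leqNgt => pk; rewrite cc'.
Qed.

Section Weights.
Variables (n : option nat).
Implicit Types b d l : Lambda n.

(** The first part is recorded as 0; [lseq_first] recovers it, because the sum is T. *)
Definition wt b (i : nat) : nat :=
  if (1 < i)%N then xget 0%N [set k | b i = k%:R] else 0%N.

Lemma wtE b i : (1 < i)%N -> b i = (wt b i)%:R.
Proof.
move=> i1; rewrite /wt i1; have [k bk] := lseq_nat b i1.
exact: (@xgetPex _ 0%N [set k | b i = k%:R]%classic (ex_intro _ k bk)).
Qed.

Lemma wt0 b i : (i <= 1)%N -> wt b i = 0%N.
Proof. by rewrite /wt leqNgt => /negbTE ->. Qed.

Lemma wt_out b i : ~ in_range n i -> wt b i = 0%N.
Proof.
move=> /(lseq_out b) b0; have [i1|/wt0//] := ltnP 1 i.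
by apply: QT_natr_inj; rewrite -wtE.
Qed.

Lemma wt_range b i : wt b i != 0%N -> in_range n i.
Proof. by move=> w0; apply: contrapT => /(wt_out b) e; rewrite e in w0. Qed.

(** Otherwise the first part would be 0, and T would be an integer. *)
Lemma Lambda_range1 b : in_range n 1%N.
Proof.
apply: contrapT => /(lseq_out b) b0; have [z] := lseq_1 b.
rewrite b0 => /esym/eqP; rewrite subr_eq0 /TT.
rewrite -(rmorph_int (@FracField.tofrac {poly rat})) tofrac_eq => /eqP XE.
have := congr1 (fun P : {poly rat} => size P) XE; rewrite size_polyX.
by rewrite -(rmorph_int (@polyC rat)) size_polyC; case: eqP.
Qed.

Lemma wt_bounded b : exists K, forall i, (K < i)%N -> wt b i = 0%N.
Proof.
have /finite_seqP[s sE] := lseq_fin b.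
exists (\max_(i <- s) i).+1 => i iK; apply/eqP; apply: contraT => wi.
have i1 : (1 < i)%N by rewrite ltnNge; apply: contra_neqN wi => /wt0.
have : i \in s.
  suff : [set` s] i by [].
  rewrite -sE /= (wtE b i1); apply: contra_neq wi => w0.
  exact: (@QT_natr_inj _ 0%N).
by move=> si; have := @leq_bigmax_seq _ s xpredT id i si isT; move: iK => /=; lia.
Qed.

(** The successor makes [kb] at least 1, so that it bounds the colour 1 as well. *)
Definition kb b : nat := (sval (cid (wt_bounded b))).+1.

Lemma kbP b i : (kb b <= i)%N -> wt b i = 0%N.
Proof. by rewrite /kb; case: cid => K /= KP /KP. Qed.

Definition wstart b (j : nat) : nat := \sum_(2 <= i < j) wt b i.

Lemma wstartS b j : (1 < j)%N -> wstart b j.+1 = (wstart b j + wt b j)%N.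
Proof. by move=> j1; rewrite /wstart big_nat_recr. Qed.

Lemma wstart_leq b i j : (i <= j)%N -> (wstart b i <= wstart b j)%N.
Proof.
move=> ij; rewrite /wstart; have [i2|i2] := leqP 2 i.
  by rewrite (@big_cat_nat _ _ _ i 2 j)//= leq_addr.
by rewrite big_geq// ltnW.
Qed.

Definition in_block b k j : bool := (1 < j)%N && (wstart b j <= k < wstart b j.+1)%N.

Lemma in_block_inj b k i j : in_block b k i -> in_block b k j -> i = j.
Proof.
move=> /and3P[i1 ik ki] /and3P[j1 jk kj].
have [ij|ji|//] := ltngtP i j.
  by have := wstart_leq b ij; lia.
by have := wstart_leq b ji; lia.
Qed.

(** The default 1 is the colour of the positions outside the finite blocks. *)
Definition colb b (k : nat) : nat := xget 1%N [set j | in_block b k j].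

Lemma colbP b k j : (1 < j)%N -> (colb b k == j) = in_block b k j.
Proof.
move=> j1; apply/eqP/idP => [cj|jk]; last first.
  by apply: xget_unique => // i ik; apply: in_block_inj ik jk.
have [ex|nex] := pselect (exists i, in_block b k i).
  by rewrite -cj; apply: (@xgetPex _ 1%N [set i | in_block b k i] ex).
by rewrite -cj /colb xgetPN ?ltnn// in j1 => i ik; apply: nex; exists i.
Qed.

Lemma colb_gt0 b k : (0 < colb b k)%N.
Proof.
by rewrite /colb; case: xgetP => [i -> /= /andP[/ltnW]|].
Qed.

Lemma sum_tail b j : \sum_(2 <= i < j) b i = (wstart b j)%:R.
Proof.
rewrite /wstart natr_sum; apply: eq_big_nat => i /andP[i1 _]; exact: wtE.
Qed.

Lemma tail_blockP b j w : (1 < j)%N -> tail_block b j w <-> colb b (un w) = j.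
Proof.
move=> j1; split=> [[lo [hi [lE hE lwh]]]|/eqP].
  move: lE hE; rewrite !sum_tail nat1r => /QT_natr_inj lE /QT_natr_inj hE.
  apply/eqP; rewrite colbP// /in_block j1 -hE /=.
  by move: lwh; rewrite lE /un; case: w => -[].
rewrite colbP// /in_block j1 /= => jw.
exists (wstart b j).+1, (wstart b j.+1); rewrite !sum_tail nat1r; split=> //.
by move: jw; rewrite /un; case: w => -[].
Qed.

Lemma blockP b j w : (0 < j)%N -> block b j w <-> colb b (un w) = j.
Proof.
rewrite /block; case: eqP => [->|j1] j0; last by apply: tail_blockP; lia.
split=> [nb|b1 [m /= m1 /tail_blockP]].
  apply/eqP; apply: contraT => c1; exfalso; apply: nb.
  have c2 : (1 < colb b (un w))%N by rewrite ltn_neqAle eq_sym c1 colb_gt0.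
  by exists (colb b (un w)) => //; apply/tail_blockP.
by rewrite b1 => /(_ m1) m1'; rewrite -m1' in m1.
Qed.

Lemma colb_range b k : in_range n (colb b k).
Proof.
have [->|c1] := eqVneq (colb b k) 1%N; first exact: Lambda_range1.
have c2 : (1 < colb b k)%N by rewrite ltn_neqAle eq_sym c1 colb_gt0.
apply: (@wt_range b); have := eqxx (colb b k); rewrite {1}colbP// /in_block.
by rewrite wstartS//; lia.
Qed.

Lemma colb_bound b k : (colb b k <= kb b)%N.
Proof.
have [->//|c1] := eqVneq (colb b k) 1%N.
have c2 : (1 < colb b k)%N by rewrite ltn_neqAle eq_sym c1 colb_gt0.
have := eqxx (colb b k); rewrite {1}colbP// /in_block wstartS// => ck.
by rewrite leqNgt; apply/negP => /ltnW /kbP; lia.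
Qed.

Lemma YoungP b u : Young b u <-> forall k, colb b (sn u k) = colb b k.
Proof.
split=> [uY k|uY j [j0 _]].
  have kb : block b (colb b k) (om k) by apply/blockP; rewrite ?colb_gt0.
  have : block b (colb b k) (u (om k)).
    by rewrite -(uY _ (colb_range b k)); exists (om k).
  by move=> /blockP; apply; apply: colb_gt0.
apply/seteqP; split=> [_ [w /blockP bw <-]|w /blockP bw].
  by apply/blockP => //; rewrite un_sn uY bw.
exists (u^-1%g w); last by rewrite -SinfM mulgV.
by apply/blockP => //; rewrite un_sn -uY snVK bw.
Qed.

Lemma YoungV b u : Young b u -> Young b u^-1%g.
Proof. by move=> /YoungP uY; apply/YoungP => k; rewrite -uY snVK. Qed.

(* The colouring of the coset of [s] gives to [w] the index of the block of
   [s^-1 w]; colour 1 marks the infinite block. *)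
Definition ck b (x : XX b) (k : nat) : nat :=
  colb b (sn (sval (cid (svalP x)))^-1%g k).

Lemma ck_elt b s k : ck (coset_of_elt (Young b) s : XX b) k = colb b (sn s^-1%g k).
Proof.
rewrite /ck; case: cid => t /= st.
have : lcoset (Young b) s s.
  by exists 1%g; [apply/YoungP|rewrite mulg1].
rewrite st => -[u /YoungV/YoungP uY <-].
by rewrite invgM snM uY.
Qed.

Lemma coset_eltP b (x : XX b) : exists s, x = coset_of_elt (Young b) s.
Proof. by have [s xs] := svalP x; exists s; apply: coset_ext. Qed.

Lemma ck_act b g (x : XX b) k : ck (fact g x) k = ck x (sn g^-1%g k).
Proof.
have [s ->] := coset_eltP x.
by rewrite /= coset_act_elt !ck_elt invgM snM.
Qed.

Lemma ck_inj b (x y : XX b) : ck x =1 ck y -> x = y.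
Proof.
have [s ->] := coset_eltP x; have [t ->] := coset_eltP y => xy.
have sub g h : (forall k, colb b (sn g^-1%g k) = colb b (sn h^-1%g k)) ->
    lcoset (Young b) g `<=` lcoset (Young b) h.
  move=> gh _ [u uY <-]; exists (h^-1 * g * u)%g; last by rewrite !mulgA mulgV mul1g.
  by apply: Young_mul => //; apply/YoungP => k; rewrite snM -gh snK.
apply: coset_ext; apply/seteqP; split; apply: sub => k.
  by have := xy k; rewrite !ck_elt.
by have := xy k; rewrite !ck_elt.
Qed.

Lemma ck_gt0 b (x : XX b) k : (0 < ck x k)%N. Proof. exact: colb_gt0. Qed.
Lemma ck_range b (x : XX b) k : in_range n (ck x k). Proof. exact: colb_range. Qed.
Lemma ck_bound b (x : XX b) k : (ck x k <= kb b)%N. Proof. exact: colb_bound. Qed.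

(** These are the points fixed by [pstab (initseg p)] ([Fp_fixed]), in a form that identifies them
    with words of length p. *)
Definition Fp b (p : nat) : set (XX b) := [set x | forall k, (p <= k)%N -> ck x k = 1%N].

Arguments Fp b p _ : clear implicits.

Lemma FpW b p q : (p <= q)%N -> Fp b p `<=` Fp b q.
Proof. by move=> pq x xp k qk; apply: xp; apply: leq_trans qk. Qed.

Lemma ck_fin b (x : XX b) : exists p, Fp b p x.
Proof.
have [s ->] := coset_eltP x.
(* All finite blocks lie in the first [wstart b (kb b).+1] positions; the bound exceeds their images
   under s. *)
exists (\max_(i < wstart b (kb b).+1) (sn s i).+1) => k kp.
rewrite ck_elt; set c := colb _ _; apply/eqP; apply: contraT => c1.
have c2 : (1 < c)%N by rewrite ltn_neqAle eq_sym c1 colb_gt0.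
have := eqxx c; rewrite {1}colbP// => /and3P[_ _ kc].
have lt : (sn s^-1%g k < wstart b (kb b).+1)%N.
  by apply: leq_trans kc _; apply: wstart_leq; apply: colb_bound.
have := @leq_bigmax _ (fun i : 'I_(wstart b (kb b).+1) => (sn s i).+1) (Ordinal lt).
by rewrite /= snVK => /leq_trans/(_ kp); rewrite ltnn.
Qed.

End Weights.
Arguments Fp {n} b p _.

(** * Counting positions, and matching colourings with one infinite colour *)

HB.instance Definition _ (X : finitary_set) := gen_eqMixin (fcar X).
HB.instance Definition _ (X : finitary_set) := gen_choiceMixin (fcar X).

Lemma card_eq_seq (T : choiceType) (A : set T) (l : seq T) m :
  uniq l -> (forall x, A x <-> x \in l) -> (A #= `I_m) <-> m = size l.
Proof.
move=> ul Al; have -> : A = [set` seq_fset tt l].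
  have e x : [set` seq_fset tt l] x = (x \in l) by rewrite -(seq_fsetE tt).
  by apply/seteqP; split=> x; rewrite e => /Al.
split=> [/card_eq_fsetP <-|->]; last apply/card_eq_fsetP.
  by rewrite size_seq_fset undup_id.
by rewrite size_seq_fset undup_id.
Qed.

Lemma count_transport (P Q : pred nat) (p q : nat) (g : Sinf) :
  (forall k, P k -> k < p)%N -> (forall k, Q k -> k < q)%N ->
  (forall k, P (sn g k) = Q k) -> count P (iota 0 p) = count Q (iota 0 q).
Proof.
move=> Pp Qq PQ; rewrite -!size_filter.
rewrite -[RHS](size_map (sn g)); apply/perm_size/uniq_perm.
- by rewrite filter_uniq ?iota_uniq.
- by rewrite map_inj_uniq ?filter_uniq ?iota_uniq//; apply: can_inj (snK g).
move=> k; rewrite mem_filter mem_iota; apply/andP/mapP => [[Pk _]|[i + ->]].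
  exists (sn g^-1%g k); last by rewrite snVK.
  by rewrite mem_filter mem_iota -PQ snVK Pk Qq// -PQ snVK.
by rewrite mem_filter mem_iota -PQ => /andP[Pi _]; rewrite Pi Pp.
Qed.

Lemma count_iota_bound (P : pred nat) (p q : nat) :
  (forall k, P k -> k < p)%N -> (forall k, P k -> k < q)%N ->
  count P (iota 0 p) = count P (iota 0 q).
Proof. by move=> Pp Pq; apply: (@count_transport _ _ _ _ 1%g). Qed.

Lemma card_positions (A : set Omega) (P : pred nat) p m :
  (forall k, P k -> k < p)%N -> (forall w, A w <-> P (un w)) ->
  (A #= `I_m) <-> m = count P (iota 0 p).
Proof.
move=> Pp AP; rewrite -size_filter -(size_map om); apply: card_eq_seq.
  by rewrite map_inj_uniq ?filter_uniq ?iota_uniq//; apply: can_inj omK.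
move=> w; rewrite AP; split=> [Pw|/mapP[k + ->]].
  by rewrite -[w]unK map_f// mem_filter Pw mem_iota Pp.
by rewrite mem_filter omK => /andP[].
Qed.

Lemma count_mem_mkseq (T : eqType) (c : nat -> T) (t : T) p :
  count_mem t (mkseq c p) = count (fun k => c k == t) (iota 0 p).
Proof. by rewrite /mkseq count_map. Qed.

Lemma count_interval a b q : (b <= q)%N ->
  count (fun k => a <= k < b)%N (iota 0 q) = (b - a)%N.
Proof.
move=> bq; have -> : (b - a = minn b q - a)%N by lia.
elim: q {bq} => [|q IH]; first by rewrite minn0.
by rewrite -addn1 iotaD count_cat IH /=; lia.
Qed.

(** The size and the other multiplicities determine that of [t0]. In the applications [t0] is the
    infinite colour, whose multiplicity is not prescribed. *)
Lemma perm_eq_base (T : eqType) (t0 : T) (s t : seq T) : size s = size t ->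
  (forall j, j != t0 -> count_mem j s = count_mem j t) -> perm_eq s t.
Proof.
move=> st cst; have cE j : count_mem j s = count_mem j t; last first.
  by rewrite /perm_eq; apply/allP => j _; rewrite /= cE.
have [->|/cst//] := eqVneq j t0.
have e : count (predC1 t0) s = count (predC1 t0) t.
  rewrite -!size_filter; apply: perm_size; rewrite /perm_eq; apply/allP => i _ /=; apply/eqP.
  rewrite !count_filter; have [->|it] := eqVneq i t0.
    by rewrite !(@eq_count _ (predI _ _) pred0) ?count_pred0// => x /=; case: eqP.
  have e : predI (pred1 i) (predC1 t0) =1 pred1 i.
    by move=> x /=; case: (eqVneq x i) => // ->.
  by rewrite !(eq_count e) cst.
have := count_predC (pred1 t0) s; have := count_predC (pred1 t0) t.
by rewrite -[count (predC _) s]/(count (predC1 t0) s) e st => <- /eqP;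
  rewrite eqn_add2r => /eqP.
Qed.

Lemma match_base (T : eqType) (t0 : T) (c c' : nat -> T) (p : nat) :
  (forall k, (p <= k)%N -> c k = t0) -> (forall k, (p <= k)%N -> c' k = t0) ->
  (forall t, t != t0 -> count_mem t (mkseq c p) = count_mem t (mkseq c' p)) ->
  exists g : Sinf, forall k, c' (sn g k) = c k.
Proof.
move=> cp cp' cc; apply: (@match_colourings _ _ _ p) => [k pk|].
  by rewrite cp// cp'.
by apply: (@perm_eq_base _ t0); rewrite ?size_mkseq.
Qed.

(** * Points fixed by the stabilizer of an initial segment *)

Section Levels.
Variables (n : option nat).
Implicit Types b d l : Lambda n.

Lemma colb_count b j p : (1 < j)%N -> (wstart b j.+1 <= p)%N ->
  count (fun k => colb b k == j) (iota 0 p) = wt b j.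
Proof.
move=> j1 jp; rewrite (@eq_count _ _ (fun k => wstart b j <= k < wstart b j.+1)%N).
  by rewrite count_interval// wstartS// addKn.
by move=> k; rewrite colbP// /in_block j1.
Qed.

Lemma ck_count b (x : XX b) j p : Fp b p x -> (1 < j)%N ->
  count (fun k => ck x k == j) (iota 0 p) = wt b j.
Proof.
move=> xp j1; have [s xE] := coset_eltP x.
rewrite -(@colb_count b j _ j1 (leqnn _)).
apply: (@count_transport _ _ _ _ s) => k.
- by rewrite ltnNge; apply: contraTN => /xp ->; rewrite neq_ltn j1.
- by rewrite colbP// => /and3P[].
- by rewrite xE ck_elt snK.
Qed.

Lemma ck_realise b (c : nat -> nat) p :
  (forall k, (p <= k)%N -> c k = 1%N) -> (forall k, (0 < c k)%N) ->
  (forall j, (1 < j)%N -> count (fun k => c k == j) (iota 0 p) = wt b j) ->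
  exists2 x : XX b, Fp b p x & forall k, ck x k = c k.
Proof.
move=> cp c0 cw; pose x1 : XX b := coset_of_elt (Young b) 1%g.
have [q x1q] := ck_fin x1.
have [|||g gc] := @match_base _ 1%N (ck x1) c (maxn p q).
- by move=> k; rewrite geq_max => /andP[_ /x1q].
- by move=> k; rewrite geq_max => /andP[/cp].
- move=> t t1; rewrite !count_mem_mkseq; have [->|t0] := eqVneq t 0%N.
    by rewrite !(@eq_count _ _ pred0) ?count_pred0// => k /=; apply/negbTE;
      rewrite -lt0n ?ck_gt0.
  have x1m : Fp b (maxn p q) x1 by apply: FpW x1q; rewrite leq_maxr.
  rewrite (ck_count x1m); last by lia.
  rewrite -cw; last by lia.
  by apply: count_iota_bound => k; rewrite ltnNge; apply: contraTN => kp;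
    rewrite cp 1?eq_sym//; lia.
exists (fact g x1) => [k pk|k]; rewrite ck_act -gc snVK//.
by rewrite cp.
Qed.

Lemma ck_word b (x : XX b) p : Fp b p x -> mkseq (ck x) p \in words (kb b) (wt b) p.
Proof.
move=> xp; rewrite mem_words size_mkseq eqxx /=; apply/andP; split.
  by apply/allP => _ /mapP[k _ ->]; rewrite ck_gt0 ck_bound.
by apply/allP => j; rewrite mem_iota => /andP[j1 _];
  rewrite count_mem_mkseq ck_count.
Qed.

Definition decode b (p : nat) (s : seq nat) : XX b :=
  xget (coset_of_elt (Young b) 1%g : XX b)
    [set x : XX b | Fp b p x /\ mkseq (ck x) p = s].

Lemma decodeP b p s : s \in words (kb b) (wt b) p ->
  Fp b p (decode b p s) /\ mkseq (ck (decode b p s)) p = s.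
Proof.
rewrite mem_words => /and3P[/eqP sp /allP sK /allP sw].
pose c k := nth 1%N s k.
have [|||x xp xc] := @ck_realise b c p.
- by move=> k pk; rewrite /c nth_default// sp.
- move=> k; have [ks|ks] := ltnP k (size s); last by rewrite /c nth_default.
  by have /andP[] := sK _ (mem_nth 1%N ks).
- move=> j j1; rewrite -(count_mem_mkseq c) /c -sp mkseq_nth.
  have [jK|jK] := leqP j (kb b); first by apply/eqP/sw; rewrite mem_iota; lia.
  rewrite kbP 1?ltnW//; apply/eqP; rewrite -leqn0 leqNgt -has_count.
  by apply/negP => /hasP[i /sK /andP[_ iK] /eqP ij]; lia.
apply: (@xgetPex _ _ [set x : XX b | Fp b p x /\ mkseq (ck x) p = s]).
exists x; split=> //; rewrite (eq_mkseq xc) /c -sp mkseq_nth//.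
Qed.

Definition lv b (p : nat) : seq (XX b) := map (decode b p) (words (kb b) (wt b) p).

Lemma map_ck_lv b p : map (fun x => mkseq (ck x) p) (lv b p) = words (kb b) (wt b) p.
Proof.
rewrite /lv -map_comp -[RHS]map_id; apply/eq_in_map => s /decodeP[_ /= ->] //.
Qed.

Lemma lv_uniq b p : uniq (lv b p).
Proof. by apply: (@map_uniq _ _ (fun x => mkseq (ck x) p)); rewrite map_ck_lv words_uniq. Qed.

Lemma Fp_inj b p (x y : XX b) : Fp b p x -> Fp b p y ->
  mkseq (ck x) p = mkseq (ck y) p -> x = y.
Proof.
move=> xp yp xy; apply: ck_inj => k; have [kp|pk] := ltnP k p; last by rewrite xp ?yp.
by have := congr1 (fun s => nth 0%N s k) xy; rewrite !nth_mkseq.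
Qed.

Lemma mem_lv b p x : x \in lv b p <-> Fp b p x.
Proof.
split=> [/mapP[s /decodeP[sp _] ->]//|xp].
apply/mapP; exists (mkseq (ck x) p); first exact: ck_word.
have [dp dE] := decodeP (ck_word xp).
by apply: (Fp_inj xp dp); rewrite dE.
Qed.

Lemma Fp_fixed b p (x : XX b) :
  Fp b p x <-> forall s, pstab (initseg p) s -> fact s x = x.
Proof.
have ps (s : Sinf) : pstab (initseg p) s -> forall k, (k < p)%N -> sn s k = k.
  by move=> sp k kp; rewrite /sn sp.
split=> [xp s sp|xs k pk].
  have spV k : (p <= k)%N -> (p <= sn s^-1%g k)%N.
    move=> pk; rewrite leqNgt; apply/negP => kp.
    by have := ps _ sp _ kp; rewrite snVK => e; rewrite -e ltnNge pk in kp.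
  apply: ck_inj => k; rewrite ck_act; have [kp|pk] := ltnP k p.
    by rewrite -{1}(ps _ sp _ kp) snK.
  by rewrite !xp// spV.
have [q xq] := ck_fin x.
(* Position m lies outside the initial segment and has colour 1. Exchanging it with k fixes x, so k
   has colour 1 too. *)
pose m := (maxn p q); have mp : (p <= m)%N by rewrite leq_maxl.
have sw : pstab (initseg p) (Sinf_swap (om k) (om m)).
  move=> w; rewrite /initseg /= => wp; rewrite /Omega_swap.
  by case: eqP => [wk|_]; [|case: eqP => [wm|//]]; exfalso; move: wp;
    rewrite ?wk ?wm /=; lia.
rewrite -(xs _ sw) ck_act.
have -> : sn (Sinf_swap (om k) (om m))^-1%g k = m.
  by rewrite /sn /= /Omega_swap eqxx.
by apply: xq; rewrite leq_maxr.
Qed.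

Lemma Fp_act b p (x : XX b) s : pstab (initseg p) s -> Fp b p x -> fact s x = x.
Proof. by move=> sp /Fp_fixed; apply. Qed.

Lemma fixed_pointsP b (A : set (XX b)) p m :
  (fixed_points A p #= `I_m) <-> m = count (fun x => `[< A x >]) (lv b p).
Proof.
rewrite -size_filter; apply: card_eq_seq; first by rewrite filter_uniq ?lv_uniq.
move=> x; rewrite mem_filter; split=> [[Ax /Fp_fixed/mem_lv ->]|/andP[/asboolP Ax /mem_lv/Fp_fixed]].
  by rewrite andbT; apply/asboolP.
by [].
Qed.

Lemma same_prefix b N (x y : XX b) : (forall k, (k < N)%N -> ck x k = ck y k) ->
  exists2 u, pstab (initseg N) u & y = fact u x.
Proof.
move=> xy; have [p xp] := ck_fin x; have [q yq] := ck_fin y.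
(* A position k below N carries k + 1 besides its colour, a later one carries 0. A permutation
   matching these labels must fix every position below N. *)
pose lab (z : XX b) k := if (k < N)%N then (ck z k, k.+1) else (ck z k, 0%N).
pose P := maxn N (maxn p q).
have pP : (p <= P)%N by rewrite /P; lia.
have qP : (q <= P)%N by rewrite /P; lia.
have NP : (N <= P)%N by rewrite /P; lia.
have base (z : XX b) r : (r <= P)%N -> Fp b r z -> forall k, (P <= k)%N -> lab z k = (1, 0)%N.
  by move=> rP zr k Pk; rewrite /lab ltnNge (leq_trans NP Pk)/= zr// (leq_trans rP).
have spl (z : XX b) j : count_mem j (mkseq (fun k => (ck z k, 0%N)) P) =
   (count_mem j (mkseq (fun k => (ck z k, 0%N)) N) +
    count_mem j (map (lab z) (iota N (P - N))))%N.
  rewrite /mkseq -{1}(subnKC NP) iotaD map_cat count_cat; congr addn.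
  congr count; apply/eq_in_map => k; rewrite mem_iota /lab => /andP[Nk _].
  by rewrite ltnNge Nk.
have [|||g gl] := @match_base _ (1, 0)%N (lab x) (lab y) P.
- exact: base xp.
- exact: base yq.
- move=> j j1; have cc : count_mem j (mkseq (fun k => (ck x k, 0%N)) P) =
            count_mem j (mkseq (fun k => (ck y k, 0%N)) P).
    case: j j1 => i [|m] j1; rewrite !count_mem_mkseq; last first.
      by rewrite !(@eq_count _ _ pred0) ?count_pred0// => k; rewrite /= xpair_eqE andbF.
    have e (z : XX b) : (fun k => (ck z k, 0%N) == (i, 0%N)) =1 (fun k => ck z k == i).
      by move=> k; rewrite xpair_eqE eqxx andbT.
    rewrite !(eq_count (e _)); have i1 : i != 1%N by apply: contraNneq j1 => ->.
    have [->|i0] := eqVneq i 0%N.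
      by rewrite !(@eq_count _ _ pred0) ?count_pred0// => k /=; apply/negbTE;
        rewrite -lt0n ?ck_gt0.
    have i2 : (1 < i)%N by lia.
    by rewrite (ck_count (FpW pP xp) i2) (ck_count (FpW qP yq) i2).
  have e0 : mkseq (fun k => (ck x k, 0%N)) N = mkseq (fun k => (ck y k, 0%N)) N.
    by apply/eq_in_map => k; rewrite mem_iota => kN; rewrite xy.
  have e1 : mkseq (lab x) N = mkseq (lab y) N.
    by apply/eq_in_map => k; rewrite mem_iota /lab => /= kN; rewrite xy.
  move: cc; rewrite !spl e0 => /eqP; rewrite eqn_add2l => /eqP cc.
  rewrite /mkseq -(subnKC NP) iotaD !map_cat !count_cat; congr (_ + _)%N => //.
  by rewrite -!/(mkseq _ _) e1.
exists g => [w wN|].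
  have := gl (un w); rewrite /lab.
  have -> : (un w < N)%N by move: wN; rewrite /initseg /un /=; case: w => -[].
  by case: ifP => //= _ [_]; rewrite -un_sn => /(can_inj unK).
apply: ck_inj => k; rewrite ck_act; have := gl (sn g^-1%g k); rewrite snVK /lab.
by case: ifP => _; case: ifP => _ // [].
Qed.

End Levels.

(** * Evaluation of integrals at large integers *)

Definition ival (c : QT) : Prop := exists2 P, integer_valued P & c = P%:F.

Definition pol (c : QT) : {poly rat} := xget 0 [set P : {poly rat} | c = P%:F].

Lemma tofrac_inj (P Q : {poly rat}) : P%:F = Q%:F -> P = Q.
Proof. by move=> /eqP; rewrite tofrac_eq => /eqP. Qed.

Lemma polE (P : {poly rat}) : pol P%:F = P.
Proof. by apply: xget_unique => // Q /tofrac_inj. Qed.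

(** The value at T = p. Outside the polynomials [pol] returns 0, so sums and products are evaluated
    termwise only under [ival]. *)
Definition ev (p : nat) (c : QT) : rat := (pol c).[p%:R].

Lemma evE p (P : {poly rat}) : ev p P%:F = P.[p%:R].
Proof. by rewrite /ev polE. Qed.

Lemma ival_intr (z : int) : ival z%:~R.
Proof.
exists (z%:~R)%:P; first exact: integer_valuedC.
by rewrite -(rmorph_int (@FracField.tofrac {poly rat})) -(rmorph_int (@polyC rat)).
Qed.

Lemma ev_intr p (z : int) : ev p z%:~R = z%:~R.
Proof.
rewrite -(rmorph_int (@FracField.tofrac {poly rat})) -(rmorph_int (@polyC rat)).
by rewrite evE hornerC.
Qed.

Lemma ival_natr (k : nat) : ival k%:R.
Proof. by rewrite pmulrn; apply: ival_intr. Qed.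

Lemma ev_natr p (k : nat) : ev p k%:R = k%:R.
Proof. by rewrite pmulrn ev_intr -pmulrn. Qed.

Lemma ival0 : ival 0. Proof. exact: (ival_intr 0). Qed.
Lemma ival1 : ival 1. Proof. exact: (ival_intr 1). Qed.
Lemma ev0 p : ev p 0 = 0. Proof. exact: (ev_intr p 0). Qed.
Lemma ev1 p : ev p 1 = 1. Proof. exact: (ev_intr p 1). Qed.

Lemma ivalD a b : ival a -> ival b -> ival (a + b).
Proof.
move=> [P hP ->] [Q hQ ->]; exists (P + Q); first exact: integer_valuedD.
by rewrite rmorphD.
Qed.

Lemma ivalM a b : ival a -> ival b -> ival (a * b).
Proof.
move=> [P hP ->] [Q hQ ->]; exists (P * Q); first exact: integer_valuedM.
by rewrite rmorphM.
Qed.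

Lemma evD p a b : ival a -> ival b -> ev p (a + b) = ev p a + ev p b.
Proof. by move=> [P _ ->] [Q _ ->]; rewrite -rmorphD !evE hornerD. Qed.

Lemma evM p a b : ival a -> ival b -> ev p (a * b) = ev p a * ev p b.
Proof. by move=> [P _ ->] [Q _ ->]; rewrite -rmorphM !evE hornerM. Qed.

Lemma ival_sum (I : eqType) (r : seq I) (F : I -> QT) :
  (forall i, i \in r -> ival (F i)) -> ival (\sum_(i <- r) F i).
Proof.
move=> iF; rewrite big_seq; elim/big_ind: _ => //; [exact: ival0|exact: ivalD].
Qed.

Lemma ev_sum p (I : eqType) (r : seq I) (F : I -> QT) :
  (forall i, i \in r -> ival (F i)) ->
  ev p (\sum_(i <- r) F i) = \sum_(i <- r) ev p (F i).
Proof.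
elim: r => [|i r IH] iF; first by rewrite !big_nil ev0.
rewrite !big_cons evD ?IH//; first by move=> j jr; apply: iF; rewrite inE jr orbT.
  by apply: iF; rewrite mem_head.
by apply: ival_sum => j jr; apply: iF; rewrite inE jr orbT.
Qed.

Lemma ival_ext a b N : ival a -> ival b ->
  (forall p, (N <= p)%N -> ev p a = ev p b) -> a = b.
Proof.
move=> [P _ ->] [Q _ ->] PQ; congr (_ %:F); apply: (@polyrat_eq_large _ _ N) => p Np.
by rewrite -!evE PQ.
Qed.

Section Integrals.
Variables (n : option nat) (b : Lambda n).

(** By [same_prefix], membership in A depends only on the first N colours, so the fixed points are
    counted as words with a condition on a prefix. The formula is exact from p = N on, which later
    allows evaluation at the level of given points. *)
Lemma count_polyP (A : set (XX b)) N :
  (forall u, pstab (initseg N) u -> forall x, A x -> A (fact u x)) ->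
  integer_valued (count_poly A) /\
  forall p, (N <= p)%N ->
    (count_poly A).[p%:R] = (count (fun x => `[< A x >]) (lv b p))%:R.
Proof.
move=> Ast.
pose Q (s : seq nat) := `[< exists2 x, A x & forall k, (k < N)%N -> ck x k = nth 0%N s k >].
have QN s t : take N s = take N t -> Q s = Q t.
  move=> st; have e k : (k < N)%N -> nth 0%N s k = nth 0%N t k.
    by move=> kN; rewrite -(nth_take _ kN) st nth_take.
  by apply: asbool_equiv_eq; split=> -[x Ax xs]; exists x => // k kN;
    rewrite xs// e.
have [P PE] := @count_words_polynomial (kb b) (wt b) N Q isT QN.
have PA p : (N <= p)%N -> P.[p%:R] = (count (fun x => `[< A x >]) (lv b p))%:R.
  move=> Np; rewrite -PE// -map_ck_lv count_map; congr _%:R.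
  apply: eq_count => x /=; apply: asbool_equiv_eq; split=> [[y Ay yx]|Ax].
    have [|u uN ->] := @same_prefix _ _ N y x; last exact: Ast.
    by move=> k kN; rewrite yx// nth_mkseq// (leq_trans kN).
  by exists x => // k kN; rewrite nth_mkseq// (leq_trans kN).
have -> : count_poly A = P.
  apply: xget_unique => [|R [M RM]].
    exists N => p Np; exists (count (fun x => `[< A x >]) (lv b p)); last exact: PA.
    exact/fixed_pointsP.
  apply: (@polyrat_eq_large _ _ (maxn N M)) => p; rewrite geq_max => /andP[Np Mp].
  by have [m /fixed_pointsP mE ->] := RM p Mp; rewrite PA// mE.
split=> //; apply: (@integer_valued_large _ N) => p Np.
by rewrite PA// natr_int.
Qed.

Variables (phi : XX b -> QT) (N : nat).
Hypothesis phi_stable : forall u, pstab (initseg N) u ->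
  forall x, phi (fact u x) = phi x.

(** The function factors through the first N colours, and the colours are bounded. *)
Lemma stable_finite_range : finite_set (range phi).
Proof.
pose x1 : XX b := coset_of_elt (Young b) 1%g.
pose G (t : N.-tuple 'I_(kb b).+1) :=
  phi (xget x1 [set x | forall k, (k < N)%N -> ck x k = nth ord0 t k]).
apply: (@sub_finite_set _ _ [set G t | t in setT]); last exact/finite_image/finite_finset.
move=> _ [x _ <-].
pose t : N.-tuple 'I_(kb b).+1 := [tuple inord (ck x i) | i < N].
have tE k : (k < N)%N -> ck x k = nth ord0 t k.
  move=> kN; rewrite -[k]/(nat_of_ord (Ordinal kN)) -tnth_nth tnth_mktuple.
  by rewrite inordK// ltnS ck_bound.
exists t => //; rewrite /G; set y := xget _ _.
have yt : forall k, (k < N)%N -> ck y k = nth ord0 t k.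
  by apply: (@xgetPex _ x1 [set x | forall k, (k < N)%N -> ck x k = nth ord0 t k]); exists x.
have [|u uN ->] := @same_prefix _ _ N x y; last by rewrite phi_stable.
by move=> k kN; rewrite tE// yt.
Qed.

Hypothesis phi_ival : forall x, ival (phi x).

(** Sorting the points of level p by their value under [phi] turns values weighted by counts into a
    sum over points. *)
Lemma integral_ev : ival (integral phi) /\
  forall p, (N <= p)%N -> ev p (integral phi) = \sum_(x <- lv b p) ev p (phi x).
Proof.
have fin := stable_finite_range.
have cP c : integer_valued (count_poly (phi @^-1` [set c])) /\
    forall p, (N <= p)%N -> (count_poly (phi @^-1` [set c])).[p%:R] =
      (count (fun x => phi x == c) (lv b p))%:R.
  have [|i pE] := @count_polyP (phi @^-1` [set c]) N.
    by move=> u uN x; rewrite /= phi_stable.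
  split=> // p Np; rewrite pE//; congr _%:R; apply: eq_count => x.
  by apply/asboolP/eqP.
have iv c : c \in fset_set (range phi) -> ival c.
  by rewrite in_fset_set// => /set_mem[x _ <-].
have im c : ival (muT (phi @^-1` [set c])) by eexists; [apply: (cP c).1|].
rewrite /integral fsbig_finite//=; split=> [|p Np].
  by apply: ival_sum => c /iv ic; apply: ivalM.
rewrite ev_sum; last by move=> c /iv ic; apply: ivalM.
rewrite big_seq.
under eq_bigr => c /iv ic.
  rewrite evM// /muT evE (cP c).2// -sum1_count natr_sum mulr_sumr big_mkcond /=.
  over.
rewrite -big_seq exchange_big /=; apply: eq_bigr => x _.
rewrite -big_mkcond /= -big_filter.
rewrite (eq_filter (a2 := pred1 (phi x))); last by move=> c /=; rewrite eq_sym.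
rewrite filter_pred1_uniq ?fset_uniq//; first by rewrite big_seq1 mulr1.
suff : phi x \in fset_set (range phi) by [].
by rewrite in_fset_set//; apply/mem_set; exists x.
Qed.

End Integrals.

(** * Composition as matrix multiplication at finite levels *)

Section Composition.
Variable n : option nat.
Implicit Types b c d l : Lambda n.

(** An element of the algebra lies in [Tspan] exactly when all its components satisfy this: see
    [Tspan_scomp] and [Tspan_of_scomp]. *)
Definition iHom b d (f : Hom (XX b) (XX d)) : Prop := forall y x, ival (f y x).

Lemma iHom_ext b d (f g : Hom (XX b) (XX d)) : iHom f -> iHom g ->
  (forall p y x, Fp d p y -> Fp b p x -> ev p (f y x) = ev p (g y x)) -> f = g.
Proof.
move=> fi gi fg; apply: Hom_ext => y x.
have [q yq] := ck_fin y; have [r xr] := ck_fin x.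
apply: (@ival_ext _ _ (maxn q r)) => // p; rewrite geq_max => /andP[qp rp].
by apply: fg; [apply: FpW yq|apply: FpW xr].
Qed.

Section Comp.
Variables (b c d : Lambda n) (g : Hom (XX c) (XX d)) (f : Hom (XX b) (XX c)).
Hypotheses (gi : iHom g) (fi : iHom f).

(** Since z and x are fixed by [pstab (initseg p)], the integrand is invariant under this group as a
    function of y, so evaluation is valid at this very p. *)
Lemma hcomp_integral z x p : Fp d p z -> Fp b p x ->
  ival (hcomp g f z x) /\
  ev p (hcomp g f z x) = \sum_(y <- lv c p) ev p (g z y) * ev p (f y x).
Proof.
move=> zp xp; have [||i e] := @integral_ev n c (fun y => g z y * f y x) p.
- move=> u up y; rewrite -{1}(Fp_act up zp) -{1}(Fp_act up xp) !hfunP //.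
- by move=> y; apply: ivalM.
split=> //; rewrite -[LHS]/(ev p (integral _)) e//.
by apply: eq_bigr => y _; rewrite evM.
Qed.

Lemma iHom_comp : iHom (hcomp g f).
Proof.
move=> z x; have [q zq] := ck_fin z; have [r xr] := ck_fin x.
have zm : Fp d (maxn q r) z by apply: FpW zq; rewrite leq_maxl.
have xm : Fp b (maxn q r) x by apply: FpW xr; rewrite leq_maxr.
by have [] := hcomp_integral zm xm.
Qed.

Lemma hcomp_ev p z x : Fp d p z -> Fp b p x ->
  ev p (hcomp g f z x) = \sum_(y <- lv c p) ev p (g z y) * ev p (f y x).
Proof. by move=> zp xp; have [] := hcomp_integral zp xp. Qed.

End Comp.

Lemma iHom0 b d : iHom (0 : Hom (XX b) (XX d)).
Proof. by move=> y x; apply: ival0. Qed.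

Lemma iHomD b d (f g : Hom (XX b) (XX d)) : iHom f -> iHom g -> iHom (f + g).
Proof. by move=> fi gi y x; apply: ivalD. Qed.

Lemma iHomZ b d a (f : Hom (XX b) (XX d)) : ival a -> iHom f -> iHom (a *: f).
Proof. by move=> ai fi y x; apply: ivalM. Qed.

Lemma hcompA a b c d (h : Hom (XX c) (XX d)) (g : Hom (XX b) (XX c))
    (f : Hom (XX a) (XX b)) : iHom h -> iHom g -> iHom f ->
  hcomp h (hcomp g f) = hcomp (hcomp h g) f.
Proof.
move=> hi gi fi; apply: iHom_ext => [||p z x zp xp].
- by apply: iHom_comp => //; apply: iHom_comp.
- by apply: iHom_comp => //; apply: iHom_comp.
rewrite hcomp_ev//; last exact: iHom_comp.
rewrite hcomp_ev//; last exact: iHom_comp.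
rewrite [LHS]big_seq [RHS]big_seq.
under eq_bigr => y /mem_lv yp do rewrite hcomp_ev// mulr_sumr.
under [RHS]eq_bigr => y /mem_lv yp do rewrite hcomp_ev// mulr_suml.
rewrite -!big_seq exchange_big /=; apply: eq_bigr => y _.
by apply: eq_bigr => w _; rewrite mulrA.
Qed.

Lemma hcompDr b c d (g : Hom (XX c) (XX d)) (f f' : Hom (XX b) (XX c)) :
  iHom g -> iHom f -> iHom f' -> hcomp g (f + f') = hcomp g f + hcomp g f'.
Proof.
move=> gi fi fi'; have fD := iHomD fi fi'.
have gf := iHom_comp gi fi; have gf' := iHom_comp gi fi'.
apply: iHom_ext => [||p z x zp xp]; [exact: iHom_comp|exact: iHomD|].
rewrite hcomp_ev// evD// !hcomp_ev// -big_split /=; apply: eq_bigr => y _.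
by rewrite evD// mulrDr.
Qed.

Lemma hcompZr b c d a (g : Hom (XX c) (XX d)) (f : Hom (XX b) (XX c)) :
  ival a -> iHom g -> iHom f -> hcomp g (a *: f) = a *: hcomp g f.
Proof.
move=> ai gi fi; have fZ := iHomZ ai fi; have gf := iHom_comp gi fi.
apply: iHom_ext => [||p z x zp xp]; [exact: iHom_comp|exact: iHomZ|].
rewrite hcomp_ev// evM// hcomp_ev// mulr_sumr; apply: eq_bigr => y _.
by rewrite evM// mulrCA.
Qed.

Definition htr b d (f : Hom (XX b) (XX d)) : Hom (XX d) (XX b) :=
  @MkHom (XX d) (XX b) (fun x y => f y x) (fun s x y => hfunP f s y x).

Lemma htrK b d (f : Hom (XX b) (XX d)) : htr (htr f) = f.
Proof. exact: Hom_ext. Qed.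

Lemma iHom_tr b d (f : Hom (XX b) (XX d)) : iHom f -> iHom (htr f).
Proof. by move=> fi y x; apply: fi. Qed.

Lemma htr_comp b c d (g : Hom (XX c) (XX d)) (f : Hom (XX b) (XX c)) :
  htr (hcomp g f) = hcomp (htr f) (htr g).
Proof.
by apply: Hom_ext => x z; congr integral; apply/funext => y; rewrite mulrC.
Qed.

End Composition.

(** * Relative positions of pairs of colourings *)

Section Types.
Variable n : option nat.
Implicit Types b c d l : Lambda n.

Definition level_type d b (p : nat) (z : XX d) (x : XX b) (i j : nat) : nat :=
  count (fun k => (ck z k == i) && (ck x k == j)) (iota 0 p).

Lemma Fp_pair d b (z : XX d) (x : XX b) : exists p, Fp d p z /\ Fp b p x.
Proof.
have [q zq] := ck_fin z; have [r xr] := ck_fin x.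
by exists (maxn q r); split; [apply: FpW zq|apply: FpW xr];
  rewrite ?leq_maxl ?leq_maxr.
Qed.

(* The entry (1, 1) is infinite; it is replaced by 0. *)
Definition ty d b (z : XX d) (x : XX b) (i j : nat) : nat :=
  if (i == 1%N) && (j == 1%N) then 0%N
  else level_type (sval (cid (Fp_pair z x))) z x i j.

Lemma ty11 d b (z : XX d) (x : XX b) : ty z x 1 1 = 0%N.
Proof. by []. Qed.

Lemma finite_position d b (z : XX d) (x : XX b) p i j : Fp d p z -> Fp b p x ->
  ~~ ((i == 1%N) && (j == 1%N)) ->
  forall k, (ck z k == i) && (ck x k == j) -> (k < p)%N.
Proof.
move=> zp xp; rewrite negb_and => ij k /andP[/eqP zk /eqP xk].
by rewrite ltnNge; apply: contraTN ij => pk; rewrite -zk -xk zp// xp.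
Qed.

Lemma tyE d b p (z : XX d) (x : XX b) i j : Fp d p z -> Fp b p x ->
  ~~ ((i == 1%N) && (j == 1%N)) -> ty z x i j = level_type p z x i j.
Proof.
move=> zp xp ij; rewrite /ty (negbTE ij); case: cid => q [zq xq] /=.
by apply: count_iota_bound; apply: finite_position.
Qed.

Lemma tyC d b (z : XX d) (x : XX b) i j : ty x z j i = ty z x i j.
Proof.
have [p [zp xp]] := Fp_pair z x.
have [ij|ij] := boolP ((i == 1%N) && (j == 1%N)).
  by rewrite /ty ij andbC ij.
rewrite !(@tyE _ _ p)// 1?andbC//; apply: eq_count => k; exact: andbC.
Qed.

Lemma ty_act d b g (z : XX d) (x : XX b) : ty (fact g z) (fact g x) = ty z x.
Proof.
apply/funext => i; apply/funext => j.
have [p [zp xp]] := Fp_pair z x; have [q [zq xq]] := Fp_pair (fact g z) (fact g x).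
have [ij|ij] := boolP ((i == 1%N) && (j == 1%N)); first by rewrite /ty ij.
rewrite (tyE zq xq ij) (tyE zp xp ij); apply: (@count_transport _ _ _ _ g).
- exact: finite_position.
- exact: finite_position.
by move=> k; rewrite !ck_act snK.
Qed.

(** The pairs of colours form one colouring whose only infinite colour is (1, 1), so [match_base]
    applies without that entry. *)
Lemma ty_orbit d b (z z' : XX d) (x x' : XX b) : ty z x = ty z' x' ->
  exists g, z' = fact g z /\ x' = fact g x.
Proof.
move=> zx; have [p [zp xp]] := Fp_pair z x; have [q [zq xq]] := Fp_pair z' x'.
pose r := maxn p q.
have zr : Fp d r z by apply: FpW zp; rewrite leq_maxl.
have xr : Fp b r x by apply: FpW xp; rewrite leq_maxl.
have zr' : Fp d r z' by apply: FpW zq; rewrite leq_maxr.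
have xr' : Fp b r x' by apply: FpW xq; rewrite leq_maxr.
have [|||g gE] := @match_base _ (1, 1)%N (fun k => (ck z k, ck x k))
    (fun k => (ck z' k, ck x' k)) r.
- by move=> k rk; rewrite zr// xr.
- by move=> k rk; rewrite zr'// xr'.
- move=> [i j]; rewrite xpair_eqE => ij; rewrite !count_mem_mkseq.
  have := congr1 (fun t => t i j) zx; rewrite (tyE zr xr ij) (tyE zr' xr' ij).
  by [].
by exists g; split; apply: ck_inj => k; rewrite ck_act;
  have [] := gE (sn g^-1%g k); rewrite snVK.
Qed.

Lemma Hom_ty d b (f : Hom (XX b) (XX d)) z x z' x' :
  ty z x = ty z' x' -> f z x = f z' x'.
Proof. by move=> /ty_orbit[g [-> ->]]; rewrite hfunP. Qed.

(** The indicator of the orbit with matrix m, which [xi_hom_ty] identifies with [xi_hom]. *)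
Definition XI d b (m : nat -> nat -> nat) : Hom (XX b) (XX d) :=
  @MkHom (XX b) (XX d) (fun z x => if `[< ty z x = m >] then 1 else 0)
    (fun s z x => congr1 (fun t => if `[< t = m >] then 1 else 0) (ty_act s z x)).

Lemma iHom_XI d b m : iHom (XI d b m).
Proof. by move=> z x /=; case: asboolP => _; [apply: ival1|apply: ival0]. Qed.

Lemma XI_tr d b m : htr (XI d b m) = XI b d (fun i j => m j i).
Proof.
apply: Hom_ext => x z /=; congr (if _ then _ else _).
apply: asbool_equiv_eq; split=> [<-|e].
  by apply/funext => i; apply/funext => j; rewrite tyC.
apply/funext => i; apply/funext => j; rewrite -tyC.
by rewrite e.
Qed.

Lemma ty_range d b (z : XX d) (x : XX b) i j :
  ty z x i j != 0%N -> in_range n i /\ in_range n j.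
Proof.
have [p [zp xp]] := Fp_pair z x.
have [ij|ij] := boolP ((i == 1%N) && (j == 1%N)); first by rewrite /ty ij.
rewrite (tyE zp xp ij) -lt0n -has_count => /hasP[k _ /andP[/eqP <- /eqP <-]].
by split; apply: ck_range.
Qed.

Lemma ty_bound d b (z : XX d) (x : XX b) i j :
  ty z x i j != 0%N -> (i <= kb d)%N /\ (j <= kb b)%N.
Proof.
have [p [zp xp]] := Fp_pair z x.
have [ij|ij] := boolP ((i == 1%N) && (j == 1%N)); first by rewrite /ty ij.
rewrite (tyE zp xp ij) -lt0n -has_count => /hasP[k _ /andP[/eqP <- /eqP <-]].
by split; apply: ck_bound.
Qed.

Lemma ty_le_row d b (z : XX d) (x : XX b) i j : (1 < i)%N -> (ty z x i j <= wt d i)%N.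
Proof.
move=> i1; have [p [zp xp]] := Fp_pair z x.
rewrite (tyE zp xp) ?(gtn_eqF i1)// -(ck_count zp i1).
by apply: sub_count => k /andP[].
Qed.

(** Every nonzero entry lies in a row or in a column of finite weight, which bounds it, and [kb]
    bounds the support. *)
Lemma finite_types d b :
  exists L : seq (nat -> nat -> nat), uniq L /\
    forall (z : XX d) (x : XX b), ty z x \in L.
Proof.
pose D := (kb d).+1; pose B := (kb b).+1.
pose W := (\max_(i < D) wt d i + \max_(j < B) wt b j).+1.
pose G (t : {ffun 'I_D * 'I_B -> 'I_W}) (i j : nat) : nat :=
  if (i < D)%N && (j < B)%N then nat_of_ord (t (inord i, inord j)) else 0%N.
exists (undup (map G (enum {ffun 'I_D * 'I_B -> 'I_W}))); split=> [|z x].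
  exact: undup_uniq.
rewrite mem_undup; apply/mapP.
exists [ffun ij : 'I_D * 'I_B => inord (ty z x ij.1 ij.2)]; first exact: mem_enum.
apply/funext => i; apply/funext => j; rewrite /G.
case: ifPn => [/andP[iD jB]|ij]; last first.
  apply/eqP; rewrite -leqn0 leqNgt -ltnS; apply: contra ij.
  by rewrite -/(leq _ _) ltnS lt0n => /ty_bound[]; rewrite /D /B !ltnS => -> ->.
rewrite ffunE /= !inordK//.
have [i1|i1] := ltnP 1 i.
  apply: (leq_trans (ty_le_row z x j i1)).
  apply: leq_trans (leq_addr _ _).
  exact: (@leq_bigmax _ (fun i : 'I_D => wt d i) (Ordinal iD)).
have [j1|j1] := ltnP 1 j.
  rewrite -tyC; apply: (leq_trans (ty_le_row x z i j1)).
  apply: leq_trans (leq_addl _ _).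
  exact: (@leq_bigmax _ (fun j : 'I_B => wt b j) (Ordinal jB)).
suff -> : ty z x i j = 0%N by [].
have [ij|ij] := boolP ((i == 1%N) && (j == 1%N)); first by rewrite /ty ij.
apply/eqP; apply: contraT => /ty_range[[i0 _] [j0 _]]; lia.
Qed.

Lemma sum_HomE d b (I : Type) (r : seq I) (F : I -> Hom (XX b) (XX d)) z x :
  (\sum_(i <- r) F i) z x = \sum_(i <- r) F i z x.
Proof. by elim: r => [|i r IH]; rewrite ?big_nil// !big_cons /= IH. Qed.

(** An invariant function is the finite sum of its values times orbit indicators. As an induction
    principle this leaves only the orbits on which f does not vanish. *)
Lemma iHom_decompose d b (P : Hom (XX b) (XX d) -> Prop) (f : Hom (XX b) (XX d)) :
  P 0 -> (forall g h, P g -> P h -> P (g + h)) ->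
  (forall z x, f z x != 0 -> P (f z x *: XI d b (ty z x))) -> P f.
Proof.
move=> P0 PD Pf; have [L [uL LP]] := finite_types d b.
pose F m := xget 0 [set a | exists (z : XX d) (x : XX b), ty z x = m /\ a = f z x].
have FE z x : F (ty z x) = f z x.
  by apply: xget_unique; [exists z, x|move=> _ [z' [x' [/Hom_ty e ->]]]].
have -> : f = \sum_(m <- L) F m *: XI d b m.
  apply: Hom_ext => z x; rewrite sum_HomE /=.
  under eq_bigr do rewrite (fun_if (GRing.mul _)) mulr1 mulr0.
  rewrite -big_mkcond /= -big_filter.
  rewrite (eq_filter (a2 := pred1 (ty z x))).
    by rewrite filter_pred1_uniq// big_seq1 FE.
  by move=> m /=; apply/asboolP/eqP => ->.
elim: L {uL LP} => [|m L IH]; first by rewrite big_nil.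
rewrite big_cons; apply: (PD (F m *: XI d b m)); last exact: IH.
have [ex|nex] := pselect (exists (z : XX d) (x : XX b), ty z x = m).
  have [z [x <-]] := ex; rewrite FE.
  by have [->|/Pf//] := eqVneq (f z x) 0; rewrite scale0r.
rewrite /F xgetPN ?scale0r// => a [z [x [e _]]]; apply: nex; by exists z, x.
Qed.

End Types.

(** * The basis elements and their defining matrices *)

Lemma count_partition (f : nat -> nat) (P : pred nat) (s : seq nat) K :
  (forall k, (f k < K)%N) ->
  (\sum_(i < K) count (fun k => (f k == i) && P k) s)%N = count P s.
Proof.
move=> fK; elim: s => [|a s IH] /=; first by rewrite big1.
rewrite big_split /= IH; congr addn; rewrite (bigD1 (Ordinal (fK a)))//= eqxx /=.
by rewrite big1 ?addn0// => i; rewrite -val_eqE /= eq_sym => /negbTE ->.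
Qed.

Lemma fsbig_below (R : nmodType) (F : nat -> R) K :
  (forall i, (K <= i)%N -> F i = 0) -> \sum_(i \in [set: nat]) F i = \sum_(i < K) F i.
Proof.
move=> F0; rewrite fsbig_ord; apply/esym/fsbig_widen => // i [_ /= iK].
by apply: F0; rewrite leqNgt; apply/negP.
Qed.

Section Matrices.
Variable n : option nat.
Implicit Types b c d l : Lambda n.

(** Restores the entry (1, 1) of a type m, for which [m 1 1] is 0: it is T minus the other entries,
    for K beyond the support. *)
Definition qmat (K : nat) (m : nat -> nat -> nat) (i j : nat) : QT :=
  (if (i == 1%N) && (j == 1%N) then TT - (\sum_(i < K) \sum_(j < K) m i j)%:R
   else 0) + (m i j)%:R.

Lemma qmatE K m i j : ~~ ((i == 1%N) && (j == 1%N)) -> qmat K m i j = (m i j)%:R.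
Proof. by move=> /negbTE ij; rewrite /qmat ij add0r. Qed.

Lemma qmat_tr K m : qtranspose (qmat K m) = qmat K (fun i j => m j i).
Proof.
apply/funext => i; apply/funext => j; rewrite /qtranspose /qmat andbC.
by rewrite exchange_big.
Qed.

Lemma lseq_first b K : (kb b < K)%N -> b 1%N = TT - (\sum_(i < K) wt b i)%:R.
Proof.
move=> K1; have K2 : (1 < K)%N by move: K1; rewrite /kb; lia.
have S : \sum_(i < K) b i = b 1%N + (\sum_(i < K) wt b i)%:R.
  rewrite natr_sum (bigD1 (Ordinal K2))// [in RHS](bigD1 (Ordinal K2))//=.
  rewrite (wt0 b (leqnn 1)) add0r; congr (_ + _).
  apply: eq_bigr => i; rewrite -val_eqE /= => i1.
  have [i2|i2] := ltnP 1 i; first by rewrite -wtE.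
  rewrite wt0//; apply: lseq_out => -[]; lia.
rewrite -(lseq_sum b) (@fsbig_below _ _ K) ?S ?addrK// => i Ki.
rewrite wtE ?kbP//; move: K1 Ki; rewrite /kb; lia.
Qed.

Lemma level_col d b (z : XX d) (x : XX b) p K j : (kb d < K)%N ->
  (\sum_(i < K) level_type p z x i j)%N = count (fun k => ck x k == j) (iota 0 p).
Proof.
by move=> dK; apply: count_partition => k; apply: leq_ltn_trans (ck_bound z k) dK.
Qed.

Lemma level_typeC d b (z : XX d) (x : XX b) p i j :
  level_type p x z j i = level_type p z x i j.
Proof. by apply: eq_count => k; rewrite andbC. Qed.

Lemma ty_col d b (z : XX d) (x : XX b) K j : (kb d < K)%N -> (1 < j)%N ->
  (\sum_(i < K) ty z x i j)%N = wt b j.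
Proof.
move=> dK j1; have [p [zp xp]] := Fp_pair z x.
rewrite -(ck_count xp j1) -(level_col z x p j dK); apply: eq_bigr => i _.
by rewrite (tyE zp xp)// (gtn_eqF j1) andbF.
Qed.

Lemma ty_row d b (z : XX d) (x : XX b) K i : (kb b < K)%N -> (1 < i)%N ->
  (\sum_(j < K) ty z x i j)%N = wt d i.
Proof.
by move=> bK i1; rewrite -(ty_col x z bK i1); apply: eq_bigr => j _; rewrite tyC.
Qed.

Lemma qmat_out d b (z : XX d) (x : XX b) K i j : (kb d < K)%N -> (kb b < K)%N ->
  (K <= i)%N || (K <= j)%N -> qmat K (ty z x) i j = 0.
Proof.
move=> dK bK ij; rewrite qmatE.
  case: (eqVneq (ty z x i j) 0%N) => [->//|/ty_bound[]]; lia.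
move: dK bK; rewrite /kb; lia.
Qed.

Lemma qmat_col d b (z : XX d) (x : XX b) K j : (kb d < K)%N -> (kb b < K)%N ->
  \sum_(i \in [set: nat]) qmat K (ty z x) i j = b j.
Proof.
move=> dK bK; rewrite (@fsbig_below _ _ K); last first.
  by move=> i Ki; rewrite qmat_out// Ki.
have K1 : (1 < K)%N by move: dK; rewrite /kb; lia.
rewrite /qmat big_split /=.
have -> : \sum_(i < K) (if (i == 1%N :> nat) && (j == 1%N)
    then TT - (\sum_(i < K) \sum_(j < K) ty z x i j)%:R else 0) =
    if j == 1%N then TT - (\sum_(i < K) \sum_(j < K) ty z x i j)%:R else 0.
  rewrite (bigD1 (Ordinal K1))//= [X in _ + X]big1 ?addr0// => i.
  by rewrite -val_eqE /= => /negbTE ->.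
rewrite -natr_sum; case: (ltngtP j 1%N) => j1.
- rewrite add0r big1 ?lseq_out//; first by move=> []; lia.
  move=> i _; case: (eqVneq (ty z x i j) 0%N) => // /ty_range[_ []]; lia.
- by rewrite add0r ty_col// -wtE.
(* T minus all entries plus those of column 1 is T minus the sum of the other columns, which are the
   finite parts of b. *)
rewrite j1 (lseq_first bK) exchange_big /= (bigD1 (Ordinal K1))//=.
rewrite [in X in _ = _ - X%:R](bigD1 (Ordinal K1))//= (wt0 b (leqnn 1)) add0n.
rewrite natrD opprD addrA addrAC subrK; congr (_ - _%:R).
apply: eq_bigr => i; rewrite -val_eqE /= => i1.
have [i2|i2] := ltnP 1 i; first exact: ty_col.
rewrite wt0// big1// => k _; case: (eqVneq (ty z x k i) 0%N) => // /ty_range[_ []].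
lia.
Qed.

Lemma Mat_ty d b (z : XX d) (x : XX b) K : (kb d < K)%N -> (kb b < K)%N ->
  Mat d b (qmat K (ty z x)).
Proof.
move=> dK bK; have K1 : (1 < K)%N by move: dK; rewrite /kb; lia.
have col j := qmat_col z x j dK bK.
have supp : [set ij : nat * nat | qmat K (ty z x) ij.1 ij.2 != 0] `<=` `I_K `*` `I_K.
  move=> [i j] /=; apply: contra_neqP => ij; apply: qmat_out => //.
  rewrite leqNgt [(K <= j)%N]leqNgt -negb_and; apply/negP => /andP[].
  by move=> iK jK; apply: ij.
split.
  move=> i j ij; have [/andP[/eqP i1 /eqP j1]|ij1] := boolP ((i == 1%N) && (j == 1%N)).
    by exfalso; apply: ij; rewrite i1 j1; split; apply: Lambda_range1 b.
  by rewrite qmatE//; case: (eqVneq (ty z x i j) 0%N) => [->//|/ty_range/ij].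
split.
  by exists (\sum_(i < K) \sum_(j < K) ty z x i j)%N%:Z; rewrite /qmat /= addr0 -pmulrn.
split.
  move=> i j ij; rewrite qmatE; first by exists (ty z x i j).
  by apply/negP => /andP[/eqP i1 /eqP j1]; apply: ij; rewrite i1 j1.
split; first by apply: sub_finite_set supp _; apply: finite_setX; apply: finite_II.
split; last split=> //.
  rewrite -(@fsbig_widen _ _ _ _ (`I_K `*` `I_K) setT)//; last first.
    move=> ij [_ /= nij]; apply/eqP; apply: contraPT nij => ijn.
    by apply; apply: supp.
  rewrite -(@pair_fsbig _ _ _ _ _ `I_K `I_K (fun i j => qmat K (ty z x) i j))//.
  rewrite exchange_fsbig//= -(lseq_sum b) [RHS](@fsbig_below _ _ K).
    rewrite -fsbig_ord; apply: eq_bigr => j _; rewrite -col (@fsbig_below _ _ K)//.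
      by rewrite -fsbig_ord.
    by move=> i Ki; rewrite qmat_out// Ki.
  by move=> j jK; rewrite -col fsbig1// => i _; rewrite qmat_out// jK orbT.
move=> i; rewrite -(qmat_col x z i bK dK); apply: eq_fsbigr => j _.
rewrite -[RHS]/(qtranspose (qmat K (ty x z)) i j) qmat_tr.
by congr (qmat K _ i j); apply/funext => u; apply/funext => v; rewrite tyC.
Qed.

Lemma rel_positionP d b q s : rel_position d b q s <->
  forall i j, in_range n i -> in_range n j -> (i, j) <> (1, 1)%N ->
    q i j = (ty (coset_of_elt (Young d) 1%g : XX d)
                (coset_of_elt (Young b) s : XX b) i j)%:R.
Proof.
set z : XX d := coset_of_elt _ _; set x : XX b := coset_of_elt _ _.
have [p [zp xp]] := Fp_pair z x.
have cardE i j m : in_range n i -> in_range n j -> (i, j) <> (1, 1)%N ->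
    (block d i `&` ((s : Omega -> Omega) @` block b j) #= `I_m) <-> m = ty z x i j.
  move=> [i0 _] [j0 _] ij; have {}ij : ~~ ((i == 1%N) && (j == 1%N)).
    by apply/negP => /andP[/eqP i1 /eqP j1]; apply: ij; rewrite i1 j1.
  rewrite (tyE zp xp ij); apply: card_positions.
    exact: finite_position zp xp ij.
  move=> w; split=> [[/blockP zi [v /blockP bv vw]]|/andP[/eqP zi /eqP xj]].
    apply/andP; split; apply/eqP; first by rewrite /z ck_elt -(zi i0).
    by rewrite -vw /x ck_elt un_sn snK bv.
  split; first by apply/blockP => //; rewrite -zi /z ck_elt.
  exists (s^-1%g w); last by rewrite -SinfM mulgV.
  by apply/blockP => //; rewrite un_sn -xj /x ck_elt.
split=> [qs i j ir jr ij|qs i j ir jr ij].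
  by have [m /cardE -> // ->] := qs i j ir jr ij.
by exists (ty z x i j); [apply/cardE|apply: qs].
Qed.

Lemma xi_orbit_ty d b q (y : XX d) (x : XX b) : xi_orbit q y x <->
  forall i j, in_range n i -> in_range n j -> (i, j) <> (1, 1)%N ->
    q i j = (ty y x i j)%:R.
Proof.
split=> [[s /rel_positionP qs [t [-> ->]]] i j ir jr ij|qy].
  by rewrite ty_act qs.
have [t yE] := coset_eltP y; have [u xE] := coset_eltP x.
have y1 : y = fact t (coset_of_elt (Young d) 1%g : XX d).
  by rewrite /= coset_act_elt mulg1.
have x1 : x = fact t (coset_of_elt (Young b) (t^-1 * u)%g : XX b).
  by rewrite /= coset_act_elt mulgA mulgV mul1g.
exists (t^-1 * u)%g; last by exists t.
by apply/rel_positionP => i j ir jr ij; rewrite qy// y1 x1 ty_act.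
Qed.

Lemma xi_hom_ty d b (z0 : XX d) (x0 : XX b) K :
  xi_hom d b (qmat K (ty z0 x0)) = XI d b (ty z0 x0).
Proof.
apply: Hom_ext => y x /=; congr (if _ then _ else _).
apply: asbool_equiv_eq; rewrite xi_orbit_ty; split=> [q|-> i j _ _ ij].
  apply/funext => i; apply/funext => j.
  have [ij|ij] := boolP ((i == 1%N) && (j == 1%N)); first by rewrite /ty ij.
  have [e|/ty_range[ir jr]] := eqVneq (ty y x i j) 0%N.
    rewrite e; have [//|/ty_range[ir jr]] := eqVneq (ty z0 x0 i j) 0%N.
    rewrite -e; have := q i j ir jr; rewrite qmatE// => /(_ _)/QT_natr_inj ->//.
    by move=> [i1 j1]; rewrite i1 j1 in ij.
  have := q i j ir jr; rewrite qmatE// => /(_ _)/QT_natr_inj ->//.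
  by move=> [i1 j1]; rewrite i1 j1 in ij.
by rewrite qmatE//; apply/negP => /andP[/eqP i1 /eqP j1]; apply: ij; rewrite i1 j1.
Qed.

End Matrices.

(** * Semistandardness *)

(** Turns the comparison of entries in a column of a tableau into a comparison of multiplicities. *)
Lemma sorted_count_lt (s : seq nat) (j c : nat) : sorted leq s ->
  (c < count (fun x => x < j) s)%N = (c < size s)%N && (nth 0%N s c < j)%N.
Proof.
elim: s c => [|a s IH] c /=; first by rewrite ltn0.
move=> as_; have ss := path_sorted as_.
have [aj|ja] := ltnP a j; first by case: c => [|c] //=; rewrite add1n !ltnS IH.
have big x : x \in s -> (j <= x)%N.
  move=> xs; apply: leq_trans ja _.
  by have /allP/(_ x xs) := order_path_min leq_trans as_.
rewrite add0n; have -> : count (fun x => x < j)%N s = 0%N.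
  by apply/eqP; rewrite -leqn0 leqNgt -has_count -all_predC; apply/allP => x /big;
    rewrite /= -leqNgt.
rewrite ltn0; apply/esym/negP => /andP[cs]; case: c cs => [_|c cs] /=.
  by rewrite ltnNge ja.
by rewrite ltnNge big// mem_nth.
Qed.

(* Column strictness of rows i and i+1 in terms of multiplicities: at most as
   many entries <= j in row i+1 as entries < j in row i. Row 1 starts with
   infinitely many 1's, so that there only j = 1 is a condition. *)
Definition good (m : nat -> nat -> nat) : Prop :=
  forall i j, (0 < i)%N -> (0 < j)%N -> (i = 1 -> j = 1)%N ->
    (\sum_(u < j.+1) m i.+1 u <= \sum_(u < j) m i u)%N.

Section Good.
Variable n : option nat.
Implicit Types b l : Lambda n.

(** Only the entry (1, 1) grows with p, so it eventually exceeds any constant. *)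
Lemma level_type11 l b (z : XX l) (x : XX b) p K : Fp l p z -> Fp b p x ->
  (kb l < K)%N -> (kb b < K)%N ->
  (level_type p z x 1 1 + \sum_(i < K) \sum_(j < K) ty z x i j)%N = p.
Proof.
move=> zp xp lK bK; have K1 : (1 < K)%N by move: lK; rewrite /kb; lia.
transitivity (\sum_(j < K) \sum_(i < K) level_type p z x i j)%N; last first.
  under eq_bigr do rewrite level_col//.
  have := @count_partition (ck x) predT (iota 0 p) K.
  rewrite count_predT size_iota => cp; rewrite -[RHS]cp.
    by apply: eq_bigr => j _; apply: eq_count => k; rewrite andbT.
  by move=> k; apply: leq_ltn_trans (ck_bound x k) bK.
apply/esym; rewrite exchange_big /= (bigD1 (Ordinal K1))//= [in RHS](bigD1 (Ordinal K1))//=.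
rewrite (bigD1 (Ordinal K1))//= [in RHS](bigD1 (Ordinal K1))//= ty11 add0n addnA.
congr (_ + _ + _)%N.
  apply: eq_bigr => j; rewrite -val_eqE /= => j1.
  by rewrite (tyE zp xp)//= .
apply: eq_bigr => i; rewrite -val_eqE /= => i1; apply: eq_bigr => j _.
by rewrite (tyE zp xp)// (negbTE i1).
Qed.

Lemma seq_at_count l (z : XX l) (d p i : nat) : Fp l p z -> (p <= d)%N ->
  seq_at l d i = (count (fun k => ck z k == i) (iota 0 d))%:R.
Proof.
move=> zp pd; have zd := FpW pd zp; rewrite /seq_at.
have [->|i1] := eqVneq i 1%N; last first.
  have [i2|i2] := ltnP 1 i; first by rewrite wtE// -(ck_count zd i2).
  have -> : i = 0%N by lia.
  rewrite lseq_out; last by move=> [].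
  rewrite (@eq_count _ _ pred0) ?count_pred0// => k /=; apply/negbTE.
  by rewrite -lt0n ck_gt0.
rewrite (lseq_first (ltnSn (kb l))) addrC addrA subrK.
apply/eqP; rewrite subr_eq -natrD; apply/eqP; congr _%:R.
have K1 : (1 < (kb l).+1)%N by rewrite /kb; lia.
have := @count_partition (ck z) predT (iota 0 d) (kb l).+1 (fun k => ck_bound z k).
rewrite count_predT size_iota => cp; rewrite -[LHS]cp.
rewrite (bigD1 (Ordinal K1))//= [in RHS](bigD1 (Ordinal K1))//= (wt0 l (leqnn 1)) add0n.
congr (_ + _)%N; first by apply: eq_count => k; rewrite andbT.
apply: eq_bigr => {i} i; rewrite -val_eqE /= => i1.
have [i2|i2] := ltnP 1 i.
  by rewrite -(ck_count zd i2); apply: eq_count => k; rewrite andbT.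
rewrite wt0//; rewrite (@eq_count _ _ pred0) ?count_pred0// => k /=.
by apply/negP => /andP[/eqP ki _]; move: (ck_gt0 z k); rewrite ki; lia.
Qed.

Lemma semistandard_good l b (z : XX l) (x : XX b) K :
  (kb l < K)%N -> (kb b < K)%N -> good (ty z x) -> semistandard l (qmat K (ty z x)).
Proof.
move=> lK bK gd; have [p [zp xp]] := Fp_pair z x.
(* From this bound on, the count at (1, 1) is at least the second part of l: the entries 1 of row 1
   cover row 2. *)
exists (p + (\sum_(i < K) \sum_(j < K) ty z x i j + wt l 2))%N => d pd.
have zd : Fp l d z by apply: FpW zp; lia.
have xd : Fp b d x by apply: FpW xp; lia.
have t11 := level_type11 zd xd lK bK.
(* Row i lists in increasing order the x-colours of the positions of z-colour i. *)
pose tab i := sort leq [seq ck x k | k <- iota 0 d & ck z k == i].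
have tabC P i : count P (tab i) = count (fun k => (ck z k == i) && P (ck x k)) (iota 0 d).
  rewrite /tab (permP (permEl (perm_sort _ _))) count_map count_filter.
  by apply: eq_count => k /=; rewrite andbC.
have tabS i : sorted leq (tab i) by apply: sort_sorted; apply: leq_total.
have tabL i j : count (fun u => u < j)%N (tab i) = (\sum_(u < j) level_type d z x i u)%N.
  rewrite tabC; elim: j => [|j IH].
    by rewrite big_ord0 (@eq_count _ _ pred0) ?count_pred0// => k; rewrite /= andbF.
  rewrite big_ord_recr /= -IH -count_predUI [X in (_ + X)%N](@eq_count _ _ pred0).
    rewrite count_pred0 addn0; apply: eq_count => k /=.
    by rewrite -andb_orr ltnS leq_eqVlt orbC.
  by move=> k /=; case: eqP => //= _; case: eqP => [->|]; rewrite ?ltnn ?andbF.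
exists tab => [i|].
  split=> //.
    by rewrite (seq_at_count i zp) -?count_predT ?tabC; [congr _%:R; apply: eq_count => k; rewrite andbT|lia].
  move=> j; rewrite tabC /mat_at -/(level_type d z x i j).
  case: ifPn => [/andP[/eqP -> /eqP ->]|ij]; last by rewrite qmatE// (tyE zd xd).
  rewrite /qmat /= ty11 addr0 addrC addrA subrK.
  by apply/esym/eqP; rewrite subr_eq -natrD t11.
have step i c : (0 < i)%N -> (c < size (tab i.+1))%N ->
    (c < size (tab i))%N && (nth 0%N (tab i) c < nth 0%N (tab i.+1) c)%N.
  move=> i0 cs; set j := nth 0%N (tab i.+1) c.
  rewrite -sorted_count_lt// tabL.
  have : (c < count (fun u => u < j.+1)%N (tab i.+1))%N.
    by rewrite sorted_count_lt// cs ltnSn.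
  rewrite tabL => /leq_trans; apply.
  have j0 : (0 < j)%N.
    have : j \in tab i.+1 by apply: mem_nth.
    by rewrite mem_sort => /mapP[k _ ->]; apply: ck_gt0.
  (* In row 1 with j > 1 the entries 1 alone, all smaller than j, outnumber the whole of row 2. *)
  have [/andP[/eqP i1 j1]|ij] := boolP ((i == 1%N) && (1 < j)%N).
    rewrite i1; apply: (@leq_trans (wt l 2)).
      rewrite -(@ck_count _ _ z _ d)//.
      rewrite -tabL tabC; apply: sub_count => k /andP[]//.
    apply: (@leq_trans (level_type d z x 1 1)); first by move: t11 pd; lia.
    by rewrite (bigD1 (Ordinal j1))//= leq_addr.
  have lev u v : (u < j.+1)%N -> ~~ ((v == 1%N) && (u == 1%N)) ->
      level_type d z x v u = ty z x v u by move=> _ vu; rewrite (tyE zd xd).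
  rewrite (eq_bigr (fun u : 'I_j.+1 => ty z x i.+1 u)); last first.
    by move=> u _; apply: lev => //; rewrite negb_and eqSS -lt0n i0.
  rewrite [X in (_ <= X)%N](eq_bigr (fun u : 'I_j => ty z x i u)); last first.
    move=> u _; apply: lev; first by rewrite ltnW// ltnS.
    have := ltn_ord u; move: ij; lia.
  apply: gd => // i1; move: ij; rewrite i1; lia.
have chain i e c : (0 < i)%N -> (c < size (tab (i + e).+1))%N ->
    (c < size (tab i))%N && (nth 0%N (tab i) c < nth 0%N (tab (i + e).+1) c)%N.
  move=> i0; elim: e => [|e IH]; first by rewrite addn0; apply: step.
  rewrite addnS => cs; have /andP[cs' lt'] := @step (i + e).+1 c isT cs.
  by have /andP[-> /= lt] := IH cs'; apply: ltn_trans lt'.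
move=> i i' c ii' ci ci'; case: (posnP i) => [i0|i0].
  move: ci; rewrite i0 -count_predT tabC.
  rewrite (@eq_count _ _ pred0) ?count_pred0// => k /=.
  by rewrite andbT; apply/negbTE; rewrite -lt0n ck_gt0.
have e : i' = (i + (i' - i).-1).+1 by lia.
by move: ci'; rewrite e => /(chain i _ c i0)/andP[].
Qed.

Lemma Lambda_plus_good l b (z : XX l) (x : XX b) : good (ty z x) -> Lambda_plus l.
Proof.
move=> gd i i2; exists (wt l i), (wt l i.+1); rewrite !wtE//; try lia.
split=> //; set K := (maxn (kb l) (kb b)).+1.
have bK : (kb b < K)%N by rewrite /K; lia.
rewrite -(ty_row z x bK (leqW i2)) -(ty_row z x bK i2).
(* K lies past all columns, so this instance of [good] compares the full sums of rows i and i +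
   1. *)
apply: leq_trans (gd i K _ _ _); try lia.
by rewrite [leqRHS]big_ord_recr /= leq_addr.
Qed.

End Good.

(** * Spans *)

Section Spans.
Variable n : option nat.
Implicit Types b c d l : Lambda n.

Lemma Tspan0 : Tspan n 0.
Proof.
exists 0%N, (fun=> 0), (fun=> 0); split; [by case|by case|by rewrite big_ord0].
Qed.

Lemma Tspan_CB x : CB x -> Tspan n x.
Proof.
move=> cx; exists 1%N, (fun=> (1%:~R)%:P), (fun=> x); split=> // [_|].
  exact: integer_valuedC.
by rewrite big_ord1 (rmorph1 (@polyC rat)) (rmorph1 (@FracField.tofrac {poly rat})) scale1r.
Qed.

Lemma TspanD x y : Tspan n x -> Tspan n y -> Tspan n (x + y).
Proof.
move=> [m [a [u [ai uc ->]]]] [m' [a' [u' [ai' uc' ->]]]].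
exists (m + m')%N, (fun i => match fintype.split i with inl j => a j | inr j => a' j end),
  (fun i => match fintype.split i with inl j => u j | inr j => u' j end).
split=> [i|i|]; [by case: fintype.split|by case: fintype.split|].
rewrite big_split_ord /=; congr (_ + _); apply: eq_bigr => i _.
  by rewrite (unsplitK (inl i)).
by rewrite (unsplitK (inr i)).
Qed.

Lemma TspanZ a x : ival a -> Tspan n x -> Tspan n (a *: x).
Proof.
move=> [A hA ->] [m [f [u [fi uc ->]]]].
exists m, (fun i => A * f i), u; split=> // [i|].
  exact: integer_valuedM.
by rewrite scaler_sumr; apply: eq_bigr => i _; rewrite scalerA rmorphM.
Qed.

Lemma Tspan_sum (I : Type) (r : seq I) (F : I -> Salg n) :
  (forall i, Tspan n (F i)) -> Tspan n (\sum_(i <- r) F i).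
Proof.
by move=> FT; elim/big_ind: _ => //; [exact: Tspan0|exact: TspanD].
Qed.

Lemma Hom_to_Salg_in d b (f : Hom (XX b) (XX d)) : Hom_to_Salg f (d, b) = f.
Proof. by rewrite /= dfwith_in. Qed.

Lemma Hom_to_Salg_out d b (f : Hom (XX b) (XX d)) db : db <> (d, b) ->
  Hom_to_Salg f db = 0.
Proof. by move=> ndb; rewrite /= dfwith_out//; apply/eqP => e; apply: ndb. Qed.

Lemma Salg_eq (x y : Salg n) d b :
  (forall db, db <> (d, b) -> x db = y db) -> x (d, b) = y (d, b) -> x = y.
Proof.
move=> xy e; apply: Salg_ext => db.
by have [->|/eqP/xy] := eqVneq db (d, b).
Qed.

Lemma Hom_to_Salg0 d b : Hom_to_Salg (0 : Hom (XX b) (XX d)) = 0.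
Proof.
by apply: (@Salg_eq _ _ d b) => [db ndb|]; rewrite ?Hom_to_Salg_in ?Hom_to_Salg_out.
Qed.

Lemma Hom_to_SalgD d b (f g : Hom (XX b) (XX d)) :
  Hom_to_Salg (f + g) = Hom_to_Salg f + Hom_to_Salg g.
Proof.
apply: (@Salg_eq _ _ d b) => [db ndb|]; last first.
  by rewrite -[RHS]/(Hom_to_Salg f (d, b) + Hom_to_Salg g (d, b)) !Hom_to_Salg_in.
rewrite -[RHS]/(Hom_to_Salg f db + Hom_to_Salg g db) !Hom_to_Salg_out//.
by rewrite addr0.
Qed.

Lemma Hom_to_SalgZ d b a (f : Hom (XX b) (XX d)) :
  Hom_to_Salg (a *: f) = a *: Hom_to_Salg f.
Proof.
apply: (@Salg_eq _ _ d b) => [db ndb|]; last first.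
  by rewrite -[RHS]/(a *: Hom_to_Salg f (d, b)) !Hom_to_Salg_in.
by rewrite -[RHS]/(a *: Hom_to_Salg f db) !Hom_to_Salg_out// scaler0.
Qed.

Lemma smul_Hom_to_Salg d l b (g : Hom (XX l) (XX d)) (f : Hom (XX b) (XX l)) :
  smul (Hom_to_Salg g) (Hom_to_Salg f) = Hom_to_Salg (hcomp g f).
Proof.
apply: (@Salg_eq _ _ d b) => [[d' b'] ndb|].
  rewrite [RHS]Hom_to_Salg_out//; apply: (@fsbig1 _ _ +%R) => c _.
  rewrite -[LHS]/(hcomp (Hom_to_Salg g (d', c)) (Hom_to_Salg f (c, b'))).
  have [e|nd] := pselect (d' = d /\ c = l); last first.
    by rewrite (@Hom_to_Salg_out _ _ g (d', c)) ?hcomp0l// => -[dd cl]; apply: nd.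
  rewrite (@Hom_to_Salg_out _ _ f (c, b')) ?hcomp0r// => -[_ bb]; apply: ndb.
  by rewrite e.1 bb.
rewrite Hom_to_Salg_in.
rewrite -[LHS]/(\sum_(c \in [set: Lambda n])
  (hcomp (Hom_to_Salg g (d, c)) (Hom_to_Salg f (c, b)) : Hom (XX b) (XX d))).
rewrite -(@fsbig_widen _ _ _ _ [set l]); last first.
- move=> c [_ cl].
  change (hcomp (Hom_to_Salg g (d, c)) (Hom_to_Salg f (c, b)) = 0).
  rewrite (@Hom_to_Salg_out _ _ g (d, c)) ?hcomp0l// => -[e].
  exact: cl.
- by [].
by rewrite fsbig_set1 !Hom_to_Salg_in.
Qed.

Lemma CB_good d l b (z : XX d) (y y' : XX l) (x : XX b) :
  good (ty y z) -> good (ty y' x) ->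
  CB (Hom_to_Salg (hcomp (XI d l (ty z y)) (XI l b (ty y' x)))).
Proof.
move=> gz gx; pose K := (maxn (kb d) (maxn (kb l) (kb b))).+1.
have dK : (kb d < K)%N by rewrite /K; lia.
have lK : (kb l < K)%N by rewrite /K; lia.
have bK : (kb b < K)%N by rewrite /K; lia.
exists l; first exact: Lambda_plus_good gx.
exists (xi d l (qmat K (ty z y))).
  exists d => //; exists (qmat K (ty z y)) => //; split; first exact: Mat_ty.
  rewrite qmat_tr (_ : (fun i j => _) = ty y z); first exact: semistandard_good.
  by apply/funext => i; apply/funext => j; rewrite tyC.
exists (xi l b (qmat K (ty y' x))).
  exists b => //; exists (qmat K (ty y' x)) => //; split; first exact: Mat_ty.
  exact: semistandard_good.
by rewrite /xi smul_Hom_to_Salg !xi_hom_ty.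
Qed.

End Spans.

Local Close Scope classical_set_scope.

(** * Composition with an elementary merging map *)

Lemma card_ord_count p (P : pred nat) : #|[set k : 'I_p | P k]| = count P (iota 0 p).
Proof.
rewrite -sum1_card -sum1_count -[X in iota 0 X]subn0 -/(index_iota 0 p) big_mkord.
by apply: eq_bigl => k; rewrite inE.
Qed.

Lemma count_and_split (T : Type) (A B : pred T) (s : seq T) :
  (count (fun k => A k && B k) s + count (fun k => A k && ~~ B k) s = count A s)%N.
Proof. by elim: s => //= a s <-; case: (A a); case: (B a); lia. Qed.

(** A subset of Z is the same as the family of its colour parts, and these are chosen
    independently. *)
Lemma card_draws_coloured (I : finType) (x : I -> nat) (K : nat) (Z : {set I})
    (Y : nat -> nat) : (forall k, x k < K)%N ->
  #|[set L : {set I} | (L \subset Z) &&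
       [forall j : 'I_K, #|[set k in L | x k == j]| == Y j]]| =
  (\prod_(j < K) 'C(#|[set k in Z | x k == j]|, Y j))%N.
Proof.
move=> xK; pose part (L : {set I}) : {ffun 'I_K -> {set I}} :=
  [ffun j : 'I_K => [set k in L | x k == j]].
pose F (j : 'I_K) := [set S : {set I} | S \subset [set k in Z | x k == j] & #|S| == Y j].
have part_inj : injective part.
  move=> L L' LL'; apply/setP => k.
  have := congr1 (fun f : {ffun 'I_K -> {set I}} => k \in f (Ordinal (xK k))) LL'.
  by rewrite !ffunE !inE /= eqxx !andbT.
rewrite -(card_imset _ part_inj).
transitivity #|family (fun j => mem (F j))|; last first.
  rewrite card_family foldrE /image_mem big_map big_enum /=.
  by apply: eq_bigr => j _; rewrite -cards_draws.
apply: eq_card => f; apply/imsetP/familyP => [[L + ->] j|fF].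
  rewrite !inE ffunE => /andP[LZ /forallP/(_ j) ->]; rewrite andbT.
  by apply/fintype.subsetP => k; rewrite !inE => /andP[/(fintype.subsetP LZ) -> ->].
have fS j k : k \in f j -> (k \in Z) /\ x k = j.
  have := fF j; rewrite !inE => /andP[/fintype.subsetP fZ _] /fZ.
  by rewrite !inE => /andP[-> /eqP].
have pE (j : 'I_K) : [set k in \bigcup_(j < K) f j | x k == j] = f j.
  apply/setP => k; rewrite !inE; apply/andP/idP => [[/bigcupP[i _ ki] /eqP xk]|kj].
    suff -> : j = i by [].
    by apply: val_inj; rewrite /= -xk; have [_] := fS _ _ ki.
  have [_ ->] := fS _ _ kj; split=> //; apply/bigcupP; by exists j.
exists (\bigcup_(j < K) f j); last by apply/ffunP => j; rewrite ffunE pE.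
rewrite !inE; apply/andP; split.
  by apply/fintype.subsetP => k /bigcupP[j _ /fS[]].
apply/forallP => j; rewrite pE.
by have := fF j; rewrite !inE => /andP[].
Qed.

Section Elementary.
Variable n : option nat.
Implicit Types b l m : Lambda n.

Definition ty_hom l b (phi : (nat -> nat -> nat) -> QT) : Hom (XX b) (XX l) :=
  @MkHom (XX b) (XX l) (fun z x => phi (ty z x))
    (fun s z x => congr1 phi (ty_act s z x)).

(** Some positions of colour i in y become i + 1 in z. For m = l + k (e_i - e_(i+1)) the indicator
    [merge_hom] is an analogue of a divided power of a Chevalley generator. *)
Definition recolour i l m (z : XX l) (y : XX m) : Prop :=
  forall k, ck z k = ck y k \/ ck z k = i.+1 /\ ck y k = i.

Lemma recolour_act i l m s (z : XX l) (y : XX m) :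
  recolour i (fact s z) (fact s y) <-> recolour i z y.
Proof.
split=> zy k; last by rewrite !ck_act.
by have := zy (sn s k); rewrite !ck_act snK.
Qed.

Definition merge_hom i l m : Hom (XX m) (XX l) :=
  @MkHom (XX m) (XX l) (fun z y => if `[< recolour i z y >] then 1 else 0)
    (fun s z y => congr1 (fun c : bool => if c then 1 else 0)
       (asbool_equiv_eq (recolour_act i s z y))).

Lemma iHom_merge i l m : iHom (merge_hom i l m).
Proof. by move=> z y /=; case: ifP => _; [apply: ival1|apply: ival0]. Qed.

Definition other_rows (i : nat) (t r : nat -> nat -> nat) : Prop :=
  forall u j, u != i -> u != i.+1 -> t u j = r u j.

(** The column sums determine row i from the other rows, so this indicator selects at most one
    orbit. *)
Definition split_hom i m b (r : nat -> nat -> nat) (Y : nat -> nat) :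
    Hom (XX b) (XX m) :=
  ty_hom m b (fun t => if `[< other_rows i t r /\ t i.+1 = Y >] then 1 else 0).

Lemma iHom_split i m b r Y : iHom (split_hom i m b r Y).
Proof. by move=> z y /=; case: ifP => _; [apply: ival1|apply: ival0]. Qed.

Definition row_binomials (K i : nat) (r : nat -> nat -> nat) (Y : nat -> nat)
    (t : nat -> nat -> nat) : QT :=
  if `[< other_rows i t r >] then (\prod_(j < K) 'C(t i.+1 j, Y j))%N%:R else 0.

Lemma level_type_recolour i l m b p (z : XX l) (y : XX m) (x : XX b) u j :
  recolour i z y -> u != i -> u != i.+1 ->
  level_type p z x u j = level_type p y x u j.
Proof.
move=> zy ui ui1; apply: eq_count => k; congr andb.
by have [->//|[-> ->]] := zy k; rewrite [_ == u]eq_sym [i == u]eq_sym (negbTE ui) (negbTE ui1).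
Qed.

(** For fixed z and x, the intermediate point y is determined by the set L of positions that keep
    colour i + 1. Here L is any subset of this colour class of z with [Y j] positions of x-colour j
    for each j, whence the product of binomials. *)
Lemma merge_split i l m b r (Y : nat -> nat) K : (0 < i)%N -> (kb b < K)%N ->
  (forall j, (K <= j)%N -> Y j = 0%N) ->
  wt m i.+1 = (\sum_(j < K) Y j)%N ->
  (forall j, j != i -> j != i.+1 -> wt m j = wt l j) ->
  ((1 < i)%N -> wt m i + wt m i.+1 = wt l i + wt l i.+1)%N ->
  hcomp (merge_hom i l m) (split_hom i m b r Y) =
    ty_hom l b (row_binomials K i r Y).
Proof.
move=> i0 bK YK mi1 mo mi.
have i11 : (1 < i.+1)%N by [].
have nt u : ~~ ((i.+1 == 1%N) && (u == 1%N)) by rewrite eqSS (gtn_eqF i0).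
apply: iHom_ext => [||p z x zp xp].
- by apply: iHom_comp; [apply: iHom_merge|apply: iHom_split].
- move=> z x; rewrite /= /row_binomials; case: ifP => _; last exact: ival0.
  exact: ival_natr.
rewrite hcomp_ev//; [|exact: iHom_merge|exact: iHom_split].
pose P (y : XX m) := `[< recolour i z y >] &&
  `[< other_rows i (ty y x) r /\ ty y x i.+1 = Y >].
transitivity ((count P (lv m p))%:R : rat).
  rewrite -sum1_count natr_sum [RHS]big_mkcond /=; apply: eq_bigr => y _; rewrite /P.
  by case: asboolP => _; case: asboolP => _; rewrite ?ev1 ?ev0 ?mulr1 ?mul0r.
rewrite -[ty_hom _ _ _ z x]/(row_binomials K i r Y (ty z x)) /row_binomials.
have oth (y : XX m) : Fp m p y -> recolour i z y ->
    other_rows i (ty y x) r <-> other_rows i (ty z x) r.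
  move=> yp zy; have e u j : u != i -> u != i.+1 -> ty z x u j = ty y x u j.
    move=> ui ui1; have [uj|uj] := boolP ((u == 1%N) && (j == 1%N)).
      by rewrite /ty uj.
    by rewrite (tyE zp xp uj) (tyE yp xp uj); apply: level_type_recolour ui ui1.
  by split=> h u j ui ui1; rewrite -h// e.
case: asboolP => [zr|nzr]; last first.
  rewrite ev0 (@eq_in_count _ _ pred0) ?count_pred0// => y /mem_lv yp.
  by apply/negP => /andP[/asboolP zy /asboolP[/(oth _ yp zy)]].
rewrite ev_natr; congr _%:R.
pose pos (q : nat -> bool) : {set 'I_p} := [set k : 'I_p | q k].
have tyY (y : XX m) j : Fp m p y ->
    ty y x i.+1 j = #|[set k in pos (fun k => ck y k == i.+1) | ck x k == j]|.
  move=> yp; rewrite (tyE yp xp (nt j)) /level_type -card_ord_count.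
  by apply: eq_card => k; rewrite !inE.
have -> : (\prod_(j < K) 'C(ty z x i.+1 j, Y j) =
   #|[set L : {set 'I_p} | (L \subset pos (fun k => ck z k == i.+1)) &&
       [forall j : 'I_K, #|[set k in L | ck x k == j]| == Y j]]|)%N.
  rewrite (@card_draws_coloured _ (fun k : 'I_p => ck x k)); last first.
    by move=> k; apply: leq_ltn_trans (ck_bound x k) bK.
  apply: eq_bigr => j _; congr 'C(_, _).
  rewrite (tyE zp xp (nt j)) /level_type -card_ord_count.
  by apply: eq_card => k; rewrite !inE.
rewrite -size_filter; pose f (y : XX m) := pos (fun k => ck y k == i.+1).
rewrite -(size_map f).
have zyE (y : XX m) k : recolour i z y ->
    ck y k = if (ck z k == i.+1) && (ck y k != i.+1) then i else ck z k.
  move=> zy; have [zk|[zk yk]] := zy k; first by rewrite -zk andbN.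
  by rewrite zk yk eqxx neq_ltn ltnSn.
have fU : uniq (map f [seq y <- lv m p | P y]).
  rewrite map_inj_in_uniq ?filter_uniq ?lv_uniq// => y y'.
  rewrite !mem_filter => /andP[/andP[/asboolP zy _] /mem_lv yp].
  move=> /andP[/andP[/asboolP zy' _] /mem_lv yp'] ff; apply: ck_inj => k.
  have [kp|pk] := ltnP k p; last by rewrite yp// yp'.
  rewrite (zyE y)// (zyE y')//.
  by move/setP: ff => /(_ (Ordinal kp)); rewrite !inE /= => ->.
rewrite -(card_uniqP fU); apply: eq_card => L; rewrite inE; apply/mapP/andP.
  move=> [y]; rewrite mem_filter => /andP[/andP[/asboolP zy /asboolP[_ yY]] /mem_lv yp ->].
  split; last by apply/forallP => j; rewrite -tyY// yY.
  apply/fintype.subsetP => k; rewrite !inE => /eqP yk.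
  by have [->|[->]] := zy k; rewrite ?yk.
move=> [LZ /forallP LY].
pose inL k := k \in [seq val a | a <- enum L].
have inLE (k : 'I_p) : inL k = (k \in L) by rewrite /inL mem_map ?mem_enum//; exact: val_inj.
have Lp k : inL k -> (k < p)%N by move=> /mapP[a _ ->]; apply: ltn_ord.
have Lz k : inL k -> ck z k = i.+1.
  by move=> /mapP[a]; rewrite mem_enum => /(fintype.subsetP LZ); rewrite inE => /eqP ? ->.
(* The point y attached to L: positions of colour i + 1 outside L fall back to colour i. *)
pose c k := if (ck z k == i.+1) && ~~ inL k then i else ck z k.
have cL k : (c k == i.+1) = inL k.
  rewrite /c; have [kL|kL] := boolP (inL k); first by rewrite andbF Lz ?eqxx.
  rewrite andbT; have [_|/negbTE//] := eqVneq (ck z k) i.+1.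
  by rewrite ltn_eqF.
have Lcount j : count (fun k => inL k && (ck x k == j)) (iota 0 p) =
    #|[set k in L | ck x k == j]|.
  by rewrite -card_ord_count; apply: eq_card => k; rewrite !inE inLE.
have Lsum : count inL (iota 0 p) = wt m i.+1.
  rewrite mi1 -(@count_partition (ck x) inL (iota 0 p) K); last first.
    by move=> k; apply: leq_ltn_trans (ck_bound x k) bK.
  apply: eq_bigr => j _; rewrite -(eqP (LY j)) -Lcount.
  by apply: eq_count => k; rewrite andbC.
have Zsum : (count inL (iota 0 p) +
    count (fun k => (ck z k == i.+1) && ~~ inL k) (iota 0 p) = wt l i.+1)%N.
  rewrite -(ck_count zp i11) -[RHS](count_and_split _ inL); congr addn.
  apply: eq_count => k; apply/idP/andP => [kL|[]//]; by rewrite Lz.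
have [|k|j j1|y yp yc] := @ck_realise n m c p.
- by move=> k pk; rewrite /c zp// (ltn_eqF i11).
- by rewrite /c; case: ifP => // _; apply: ck_gt0.
- have [->|ji1] := eqVneq j i.+1; first by rewrite -Lsum; apply: eq_count.
  have [ji|ji] := eqVneq j i.
    have wi : (wt m j = wt l j + (wt l i.+1 - wt m i.+1))%N.
      by move: j1 Zsum; rewrite ji Lsum => /mi; lia.
    rewrite wi -(ck_count zp j1) -Lsum -Zsum addKn.
    rewrite -[LHS](count_and_split _ (fun k => ck z k == j)); congr addn.
      apply: eq_count => k; rewrite /c; case: (eqVneq (ck z k) j) => zk; rewrite ?andbF//.
      by rewrite zk andbT (negbTE ji1) /= eqxx.
    apply: eq_count => k; rewrite /c; case: ifPn => [/andP[/eqP zk kL]|].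
      by rewrite zk ji !eqxx neq_ltn ltnSn orbT.
    by rewrite andbN.
  rewrite mo// -(ck_count zp j1); apply: eq_count => k; rewrite /c.
  case: ifP => // /andP[/eqP -> _]; by rewrite [i == j]eq_sym (negbTE ji) eq_sym (negbTE ji1).
have zy : recolour i z y.
  move=> k; rewrite yc /c; case: ifP => [/andP[/eqP -> _]|_]; by [right|left].
have Ly : L = f y.
  by apply/setP => k; rewrite !inE yc cL inLE.
exists y => //; rewrite mem_filter; apply/andP; split; last exact/mem_lv.
apply/andP; split; apply/asboolP => //; split; first exact/(oth y yp zy).
apply/funext => j; rewrite tyY// -/(f y) -Ly.
have [jK|Kj] := ltnP j K; first by have /eqP := LY (Ordinal jK).
rewrite YK//; apply/eqP; rewrite cards_eq0; apply/eqP/setP => k; rewrite !inE.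
apply/negbTE; rewrite negb_and; apply/orP; right; apply/eqP => xk.
by have := ck_bound x k; rewrite xk; lia.
Qed.

End Elementary.

(** * Straightening *)

(** By Pascal's rule, passing from y to y + 1 lowers C(R - y, a + 1) by C(R - 1 - y, a). The
    coefficients are thus those for R - 1 and a, negated and shifted, with constant term C(R, a +
    1). The bound y <= R keeps the truncated subtraction exact. *)
Lemma bin_complement R a : exists2 f : nat -> int,
  (forall c, (a < c)%N -> f c = 0) &
  forall D y, (a < D)%N -> (y <= R)%N ->
    'C(R - y, a)%:R = \sum_(c < D) f c * 'C(y, c)%:R :> int.
Proof.
elim: a R => [|a IH] R.
  exists (fun c => (c == 0%N)%:R) => [[]//|[//|D] y _ _].
  by rewrite bin0 big_ord_recl /= bin0 mulr1 big1 ?addr0// => c _; rewrite mul0r.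
have [f f0 fE] := IH R.-1.
exists (fun c => if c is c'.+1 then - f c' else 'C(R, a.+1)%:R) => [[//|c] ac|].
  by rewrite f0 ?oppr0.
move=> [//|D] y aD; elim: y => [_|y IHy yR].
  rewrite subn0 big_ord_recl /= bin0 mulr1 big1 ?addr0// => c _.
  by rewrite bin0n mulr0.
have := IHy (ltnW yR); have -> : (R - y = (R - y.+1).+1)%N by lia.
rewrite binS natrD !big_ord_recl /= !bin0 => /eqP; rewrite eq_sym -subr_eq => /eqP <-.
rewrite -addrA; congr (_ + _); apply/eqP; rewrite subr_eq eq_sym; apply/eqP.
have -> : (R - y.+1 = R.-1 - y)%N by lia.
rewrite (fE D) //; last by lia.
rewrite -big_split /=; apply: eq_bigr => c _.
by rewrite /bump /= !add1n binS natrD; ring.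
Qed.

(** From [y0] to y, mass moves to the right, where the weights K - j are smaller. Since the totals
    agree, each weight may be replaced by j0 - j, and every summand of the difference becomes
    nonnegative. *)
Lemma weighted_sum_lt (K j0 : nat) (y y0 : nat -> nat) :
  (\sum_(j < K) y j = \sum_(j < K) y0 j)%N ->
  (forall j, (j < j0)%N -> (j < K)%N -> (y j <= y0 j)%N) ->
  (forall j, (j0 < j)%N -> (j < K)%N -> (y0 j <= y j)%N) ->
  (forall j, (j < K)%N -> y j = y0 j) \/
  (\sum_(j < K) (K - j) * y j < \sum_(j < K) (K - j) * y0 j)%N.
Proof.
move=> yy0 lt gt.
pose F (j : 'I_K) : int := (j0%:Z - j%:Z) * ((y0 j)%:Z - (y j)%:Z).
have F0 j : 0 <= F j.
  rewrite /F; have := ltn_ord j; have [jj|jj|jj] := ltngtP j j0 => jK.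
  - by apply: mulr_ge0; have := lt _ jj jK; lia.
  - by apply: mulr_le0; have := gt _ jj jK; lia.
  - by rewrite jj subrr mul0r.
have sE : \sum_(j < K) F j =
    (\sum_(j < K) (K - j) * y0 j)%N%:Z - (\sum_(j < K) (K - j) * y j)%N%:Z.
  have castE (G : 'I_K -> nat) : (\sum_(j < K) G j)%N%:Z = \sum_(j < K) (G j)%:Z.
    by rewrite -[LHS]natz natr_sum; apply: eq_bigr => j _; rewrite natz.
  have e0 : \sum_(j < K) (K%:Z - j0%:Z) * ((y0 j)%:Z - (y j)%:Z) = 0.
    by rewrite -mulr_sumr sumrB -!castE yy0 subrr mulr0.
  transitivity (\sum_(j < K) (F j + (K%:Z - j0%:Z) * ((y0 j)%:Z - (y j)%:Z))).
    by rewrite big_split /= e0 addr0.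
  rewrite !castE -sumrB; apply: eq_bigr => j _.
  by rewrite /F !PoszM -subzn 1?ltnW//; ring.
have [e|ne] := eqVneq (\sum_(j < K) F j) 0; last first.
  have s0 : 0 <= \sum_(j < K) F j by apply: sumr_ge0.
  by right; move: ne s0; rewrite sE; lia.
left; have Fz j : F j = 0.
  apply/eqP; rewrite eq_le F0 andbT -e (bigD1 j)//= lerDl.
  by apply: sumr_ge0 => i _.
have off j : (j < K)%N -> j != j0 -> y j = y0 j.
  move=> jK jj; have /eqP := Fz (Ordinal jK); rewrite /F mulf_eq0 /=; lia.
move=> j jK; have [jj|] := eqVneq j j0; last exact: off.
move: yy0; rewrite (bigD1 (Ordinal jK))//= [in RHS](bigD1 (Ordinal jK))//=.
rewrite (eq_bigr (fun i : 'I_K => y0 i)); first by move=> /eqP; rewrite eqn_add2r => /eqP.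
by move=> i; rewrite -val_eqE /= jj => /off ->.
Qed.

Lemma sum_two_rows (K i : nat) (F : nat -> nat) : (i.+1 < K)%N ->
  (\sum_(u < K) F u = F i + F i.+1 + \sum_(u < K | (u != i :> nat) && (u != i.+1 :> nat)) F u)%N.
Proof.
move=> iK; rewrite (bigD1 (Ordinal (ltnW iK)))// (bigD1 (Ordinal iK))/=.
  by rewrite addnA.
by rewrite -val_eqE /= gtn_eqF.
Qed.

(** * Raising a weight, and pairs that differ in two rows only *)

Section Straightening.
Variable n : option nat.
Implicit Types b l m : Lambda n.

Lemma Lambda_of_weight b (w : nat -> nat) K :
  (forall i, w i != 0%N -> (1 < i)%N /\ in_range n i) ->
  (forall i, (K <= i)%N -> w i = 0%N) -> exists m, forall i, wt m i = w i.
Proof.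
move=> wr wK; have r1 := Lambda_range1 b.
pose s i : QT := if i == 1%N then TT - (\sum_(i < K) w i)%:R else (w i)%:R.
have w1 : w 1%N = 0%N by apply/eqP; apply: contraT => /wr[].
have s0 i : ~ in_range n i -> s i = 0.
  move=> ir; rewrite /s; case: eqP => [i1|_]; first by rewrite i1 in ir.
  by have [->|/wr[_ /ir]] := eqVneq (w i) 0%N.
have s1 : in_T_minus_Z (s 1%N).
  by exists (\sum_(i < K) w i)%N%:Z; rewrite /s /= -pmulrn.
have sn i : (2 <= i)%N -> is_nat (s i).
  by move=> i2; exists (w i); rewrite /s gtn_eqF.
have sK i : (maxn K 2 <= i)%N -> s i = 0.
  by rewrite geq_max => /andP[Ki i2]; rewrite /s gtn_eqF// wK.
have sf : finite_set [set i | s i != 0]%classic.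
  apply: sub_finite_set (finite_II (maxn K 2)) => i /=.
  by rewrite ltnNge; apply: contra => /sK ->.
have ss : \sum_(i \in [set: nat]%classic) s i = TT.
  rewrite (fsbig_below sK); have K1 : (1 < maxn K 2)%N by lia.
  rewrite (bigD1 (Ordinal K1))//= {1}/s /= -addrA.
  rewrite [X in _ + X](_ : _ = 0) ?addr0//.
  apply/eqP; rewrite addrC subr_eq0; apply/eqP.
  rewrite (big_ord_widen (maxn K 2) w (leq_maxl _ _)) natr_sum [RHS]big_mkcond /=.
  rewrite [RHS](bigD1 (Ordinal K1))//= w1 if_same add0r.
  apply: eq_bigr => i; rewrite -val_eqE /= /s => /negbTE ->.
  by case: ltnP => // Ki; rewrite wK.
exists (MkLambda s0 s1 sn sf ss) => i; have [i1|i1] := ltnP 1 i.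
  by apply: QT_natr_inj; rewrite -wtE//= /s gtn_eqF.
by rewrite wt0//; apply/esym/eqP; apply: contraT => /wr[]; lia.
Qed.

(** The measure of the outer induction. Moving k boxes from row i + 1 to row i lowers it by k, and
    by 2k if i = 1, as the first part counts as 0. *)
Definition phi l : nat := (\sum_(i < (kb l).+1) i * wt l i)%N.

Lemma phiE l K : (kb l < K)%N -> phi l = (\sum_(i < K) i * wt l i)%N.
Proof.
move=> lK; rewrite /phi (big_ord_widen K (fun i => i * wt l i)%N lK) big_mkcond.
by apply: eq_bigr => i _ /=; case: ltnP => // /ltnW/kbP ->; rewrite muln0.
Qed.

Lemma Lambda_raise l i k : (0 < i)%N -> (0 < k)%N -> (k <= wt l i.+1)%N ->
  exists m, [/\ (phi m < phi l)%N, (wt m i.+1 + k = wt l i.+1)%N,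
    forall j, j != i -> j != i.+1 -> wt m j = wt l j &
    ((1 < i)%N -> wt m i + wt m i.+1 = wt l i + wt l i.+1)%N].
Proof.
move=> i0 k0 kl.
have iK : (i.+1 < kb l)%N.
  by rewrite ltnNge; apply/negP => /kbP e; move: kl; rewrite e; lia.
have ir1 : in_range n i.+1 by apply: (@wt_range _ l); lia.
have ir : in_range n i.
  by case: ir1 => _ h; split=> //; move: h; case: (n) => // N; apply: ltnW.
pose w j := if j == i then (if i == 1 then 0 else wt l i + k)%N else
            if j == i.+1 then (wt l i.+1 - k)%N else wt l j.
have [j||m mw] := @Lambda_of_weight l w (kb l).
- rewrite /w; case: (eqVneq j i) => [->|_].
    by case: (eqVneq i 1%N) => // i1 _; split=> //; lia.
  case: (eqVneq j i.+1) => [->|_ wj]; first by split=> //; lia.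
  by split; [rewrite ltnNge; apply: contra wj => /wt0 ->|apply: wt_range wj].
- by move=> j jK; rewrite /w !gtn_eqF ?kbP//; lia.
have ii : (i.+1 == i) = false by rewrite gtn_eqF.
have wi1 : wt m i.+1 = (wt l i.+1 - k)%N by rewrite mw /w ii eqxx.
have wo j : j != i -> j != i.+1 -> wt m j = wt l j.
  by move=> /negbTE ji /negbTE ji1; rewrite mw /w ji ji1.
have wi : wt m i = (if i == 1 then 0 else wt l i + k)%N by rewrite mw /w eqxx.
exists m; split=> //; [|by rewrite wi1 subnK|by move=> i1; rewrite wi wi1 gtn_eqF//; lia].
pose K := (maxn (kb l) (kb m)).+1.
rewrite (@phiE l K) ?(@phiE m K); try by rewrite /K; lia.
have iK1 : (i.+1 < K)%N by rewrite /K; lia.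
rewrite (sum_two_rows (fun u => u * wt l u)%N iK1) (sum_two_rows (fun u => u * wt m u)%N iK1).
rewrite (eq_bigr (fun u : 'I_K => u * wt l u)%N); last first.
  by move=> u /andP[ui ui1]; rewrite wo.
have num a : (i * (a + k) + i.+1 * (wt l i.+1 - k) < i * a + i.+1 * wt l i.+1)%N.
  by rewrite -[X in (_ < _ + _ * X)%N](subnK kl) !mulnDr !mulSn; lia.
rewrite ltn_add2r wi wi1; case: eqP => i1; last exact: num.
by have := num 0%N; rewrite (wt0 l (_ : i <= 1)%N) ?i1//; lia.
Qed.

(* Row 1, where the infinite entry sits, has weight 0. *)
Definition psi (K : nat) (t : nat -> nat -> nat) : nat :=
  (\sum_(i < K) (i.-1 * \sum_(j < K) (K - j) * t i j))%N.

Lemma ck_count_eq b (x x0 : XX b) p j : Fp b p x -> Fp b p x0 ->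
  count (fun k => ck x k == j) (iota 0 p) = count (fun k => ck x0 k == j) (iota 0 p).
Proof.
move=> xp x0p; rewrite -!count_mem_mkseq.
have /permP -> // : perm_eq (mkseq (ck x) p) (mkseq (ck x0) p).
apply: (@perm_eq_base _ 1%N) => [|u u1]; rewrite ?size_mkseq// !count_mem_mkseq.
have [u2|u2] := ltnP 1 u; first by rewrite !ck_count.
have -> : u = 0%N by lia.
by rewrite !(@eq_count _ _ pred0) ?count_pred0// => k /=; apply/negbTE;
  rewrite -lt0n ck_gt0.
Qed.

(** At a finite level the row total, common to z and [z0], determines the entry (1, 1) that [ty]
    omits. *)
Lemma level_type_eq l b p (z z0 : XX l) (x x0 : XX b) u :
  Fp l p z -> Fp l p z0 -> Fp b p x -> Fp b p x0 ->
  (forall j, ty z x u j = ty z0 x0 u j) ->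
  forall j, level_type p z x u j = level_type p z0 x0 u j.
Proof.
move=> zp z0p xp x0p tu.
have off j : ~~ ((u == 1%N) && (j == 1%N)) ->
    level_type p z x u j = level_type p z0 x0 u j.
  by move=> uj; rewrite -(tyE zp xp uj) -(tyE z0p x0p uj).
move=> j; have [/andP[/eqP u1 /eqP ->]|/off//] := boolP ((u == 1%N) && (j == 1%N)).
pose K := (kb b).+1; have K1 : (1 < K)%N by rewrite /K /kb; lia.
have := ck_count_eq u zp z0p.
rewrite -(level_col x z p u (ltnSn _)) -(level_col x0 z0 p u (ltnSn _)) -/K.
rewrite (bigD1 (Ordinal K1))//= [in RHS](bigD1 (Ordinal K1))//=.
rewrite -[level_type p z x u 1]level_typeC -[level_type p z0 x0 u 1]level_typeC.
rewrite (eq_bigr (fun v : 'I_K => level_type p x0 z0 v u)).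
  by move=> /eqP; rewrite eqn_add2r => /eqP.
move=> v; rewrite -val_eqE /= => v1; rewrite level_typeC [RHS]level_typeC off//.
by rewrite (negbTE v1) andbF.
Qed.

(** Column totals agree and the other rows cancel. The comparison is made at a common finite level
    because column 1 is infinite. *)
Lemma ty_two_rows l b (z z0 : XX l) (x x0 : XX b) i j : (0 < i)%N ->
  ~~ ((i == 1%N) && (j == 1%N)) -> other_rows i (ty z x) (ty z0 x0) ->
  (ty z x i j + ty z x i.+1 j = ty z0 x0 i j + ty z0 x0 i.+1 j)%N.
Proof.
move=> i0 ij oth; have [p0 [zp0 xp0]] := Fp_pair z x.
have [q0 [zq0 xq0]] := Fp_pair z0 x0; pose p := maxn p0 q0.
have zp : Fp l p z by apply: FpW zp0; rewrite leq_maxl.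
have xp : Fp b p x by apply: FpW xp0; rewrite leq_maxl.
have z0p : Fp l p z0 by apply: FpW zq0; rewrite leq_maxr.
have x0p : Fp b p x0 by apply: FpW xq0; rewrite leq_maxr.
have i1j : ~~ ((i.+1 == 1%N) && (j == 1%N)) by rewrite eqSS gtn_eqF.
rewrite (tyE zp xp ij) (tyE zp xp i1j) (tyE z0p x0p ij) (tyE z0p x0p i1j).
pose K := (maxn (kb l) i.+1).+1.
have lK : (kb l < K)%N by rewrite /K; lia.
have iK1 : (i.+1 < K)%N by rewrite /K; lia.
have := ck_count_eq j xp x0p.
rewrite -(level_col z x p j lK) -(level_col z0 x0 p j lK).
rewrite (sum_two_rows (fun u => level_type p z x u j) iK1).
rewrite (sum_two_rows (fun u => level_type p z0 x0 u j) iK1).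
rewrite (eq_bigr (fun u : 'I_K => level_type p z0 x0 u j)).
  by move=> /eqP; rewrite eqn_add2r => /eqP.
move=> u /andP[ui ui1]; apply: level_type_eq => // v; exact: oth.
Qed.

(** Integral combinations of good basis elements, modulo maps that factor integrally through a
    weight of smaller [phi]. As an inductive predicate it gives [Tspan_comp] one case for each way
    to build such a map. *)
Inductive straightened l b : Hom (XX b) (XX l) -> Prop :=
| Straightened0 : straightened 0
| StraightenedD f g : straightened f -> straightened g -> straightened (f + g)
| StraightenedZ a f : ival a -> straightened f -> straightened (a *: f)
| Straightened_good (z : XX l) (x : XX b) : good (ty z x) ->
    straightened (XI l b (ty z x))
| Straightened_comp m (u : Hom (XX m) (XX l)) (v : Hom (XX b) (XX m)) :
    (phi m < phi l)%N -> iHom u -> iHom v -> straightened (hcomp u v).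

Lemma straightened_sum l b (I : Type) (r : seq I) (F : I -> Hom (XX b) (XX l)) :
  (forall i, straightened (F i)) -> straightened (\sum_(i <- r) F i).
Proof.
by move=> FS; elim/big_ind: _ => //; [exact: Straightened0|exact: StraightenedD].
Qed.

(** The deficit of the total of Y against row i + 1 is the number of boxes to move up; [merge_split]
    then gives the factorization. *)
Lemma straightened_row_binomials l b i r (Y : nat -> nat) K :
  (0 < i)%N -> (kb b < K)%N -> (forall j, (K <= j)%N -> Y j = 0%N) ->
  (\sum_(j < K) Y j < wt l i.+1)%N ->
  straightened (ty_hom l b (row_binomials K i r Y)).
Proof.
move=> i0 bK YK Yl.
have [||m [ml mi1 mo mi]] := @Lambda_raise l i (wt l i.+1 - \sum_(j < K) Y j) i0.
- by rewrite subn_gt0.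
- by rewrite leq_subr.
have mE : wt m i.+1 = (\sum_(j < K) Y j)%N by lia.
rewrite -(merge_split r i0 bK YK mE mo mi).
by apply: Straightened_comp ml _ _; [apply: iHom_merge|apply: iHom_split].
Qed.

(* [garnir K i j0 r] has leading term [XI l b r] when [r] violates [good] at
   (i, j0). *)
Definition garnir_factor (i j0 : nat) (r t : nat -> nat -> nat) (j : nat) : nat :=
  if (j < j0)%N then 'C(t i j, r i j)
  else if (j0 < j)%N then 'C(t i.+1 j, r i.+1 j) else 1%N.

Definition garnir (K i j0 : nat) (r t : nat -> nat -> nat) : QT :=
  if `[< other_rows i t r >] then (\prod_(j < K) garnir_factor i j0 r t j)%N%:R else 0.

(** * Degree, expansion and support of the Garnir functions *)

Section Garnir.
Variables (l b : Lambda n) (z0 : XX l) (x0 : XX b) (i j0 K : nat).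
Hypotheses (i0 : (0 < i)%N) (i1j0 : (i = 1 -> j0 = 1)%N).
Hypotheses (lK : (kb l < K)%N) (bK : (kb b < K)%N).
Let r := ty z0 x0.
Hypothesis bad : (\sum_(u < j0) r i u < \sum_(u < j0.+1) r i.+1 u)%N.

Lemma garnir_top : garnir K i j0 r r = 1.
Proof.
rewrite /garnir asboolT// big1// => j _; rewrite /garnir_factor.
by case: ifP => _; [|case: ifP => _]; rewrite ?binn.
Qed.

(** If i = 1 then j0 = 1, so the columns before j0 avoid the infinite entry. *)
Lemma ty_sums_below (z : XX l) (x : XX b) j : other_rows i (ty z x) r -> (j < j0)%N ->
  (ty z x i j + ty z x i.+1 j = r i j + r i.+1 j)%N.
Proof.
move=> oth jj; apply: ty_two_rows => //; apply/negP => /andP[/eqP i1 /eqP j1].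
by move: jj; rewrite (i1j0 i1) j1.
Qed.

Lemma row_sum_below t j : (forall u, (K <= u)%N -> t u = 0%N) ->
  (\sum_(u < j) t u = \sum_(u < K) if (u < j)%N then t u else 0)%N.
Proof.
move=> tK; pose M := maxn K j.
rewrite (big_ord_widen M t (leq_maxr _ _)) big_mkcond.
rewrite (big_ord_widen M (fun u => if (u < j)%N then t u else 0%N) (leq_maxl _ _)).
rewrite [RHS]big_mkcond; apply: eq_bigr => u _.
by case: (ltnP u K) => // Ku; rewrite tK ?if_same.
Qed.

Lemma r_out u v : (K <= v)%N -> r u v = 0%N.
Proof. by move=> Kv; case: (eqVneq (r u v) 0%N) => // /ty_bound[_]; lia. Qed.

(** The violation says that row i before j0 weighs less than row i + 1 up to and including j0.
    Adding row i + 1 beyond j0 to both sides gives its full sum on the right; the gain comes from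
    leaving column j0 out of the product. *)
Lemma garnir_degree :
  (\sum_(j < K) (if (j < j0)%N then r i j else if (j0 < j)%N then r i.+1 j else 0)
   < wt l i.+1)%N.
Proof.
rewrite -(ty_row z0 x0 bK) ?ltnS// -/r.
move: bad; rewrite (row_sum_below _ (r_out i)) (row_sum_below _ (r_out i.+1)) => lt.
pose B := (\sum_(j < K) if (j0 < j)%N then r i.+1 j else 0)%N.
have -> : (\sum_(j < K) r i.+1 j =
    \sum_(j < K) (if (j < j0.+1)%N then r i.+1 j else 0) + B)%N.
  rewrite -big_split /=; apply: eq_bigr => j _.
  by rewrite ltnS; case: ltnP => _; rewrite ?addn0.
apply: (@leq_ltn_trans (\sum_(j < K) (if (j < j0)%N then r i j else 0) + B)%N).
  rewrite -big_split /=; apply: leq_sum => j _.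
  by case: (ltngtP j j0); rewrite ?addn0.
by rewrite ltn_add2r.
Qed.

(** Coefficients of the factor at column j in the binomials C(s_(i+1,j), c). Before j0, s_(i,j) is a
    fixed sum minus s_(i+1,j), so [bin_complement] applies; beyond j0 the factor is already a
    binomial, and at j0 it is constant. *)
Definition garnir_coef (j : nat) : nat -> int :=
  if (j < j0)%N then s2val (cid2 (bin_complement (r i j + r i.+1 j) (r i j)))
  else if (j0 < j)%N then fun c => (c == r i.+1 j)%:R else fun c => (c == 0%N)%:R.

Lemma garnir_coef0 j c : garnir_coef j c != 0 ->
  (c <= if (j < j0)%N then r i j else if (j0 < j)%N then r i.+1 j else 0)%N.
Proof.
rewrite /garnir_coef; case: ifP => _.
  by case: cid2 => f /= f0 _; apply: contraNT; rewrite -ltnNge => /f0 ->.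
by case: ifP => _; case: (eqVneq c) => // ->.
Qed.

Lemma garnir_factorE (z : XX l) (x : XX b) D j : other_rows i (ty z x) r ->
  (r i j < D)%N -> (r i.+1 j < D)%N ->
  (garnir_factor i j0 r (ty z x) j)%:R =
  \sum_(c < D) garnir_coef j c * 'C(ty z x i.+1 j, c)%:R :> int.
Proof.
move=> oth rD rD'; rewrite /garnir_factor /garnir_coef; case: ifP => jj.
  have S := ty_sums_below oth jj; case: cid2 => f /= _ fE.
  rewrite -fE//; last by rewrite -S leq_addl.
  by rewrite -S addnK.
have single e : (e < D)%N ->
    'C(ty z x i.+1 j, e)%:R = \sum_(c < D) (c == e :> nat)%:R * 'C(ty z x i.+1 j, c)%:R :> int.
  move=> eD; rewrite (bigD1 (Ordinal eD))//= eqxx mul1r big1 ?addr0// => c.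
  by rewrite -val_eqE /= => /negbTE ->; rewrite mul0r.
case: ifP => _; first exact: single.
by rewrite -(single 0%N) ?bin0//; apply: leq_ltn_trans rD.
Qed.

Lemma straightened_garnir : straightened (ty_hom l b (garnir K i j0 r)).
Proof.
pose D := (\sum_(j < K) (r i j + r i.+1 j)).+1.
have rD j : (r i j < D)%N /\ (r i.+1 j < D)%N.
  have [jK|Kj] := ltnP j K; last by rewrite !r_out.
  by rewrite /D (bigD1 (Ordinal jK))//=; lia.
pose ext (Y : {ffun 'I_K -> 'I_D}) (j : nat) : nat :=
  if insub j is Some u then nat_of_ord (Y u) else 0%N.
have extE Y (j : 'I_K) : ext Y j = Y j by rewrite /ext valK.
have extK Y j : (K <= j)%N -> ext Y j = 0%N.
  by move=> Kj; rewrite /ext insubF// ltnNge Kj.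
have -> : ty_hom l b (garnir K i j0 r) = \sum_(Y : {ffun 'I_K -> 'I_D})
    ((\prod_(j < K) garnir_coef j (Y j))%:~R : QT) *:
      ty_hom l b (row_binomials K i r (ext Y)).
  apply: Hom_ext => z x; rewrite sum_HomE /= /garnir /row_binomials.
  case: asboolP => oth; last by rewrite big1// => Y _; rewrite mulr0.
  transitivity ((\prod_(j < K) \sum_(c < D) garnir_coef j c *
      'C(ty z x i.+1 j, c)%:R)%:~R : QT).
    rewrite pmulrn; congr (_%:~R); rewrite -natz natr_prod; apply: eq_bigr => j _.
    by apply: garnir_factorE => //; case: (rD j).
  rewrite bigA_distr_bigA rmorph_sum /=; apply: eq_bigr => Y _.
  rewrite big_split /= rmorphM /=; congr (_ * _).
  rewrite [RHS]pmulrn; congr (_%:~R); rewrite -natz natr_prod.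
  by apply: eq_bigr => j _; rewrite extE.
apply: straightened_sum => Y.
have [->|ne] := eqVneq (\prod_(j < K) garnir_coef j (Y j)) 0.
  by rewrite scale0r; apply: Straightened0.
apply: StraightenedZ; first exact: ival_intr.
apply: straightened_row_binomials => //; first exact: extK.
(* A nonzero coefficient bounds each value of Y by the degree of the factor in that column. *)
apply: leq_ltn_trans garnir_degree; apply: leq_sum => j _; rewrite extE.
by apply: garnir_coef0; move/prodf_neq0: ne; apply.
Qed.

(** Nonzero binomials give s_(i,j) >= r_(i,j), hence s_(i+1,j) <= r_(i+1,j), before j0, and
    s_(i+1,j) >= r_(i+1,j) beyond j0: the situation of [weighted_sum_lt]. If row i + 1 agrees with
    r, the column sums force row i. *)
Lemma garnir_lower (z : XX l) (x : XX b) : garnir K i j0 r (ty z x) != 0 ->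
  ty z x = r \/ (psi K (ty z x) < psi K r)%N.
Proof.
set t := ty z x; rewrite /garnir; case: asboolP => [oth|]; last by rewrite eqxx.
move=> prod0; have fpos j : (j < K)%N -> (0 < garnir_factor i j0 r t j)%N.
  move=> jK; rewrite lt0n; apply: contra_neq prod0 => f0.
  by rewrite (bigD1 (Ordinal jK))//= f0 mul0n.
have sums : (\sum_(j < K) t i.+1 j = \sum_(j < K) r i.+1 j)%N.
  by rewrite !ty_row.
have [j jj jK|j jj jK|eq_row|lt] := @weighted_sum_lt K j0 (t i.+1) (r i.+1) sums.
- have := fpos j jK; rewrite /garnir_factor jj bin_gt0.
  by have := ty_sums_below oth jj; rewrite -/t; lia.
- have := fpos j jK; have njj : (j < j0)%N = false by lia.
  by rewrite /garnir_factor njj jj bin_gt0.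
- left; have row1 j : t i.+1 j = r i.+1 j.
    have [/eq_row//|Kj] := ltnP j K; rewrite r_out//.
    by case: (eqVneq (t i.+1 j) 0%N) => // /ty_bound[_]; lia.
  apply/funext => u; apply/funext => j.
  have [->|ui] := eqVneq u i; last first.
    by have [->|ui1] := eqVneq u i.+1; [exact: row1|exact: oth].
  have [ij|ij] := boolP ((i == 1%N) && (j == 1%N)); first by rewrite /t /r /ty ij.
  by have := ty_two_rows i0 ij oth; rewrite -/t -/r row1; lia.
right; have iK : (i.+1 < K)%N.
  rewrite (leq_trans _ lK)// ltnS ltnW// ltnNge; apply/negP => /kbP w0.
  by have := garnir_degree; rewrite w0.
rewrite /psi; pose rho (q : nat -> nat -> nat) u := (\sum_(j < K) (K - j) * q u j)%N.
rewrite (sum_two_rows (fun u => u.-1 * rho t u)%N iK).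
rewrite (sum_two_rows (fun u => u.-1 * rho r u)%N iK).
rewrite (eq_bigr (fun u : 'I_K => u.-1 * rho r u)%N); last first.
  move=> u /andP[ui ui1]; congr muln; apply: eq_bigr => j _.
  by rewrite oth.
rewrite ltn_add2r [i.+1.-1]/=.
have rho1 : (rho t i.+1 < rho r i.+1)%N by [].
(* Row i + 1 is weighted once more than row i, and both rows together agree columnwise, so [psi]
   drops exactly as [rho] does on row i + 1. For i = 1 the factor 0 hides the infinite column. *)
have rhoS : (i.-1 * (rho t i + rho t i.+1) = i.-1 * (rho r i + rho r i.+1))%N.
  have [i1|i1] := eqVneq i 1%N; first by rewrite i1.
  congr muln; rewrite /rho -!big_split /=; apply: eq_bigr => j _.
  rewrite -!mulnDr; congr muln; apply: ty_two_rows => //.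
  by rewrite (negbTE i1).
have iE : i = i.-1.+1 by rewrite prednK.
move: rhoS; rewrite !mulnDr [X in (_ + X * _ < _ + X * _)%N]iE !mulSn; lia.
Qed.

End Garnir.

Lemma iHom_garnir l b K i j0 r : iHom (ty_hom l b (garnir K i j0 r)).
Proof.
move=> z x; rewrite /= /garnir; case: ifP => _; last exact: ival0.
exact: ival_natr.
Qed.

Lemma straightened_iHom l b (f : Hom (XX b) (XX l)) : iHom f -> straightened f.
Proof.
pose K := (maxn (kb l) (kb b)).+1.
have lK : (kb l < K)%N by rewrite /K; lia.
have bK : (kb b < K)%N by rewrite /K; lia.
have XIS N (z : XX l) (x : XX b) : (psi K (ty z x) < N)%N ->
    straightened (XI l b (ty z x)).
  elim: N z x => // N IH z0 x0; rewrite ltnS => psiN.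
  have [gd|ngd] := pselect (good (ty z0 x0)); first exact: Straightened_good.
  apply: contrapT => nst; apply: ngd => i j i0 j0 ij; rewrite leqNgt.
  apply/negP => bad; apply: nst.
  pose r := ty z0 x0; pose G := ty_hom l b (garnir K i j r).
  (* The leading term cancels in [G'], which is thus supported on types of smaller [psi]. *)
  pose G' := G + (-1) *: XI l b r.
  have -> : XI l b (ty z0 x0) = G + (-1) *: G'.
    by rewrite /G' scalerDr scalerA mulN1r opprK scale1r addrA scaleN1r subrr add0r.
  apply: StraightenedD; first exact: straightened_garnir.
  apply: StraightenedZ; first exact: (ival_intr (-1)).
  apply: iHom_decompose => [|g h|z x]; [exact: Straightened0|exact: StraightenedD|].
  have G'i : iHom G'.
    apply: iHomD; first exact: iHom_garnir.
    by apply: iHomZ; [exact: (ival_intr (-1))|exact: iHom_XI].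
  move=> G'0; apply: StraightenedZ => //; apply: IH.
  have : G' z x = garnir K i j r (ty z x) - (if `[< ty z x = r >] then 1 else 0).
    by rewrite /= mulN1r.
  case: asboolP => [e|ne] G'E.
    by move: G'0; rewrite G'E e garnir_top subrr eqxx.
  move: G'0; rewrite G'E subr0 => /(garnir_lower i0 ij lK bK bad) [//|lt].
  exact: leq_trans psiN.
move=> fi; apply: iHom_decompose => [|g h|z x _]; [exact: Straightened0|exact: StraightenedD|].
by apply: StraightenedZ; [exact: fi|exact: XIS (ltnSn _)].
Qed.

Lemma iHom_straightened l b (f : Hom (XX b) (XX l)) : straightened f -> iHom f.
Proof.
elim=> {f} [|f g _ fi _ gi|a f ai _ fi|z x _|m u v _ ui vi].
- exact: iHom0.
- exact: iHomD.
- exact: iHomZ.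
- exact: iHom_XI.
- exact: iHom_comp.
Qed.

End Straightening.

Local Open Scope classical_set_scope.

(** * Spanning by the codeterminants *)

Section Spanning.
Variable n : option nat.
Implicit Types b d l m : Lambda n.

Lemma htrD d b (f g : Hom (XX b) (XX d)) : htr (f + g) = htr f + htr g.
Proof. exact: Hom_ext. Qed.

Lemma htrZ d b a (f : Hom (XX b) (XX d)) : htr (a *: f) = a *: htr f.
Proof. exact: Hom_ext. Qed.

Lemma htr0 d b : htr (0 : Hom (XX b) (XX d)) = 0.
Proof. exact: Hom_ext. Qed.

Lemma hcomp_htr d l b (h : Hom (XX d) (XX l)) (f : Hom (XX b) (XX l)) :
  hcomp (htr h) f = htr (hcomp (htr f) h).
Proof. by rewrite htr_comp htrK. Qed.

Lemma XI_htr d l (y : XX l) (z : XX d) : htr (XI l d (ty y z)) = XI d l (ty z y).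
Proof.
rewrite XI_tr; congr XI; apply/funext => i; apply/funext => j; exact: tyC.
Qed.

(** A factorization of either factor through m is absorbed by reassociation, which makes m the
    middle weight. What remains is a composite of two good basis elements, which is a
    codeterminant. *)
Lemma Tspan_comp l d b (g : Hom (XX l) (XX d)) (f : Hom (XX b) (XX l)) :
  iHom g -> iHom f -> Tspan n (Hom_to_Salg (hcomp g f)).
Proof.
have [N] := ubnP (phi l); elim: N => // N IH in l g f *.
rewrite ltnS => lN gi fi.
elim: (straightened_iHom fi) => {f fi} [|f f' fS Tf fS' Tf'|a f ai fS Tf|y' x gx|m u v ml ui vi].
- by rewrite hcomp0r Hom_to_Salg0; apply: Tspan0.
- rewrite hcompDr//; [|exact: iHom_straightened|exact: iHom_straightened].
  by rewrite Hom_to_SalgD; apply: TspanD.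
- rewrite hcompZr//; last exact: iHom_straightened.
  by rewrite Hom_to_SalgZ; apply: TspanZ.
- have fi : iHom (XI l b (ty y' x)) by apply: iHom_XI.
  set f := XI l b (ty y' x) in fi *.
  (* The transpose of g maps into [XX l], so straightening applies to it; [hcomp_htr] transfers
     linearity from the right argument to the left one. *)
  rewrite -[g]htrK; elim: (straightened_iHom (iHom_tr gi)) => {g gi}
      [|h h' hS Th hS' Th'|a h ai hS Th|y z gz|m u v ml ui vi].
  + by rewrite htr0 hcomp0l Hom_to_Salg0; apply: Tspan0.
  + rewrite hcomp_htr hcompDr; [|exact: iHom_tr|exact: iHom_straightened|exact: iHom_straightened].
    by rewrite htrD -!hcomp_htr Hom_to_SalgD; apply: TspanD.
  + rewrite hcomp_htr hcompZr//; [|exact: iHom_tr|exact: iHom_straightened].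
    by rewrite htrZ -hcomp_htr Hom_to_SalgZ; apply: TspanZ.
  + by rewrite XI_htr; apply: Tspan_CB; apply: CB_good.
  + rewrite htr_comp -hcompA//; [|exact: iHom_tr|exact: iHom_tr].
    apply: (IH m); first exact: leq_trans lN.
      exact: iHom_tr.
    by apply: iHom_comp => //; apply: iHom_tr.
- rewrite hcompA//; apply: (IH m) => //; first exact: leq_trans lN.
  exact: iHom_comp.
Qed.

Definition hid d : Hom (XX d) (XX d) :=
  @MkHom (XX d) (XX d) (fun y x => if y == x then 1 else 0)
    (fun s y x => congr1 (fun c : bool => if c then 1 else 0)
       (inj_eq (can_inj (factK s)) y x)).

Lemma iHom_id d : iHom (hid d).
Proof. by move=> y x /=; case: ifP => _; [apply: ival1|apply: ival0]. Qed.

Lemma hcomp_id d b (f : Hom (XX b) (XX d)) : iHom f -> hcomp (hid d) f = f.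
Proof.
move=> fi; have ii : iHom (hid d) by exact: iHom_id.
  apply: iHom_ext => [||p z x zp xp] //.
  exact: iHom_comp.
rewrite hcomp_ev// (bigD1_seq z) ?lv_uniq//=; last exact/mem_lv.
rewrite eqxx ev1 mul1r big1 ?addr0// => y /negbTE yz.
by rewrite eq_sym yz ev0 mul0r.
Qed.

(** Inserting the identity of [XX d] makes f a composite with middle weight d. *)
Lemma Tspan_iHom d b (f : Hom (XX b) (XX d)) : iHom f -> Tspan n (Hom_to_Salg f).
Proof. by move=> fi; rewrite -(hcomp_id fi); apply: Tspan_comp => //; apply: iHom_id. Qed.

Lemma scomp_sum (I : Type) (r : seq I) (F : I -> Salg n) db :
  (\sum_(i <- r) F i) db = \sum_(i <- r) F i db.
Proof. by elim: r => [|i r IH]; rewrite ?big_nil// !big_cons -IH. Qed.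

Lemma iHom_to_Salg d b (f : Hom (XX b) (XX d)) db : iHom f -> iHom (Hom_to_Salg f db).
Proof.
move=> fi; have [->|/eqP ndb] := eqVneq db (d, b); first by rewrite Hom_to_Salg_in.
by rewrite Hom_to_Salg_out//; apply: iHom0.
Qed.

Lemma iHom_xi_hom d b q : iHom (xi_hom d b q).
Proof. by move=> y x /=; case: ifP => _; [apply: ival1|apply: ival0]. Qed.

(** A codeterminant is a composite of functions with values 0 and 1, so [iHom_comp] applies. *)
Lemma Tspan_scomp (x : Salg n) db : Tspan n x -> iHom (x db).
Proof.
move=> [m [a [c [ai cc ->]]]]; rewrite scomp_sum.
elim/big_ind: _ => [|f g|k _]; [exact: iHom0|exact: iHomD|].
apply: iHomZ; first by exists (a k).
have [l _ [_ [d _ [q _ <-]] [_ [b _ [r _ <-]] <-]]] := cc k.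
rewrite /xi smul_Hom_to_Salg; apply: iHom_to_Salg.
by apply: iHom_comp; apply: iHom_xi_hom.
Qed.

Lemma Tspan_of_scomp (x : Salg n) : (forall db, iHom (x db)) -> Tspan n x.
Proof.
move=> xi; have /finite_seqP[s sE] := scomp_fin x.
have -> : x = \sum_(db <- undup s) @Hom_to_Salg n db.1 db.2 (x db).
  apply: Salg_ext => db; rewrite scomp_sum.
  have [dbs|dbs] := boolP (db \in undup s).
    rewrite (bigD1_seq db) ?undup_uniq//= big1_seq ?addr0.
      by case: db {dbs} => d b /=; rewrite dfwith_in.
    move=> [d b] /andP[ndb _]; rewrite -[LHS]/(Hom_to_Salg (x (d, b)) db).
    by rewrite Hom_to_Salg_out// => e; rewrite e eqxx in ndb.
  rewrite big1_seq; last first.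
    move=> [d b] /andP[_ ms]; rewrite -[LHS]/(Hom_to_Salg (x (d, b)) db).
    by rewrite Hom_to_Salg_out// => e; rewrite e ms in dbs.
  apply: scomp_out; rewrite sE /= => ms; by rewrite mem_undup ms in dbs.
by apply: Tspan_sum => -[d b]; apply: Tspan_iHom.
Qed.

End Spanning.

Theorem proposition6p2p5 (n : option nat) (hn : n <> Some 0%N)
    (x y : Salg n) (hx : Tspan n x) (hy : Tspan n y) :
  Tspan n (smul x y).
Proof.
apply: Tspan_of_scomp => db; rewrite -[smul x y db]/(smul_fun x y db) /smul_fun.
elim/big_ind: _ => [|f g|c _]; [exact: iHom0|exact: iHomD|].
by apply: iHom_comp; [exact: (@Tspan_scomp n x (db.1, c : Lambda n) hx)|
  exact: (@Tspan_scomp n y (c : Lambda n, db.2) hy)].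
Qed.
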